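(* Let $n\ge1$ and $\alpha\in(0,1)$. There exists $f\in BV^\alpha(\mathbb R^n)$ such that $$\int_{\mathbb R}|D^\alpha\chi_{\{f>t\}}|(\mathbb R^n)\,dt=+\infty.$$
   Context: For $\alpha\in(0,1)$ let $\mu_{n,\alpha}:=2^\alpha\pi^{-n/2}\,\Gamma\big(\tfrac{n+\alpha+1}{2}\big)/\Gamma\big(\tfrac{1-\alpha}{2}\big)$. For $\varphi\in C^\infty_c(\mathbb R^n;\mathbb R^n)$ the fractional $\alpha$-divergence is $$\mathrm{div}^\alpha\varphi(x):=\mu_{n,\alpha}\int_{\mathbb R^n}\frac{(y-x)\cdot(\varphi(y)-\varphi(x))}{|y-x|^{n+\alpha+1}}\,dy,$$ which is a function in $L^1(\mathbb R^n)\cap L^\infty(\mathbb R^n)$. $BV^\alpha(\mathbb R^n)$ is the space of $f\in L^1(\mathbb R^n)$ with $\sup\{\int_{\mathbb R^n}f\,\mathrm{div}^\alpha\varphi\,dx:\ \varphi\in C^\infty_c(\mathbb R^n;\mathbb R^n),\ \|\varphi\|_{L^\infty}\le1\}<+\infty$. For a measurable set $E\subset\mathbb R^n$ (possibly of infinite measure), $$|D^\alpha\chi_E|(\mathbb R^n):=\sup\Big\{\int_E\mathrm{div}^\alpha\varphi\,dx:\ \varphi\in C^\infty_c(\mathbb R^n;\mathbb R^n),\ \|\varphi\|_{L^\infty(\mathbb R^n;\mathbb R^n)}\le1\Big\}\in[0,+\infty].$$ $\{f>t\}:=\{x\in\mathbb R^n:f(x)>t\}$. *)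

(* Defs.v *)
From HB Require Import structures.
From mathcomp Require Import all_boot all_order all_algebra.
From mathcomp Require Import all_classical all_reals all_analysis.
Import Order.TTheory GRing.Theory Num.Theory.
Import numFieldNormedType.Exports.

Set Implicit Arguments.
Unset Strict Implicit.
Unset Printing Implicit Defensive.

Local Open Scope classical_set_scope.
Local Open Scope ring_scope.

Definition rV_display : measure_display. Proof. exact. Qed.

(* 'rV[R]_n carries the product sigma-algebra, generated by the coordinates;
   it coincides with the Borel sigma-algebra. *)
Section measurable_rV.
Context (R : realType) (n : nat).

Let coord (i : 'I_n) (x : 'rV[R]_n) : measurableTypeR R := x ord0 i.

Let rV_set0 : g_sigma_preimage coord set0.
Proof. exact: sigma_algebra0. Qed.

Let rV_setC A : g_sigma_preimage coord A -> g_sigma_preimage coord (~` A).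
Proof. exact: sigma_algebraC. Qed.

Let rV_bigcup (F : (set 'rV[R]_n)^nat) :
  (forall i, g_sigma_preimage coord (F i)) ->
  g_sigma_preimage coord (\bigcup_i (F i)).
Proof. exact: sigma_algebra_bigcup. Qed.

HB.instance Definition _ := @isMeasurable.Build rV_display
  'rV[R]_n (g_sigma_preimage coord) rV_set0 rV_setC rV_bigcup.

Lemma measurable_coord_rV (i : 'I_n) :
  measurable_fun [set: 'rV[R]_n]
    ((fun x => x ord0 i) : 'rV[R]_n -> measurableTypeR R).
Proof.
move=> _ Y mY; rewrite setTI; apply: sub_sigma_algebra => /=.
rewrite -bigcup_seq/=; exists i => /=; first by rewrite mem_index_enum.
by exists Y => //; rewrite setTI.
Qed.

Lemma measurable_fun_rVP d (T : measurableType d) (f : T -> 'rV[R]_n) :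
  (forall i, measurable_fun [set: T]
    ((fun t => f t ord0 i) : T -> measurableTypeR R)) ->
  measurable_fun [set: T] f.
Proof.
move=> mf.
have : g_sigma_preimage (fun i => coord i \o f) `<=` measurable.
  apply: smallest_sub; first exact: sigma_algebra_measurable.
  rewrite -bigcup_seq => A [i _ [B mB <-]]; exact: mf.
rewrite g_sigma_preimage_comp => prefS _ A mA.
by apply: prefS; exists A.
Qed.

End measurable_rV.

Section lebesgue_measure_rV.
Context (R : realType).

Definition consrV n (p : measurableTypeR R * 'rV[R]_n) : 'rV[R]_n.+1 :=
  \row_(i < n.+1) oapp (fun j => p.2 ord0 j) p.1 (unlift ord0 i).

Definition unconsrV n (x : 'rV[R]_n.+1) : measurableTypeR R * 'rV[R]_n :=
  (x ord0 ord0, \row_(j < n) x ord0 (lift ord0 j)).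

Lemma consrVK n : cancel (@consrV n) (@unconsrV n).
Proof.
move=> [a x]; rewrite /unconsrV mxE unlift_none/=; congr pair.
by apply/rowP => j; rewrite !mxE liftK.
Qed.

Lemma measurable_consrV n : measurable_fun [set: _] (@consrV n).
Proof.
apply: measurable_fun_rVP => i.
case: (unliftP ord0 i) => [j|] ->.
- rewrite (_ : (fun _ => _) = (fun x : 'rV[R]_n => x ord0 j) \o snd); last first.
    by apply/funext => p; rewrite /consrV mxE liftK.
  by apply: measurableT_comp => //; exact: measurable_coord_rV.
- rewrite (_ : (fun _ => _) = fst)//.
  by apply/funext => p; rewrite /consrV mxE unlift_none.
Qed.

Lemma measurable_unconsrV n : measurable_fun [set: _] (@unconsrV n).
Proof.
apply/measurable_fun_pairP; split.
  exact: measurable_coord_rV.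
apply: measurable_fun_rVP => i /=.
under eq_fun do rewrite mxE.
exact: measurable_coord_rV.
Qed.


Section step.
Context n (mu : {sigma_finite_measure set 'rV[R]_n -> \bar R}).
Local Open Scope ereal_scope.

Definition consrV_measure : set 'rV[R]_n.+1 -> \bar R :=
  pushforward (@lebesgue_measure R \x mu) (@consrV n).

Let consrV_measure0 : consrV_measure set0 = 0.
Proof. by rewrite /consrV_measure /pushforward preimage_set0 measure0. Qed.

Let consrV_measure_ge0 A : 0 <= consrV_measure A.
Proof. by rewrite /consrV_measure /pushforward; exact: measure_ge0. Qed.

Let consrV_measure_sigma_additive : semi_sigma_additive consrV_measure.
Proof.
move=> F mF tF mUF; rewrite /consrV_measure /pushforward preimage_bigcup.
apply: measure_semi_sigma_additive.
- by move=> k; rewrite -[X in measurable X]setTI; exact: measurable_consrV.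
- apply/trivIsetP => /= i j _ _ ij; rewrite -preimage_setI.
  by move/trivIsetP : tF => /(_ _ _ _ _ ij) ->//; rewrite preimage_set0.
- rewrite -preimage_bigcup -[X in measurable X]setTI.
  exact: measurable_consrV.
Qed.

HB.instance Definition _ := isMeasure.Build _ _ _ consrV_measure
  consrV_measure0 consrV_measure_ge0 consrV_measure_sigma_additive.

Let consrV_measure_sigma_finite : sigma_finite [set: 'rV[R]_n.+1] consrV_measure.
Proof.
have /sigma_finiteP[F [TF ndF Foo]] := sigma_finiteT (@lebesgue_measure R).
have /sigma_finiteP[G [TG ndG Goo]] := sigma_finiteT mu.
exists (fun k => @unconsrV n @^-1` (F k `*` G k)).
  apply/seteqP; split => // x _.
  have [k _ Fk] : (\bigcup_k F k) (unconsrV x).1 by rewrite -TF.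
  have [l _ Gl] : (\bigcup_k G k) (unconsrV x).2 by rewrite -TG.
  exists (maxn k l) => //; split.
    by move: Fk; exact/subsetPset/ndF/leq_maxl.
  by move: Gl; exact/subsetPset/ndG/leq_maxr.
move=> k; have [mF Fk] := Foo k; have [mG Gk] := Goo k; split.
  rewrite -[X in measurable X]setTI; apply: measurable_unconsrV => //.
  exact: measurableX.
rewrite /consrV_measure /pushforward -comp_preimage.
rewrite (_ : @unconsrV n \o @consrV n = id); last first.
  by apply/funext => p /=; rewrite consrVK.
by rewrite preimage_id product_measure1E// lte_mul_pinfty// ge0_fin_numE.
Qed.

HB.instance Definition _ := Measure_isSigmaFinite.Build _ _ _ consrV_measure
  consrV_measure_sigma_finite.

End step.

Fixpoint lebesgue_rV (n : nat) : {sigma_finite_measure set 'rV[R]_n -> \bar R} :=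
  match n with
  | 0 => @dirac _ 'rV[R]_0 0 R
  | m.+1 => consrV_measure (lebesgue_rV m)
  end.

Lemma lebesgue_rV_box n (A : 'I_n -> set (measurableTypeR R)) :
  (forall i, measurable (A i)) ->
  lebesgue_rV n [set x : 'rV[R]_n | forall i, A i (x ord0 i)] =
  (\prod_(i < n) lebesgue_measure (A i))%E.
Proof.
elim: n A => [|n IHn] A mA /=.
  by rewrite big_ord0 diracE mem_set//= => -[].
rewrite big_ord_recl -IHn// -product_measure1E//; last first.
  rewrite (_ : mkset _ = \bigcap_(i in [set: 'I_n])
      ((fun x : 'rV[R]_n => x ord0 i) @^-1` A (lift ord0 i))); last first.
    by apply/seteqP; split=> x /= Ax i; [move=> _|]; exact: Ax.
  apply: fin_bigcap_measurable => // i _.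
  rewrite -[X in measurable X]setTI; exact: measurable_coord_rV.
rewrite /consrV_measure /pushforward; congr product_measure1.
apply/seteqP; split => -[a x] /=.
- move=> Aax; split.
    by have := Aax ord0; rewrite mxE unlift_none.
  by move=> i; have := Aax (lift ord0 i); rewrite mxE liftK.
- move=> [Aa Ax] i; rewrite mxE.
  by case: (unliftP ord0 i) => [j|] ->.
Qed.

End lebesgue_measure_rV.

Section fractional_variation.
Context (R : realType).

Definition Gamma (s : R) : R :=
  \int[@lebesgue_measure R]_(t in `]0, +oo[) (t `^ (s - 1) * expR (- t)).

(* The norm `|x| of 'rV[R]_n is the sup norm. *)
Definition dotrV n (x y : 'rV[R]_n) : R := \sum_(i < n) x ord0 i * y ord0 i.

Definition enorm n (x : 'rV[R]_n) : R := Num.sqrt (dotrV x x).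

Fixpoint Ck (V W : normedModType R) (k : nat) (f : V -> W) : Prop :=
  match k with
  | 0 => continuous f
  | j.+1 => (forall x, differentiable f x) /\
            (forall v, Ck j (fun x => 'D_v f x))
  end.

Definition smooth (V W : normedModType R) (f : V -> W) :=
  forall k, Ck k f.

Definition compactly_supported (V W : normedModType R) (f : V -> W) :=
  compact (closure [set x | f x != 0]).

Definition frac_const n (alpha : R) : R :=
  2 `^ alpha * pi `^ (- (n%:R / 2)) *
  Gamma ((n%:R + alpha + 1) / 2) / Gamma ((1 - alpha) / 2).

Definition frac_div n (alpha : R) (phi : 'rV[R]_n -> 'rV[R]_n) (x : 'rV[R]_n)
    : R :=
  frac_const n alpha *
  \int[lebesgue_rV R n]_y
    (dotrV (y - x) (phi y - phi x) / enorm (y - x) `^ (n%:R + alpha + 1)).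

Definition unit_test_field n : set ('rV[R]_n -> 'rV[R]_n) :=
  [set phi | [/\ smooth phi, compactly_supported phi &
    ('N[lebesgue_rV R n]_+oo[EFin \o (@enorm n \o phi)] <= 1)%E]].

Local Open Scope ereal_scope.

Definition frac_variation n (alpha : R) (f : 'rV[R]_n -> R) : \bar R :=
  ereal_sup [set \int[lebesgue_rV R n]_x (f x * frac_div alpha phi x)%:E
            | phi in @unit_test_field n].

Definition frac_BV n (alpha : R) : set ('rV[R]_n -> R) :=
  [set f | (lebesgue_rV R n).-integrable setT (EFin \o f) /\
           frac_variation alpha f < +oo].

Definition frac_perimeter n (alpha : R) (E : set 'rV[R]_n) : \bar R :=
  ereal_sup [set \int[lebesgue_rV R n]_(x in E) (frac_div alpha phi x)%:E
            | phi in @unit_test_field n].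

End fractional_variation.

(* Main.v *)
(* The function is [f x = sgn x_0 |x_0|^(a-1) eta x'], cut off to [|x_0| < 1],
   where [x = (x_0, x')], [a = alpha] and [eta] is a Lipschitz cutoff.

   Why [f] is in BV^alpha. Pairing [f] with the fractional divergence of a test
   field [phi] gives, for each component, the integral of the kernel
   [h_i |h|^(-n-a-1)] against increments of the correlation
   [C h = int f x phi(x + h) dx].  By oddness of the kernel only
   [C h - C (h with h_i reversed)] matters. This is O(min(1, |h|)) whenever the
   first coordinate is left unchanged, because [f] is Lipschitz in mean in the
   directions of [x']. For [i = 0] one is left, after integrating out [h'], with
   [int kfun(t) int g(x) (Psi(x + t) - Psi(x - t)) dx dt] on the line, where
   [g x = sgn x |x|^(a-1)] and [Psi] is bounded. Substituting [t = x z], the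
   powers of [x] combine to [1/|x|], and the inner integral is of Frullani type:
   it is bounded by [sup |Psi|] times the logarithmic length of
   [||z| - 1| <= |s| < 1 + |z|], which makes the integral in [z] converge.

   Why the coarea integral diverges. For [t >= 1] put [s = t^(-1/(1-a))]. The set
   [{f > t}] lies in [{x_0 > 0}] and contains a layer of thickness [s] next to
   the hyperplane [x_0 = 0]. A test field [- psi e_0] with [psi >= 0] supported
   at distance at most [3 s] on the other side of this hyperplane has nonnegative
   fractional divergence on [{x_0 > 0}], and at least [c s^(-a)] on the layer.
   Hence the perimeter of [{f > t}] is at least [c s^(1-a) = c/t]. *)
Require Import Defs.
From mathcomp Require Import all_boot all_order all_algebra.
From mathcomp Require Import all_classical all_reals all_analysis.
From mathcomp Require Import measurable_realfun ess_sup_inf lra.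
Import Order.TTheory GRing.Theory Num.Theory.
Import numFieldNormedType.Exports.

Set Implicit Arguments.
Unset Strict Implicit.
Unset Printing Implicit Defensive.

Local Open Scope classical_set_scope.
Local Open Scope ring_scope.

(** * Integration preliminaries *)

(** The exponent [a - 1] is dictated by homogeneity. On the line, the Riesz potential of order
    [1 - a] of sgn x |x|^(a-1) is odd and homogeneous of degree 0, hence a multiple of sgn, so the
    fractional derivative of order [a] is a multiple of a Dirac mass. The even profile |x|^(a-1)
    would give a logarithm, whose derivative is not a measure. Finite variation thus rests on a
    cancellation between the two sides of the hyperplane, and the superlevel sets, which see the
    positive side only, lose it. The same homogeneity puts the lower bound for their perimeters at
    1/t, the borderline of divergence. The obstacle in the upper bound is uniformity. Test fields
    are bounded by 1, but their Lipschitz constants [L] are arbitrary, while each use of Fubini or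
    of a substitution asks for absolute integrability, which is obtained from [L]. Hence the
    estimates come in two kinds: those with [L], which serve measurability and integrability alone,
    and those free of [L], which enter the final constant. *)

Section measure_preserving.
Context d (T : measurableType d) (R : realType) (mu : {measure set T -> \bar R}).
Local Open Scope ereal_scope.

Definition measure_preserving (th : T -> T) :=
  measurable_fun setT th /\
  forall A, measurable A -> mu (th @^-1` A) = mu A.

Lemma ge0_integral_preserving th (f : T -> \bar R) : measure_preserving th ->
  measurable_fun setT f -> (forall x, 0 <= f x) ->
  \int[mu]_x f (th x) = \int[mu]_x f x.
Proof.
move=> [mth th_mu] mf f0.
transitivity (\int[pushforward mu th]_x f x).
  by rewrite ge0_integral_pushforward.
by apply: eq_measure_integral => A mA _; exact: th_mu.
Qed.

Lemma integrable_preserving th (f : T -> \bar R) : measure_preserving th ->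
  mu.-integrable setT f -> mu.-integrable setT (f \o th).
Proof.
move=> mpth /integrableP[mf foo]; apply/integrableP; split.
  by apply: measurableT_comp => //; case: mpth.
rewrite (ge0_integral_preserving (f := abse \o f) mpth)//=.
exact: measurableT_comp.
Qed.

Lemma integral_preserving th (f : T -> \bar R) : measure_preserving th ->
  mu.-integrable setT f -> \int[mu]_x f (th x) = \int[mu]_x f x.
Proof.
move=> mpth fi; have [mth th_mu] := mpth.
transitivity (\int[pushforward mu th]_x f x).
  rewrite integral_pushforward//; first exact: measurable_int fi.
  exact: integrable_preserving.
by apply: eq_measure_integral => A mA _; exact: th_mu.
Qed.

Lemma Rintegral_preserving th (f : T -> R) : measure_preserving th ->
  mu.-integrable setT (EFin \o f) ->
  (\int[mu]_x f (th x) = \int[mu]_x f x)%R.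
Proof. by move=> ? ?; rewrite /Rintegral (integral_preserving (f := EFin \o f)). Qed.

(* The integral of a nonnegative function is a supremum over simple functions,
   so monotonicity needs no measurability. *)
Lemma ge0_le_integral_nomeas (D : set T) (f g : T -> \bar R) :
  (forall x, D x -> 0 <= f x) -> (forall x, D x -> f x <= g x) ->
  \int[mu]_(x in D) f x <= \int[mu]_(x in D) g x.
Proof.
move=> f0 fg.
have g0 x : D x -> 0 <= g x by move=> Dx; apply: le_trans (f0 _ Dx) (fg _ Dx).
rewrite integral_mkcond [leRHS]integral_mkcond.
rewrite ge0_integralTE; last exact: erestrict_ge0.
rewrite ge0_integralTE; last exact: erestrict_ge0.
apply: le_ereal_sup => _ [h hf <-]; exists h => // x.
apply: (le_trans (hf x)); rewrite /patch; case: ifPn => // /set_mem; exact: fg.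
Qed.

End measure_preserving.

Section lebesgue_affine.
Context (R : realType).
Notation mu := (@lebesgue_measure R).

Lemma measure_preserving_shift (a : R) :
  measure_preserving mu (fun x : measurableTypeR R => x + a).
Proof.
have ms : measurable_fun [set: measurableTypeR R]
    ((fun x => x + a) : measurableTypeR R -> measurableTypeR R).
  by apply: measurable_funD.
split => // A mA; apply/esym.
apply: (lebesgue_measure_unique (mu := pushforward mu _)) => //.
move=> _ [[u v] _ <-] /=.
rewrite /pushforward (_ : _ @^-1` _ = `](u - a), (v - a)]%classic); last first.
  by apply/seteqP; split=> x /=; rewrite !in_itv/= ltrBlDr lerBrDr.
by rewrite !lebesgue_measure_itv/= !lte_fin ltrD2r; case: ifP => // _; congr EFin; lra.
Qed.

Lemma measure_preserving_opp :
  measure_preserving mu (fun x : measurableTypeR R => - x).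
Proof.
split; first exact: oppr_measurable.
by move=> A mA; exact: lebesgue_measureN.
Qed.

(** By uniqueness of Lebesgue measure: [|a|] times the image measure under multiplication by [a]
    gives every half-open interval its length. A negative [a] exchanges the open and the closed end,
    which does not change the length. *)
Lemma ge0_integral_scale (a : R) (f : R -> \bar R) : a != 0 ->
  measurable_fun [set: measurableTypeR R] f -> (forall x, (0 <= f x)%E) ->
  (\int[mu]_x f (a * x)%R = `|a|^-1%:E * \int[mu]_x f x)%E.
Proof.
move=> a0 mf f0.
pose th : measurableTypeR R -> measurableTypeR R := fun x => a * x.
have ms : measurable_fun setT th by exact: mulrl_measurable.
have na : (0 <= `|a|)%R by [].
pose nu := mscale (NngNum na) (pushforward mu th).
have E (A : set R) : measurable (A : set (measurableTypeR R)) -> mu A = nu ms A.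
  apply: (@lebesgue_measure_unique R (nu ms) _ A) => _ [[u v] _ <-] /=.
  rewrite /nu /mscale /= /pushforward.
  have [ag|al] := ltP 0 a.
    rewrite (_ : _ @^-1` _ = `](u / a), (v / a)]%classic); last first.
      by apply/seteqP; split=> x /=; rewrite !in_itv/= ltr_pdivrMr// ler_pdivlMr// mulrC.
    rewrite !lebesgue_measure_itv/= !lte_fin ltr_pM2r ?invr_gt0//.
    case: ifP; last by rewrite mule0.
    move=> _; rewrite -!EFinD -EFinM; congr EFin; rewrite gtr0_norm//.
    by rewrite -mulrBl mulrC divfK.
  have {al}al : a < 0 by rewrite lt_neqAle a0.
  rewrite (_ : _ @^-1` _ = `[(v / a), (u / a)[%classic); last first.
    by apply/seteqP; split=> x /=; rewrite !in_itv/= ltr_ndivlMr// ler_ndivrMr// mulrC andbC.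
  rewrite !lebesgue_measure_itv/= !lte_fin ltr_nM2r ?invr_lt0//.
  case: ifP; last by rewrite mule0.
  move=> _; rewrite -!EFinD -EFinM; congr EFin; rewrite ltr0_norm//.
  by rewrite -mulrBl mulNr mulrCA divff// mulr1 opprB.
have -> : (\int[mu]_x f x = \int[nu ms]_x f x)%E.
  by apply: eq_measure_integral => A mA _; exact: E.
rewrite ge0_integral_mscale// ge0_integral_pushforward//.
by rewrite muleA -EFinM/= mulVf ?normr_eq0// mul1e.
Qed.

End lebesgue_affine.

(** Monotone convergence in the form of a bound. It passes from compact intervals, where the
    fundamental theorem of calculus applies, to improper integrals. *)
Lemma ge0_integral_bigcup_le d (T : measurableType d) (R : realType)
    (mu : {measure set T -> \bar R}) (F : (set T)^nat) (f : T -> \bar R) C :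
  nondecreasing_seq F -> (forall k, measurable (F k)) ->
  measurable_fun setT f -> (forall x, (0 <= f x)%E) ->
  (forall k, (\int[mu]_(x in F k) f x <= C)%E) ->
  (\int[mu]_(x in \bigcup_k F k) f x <= C)%E.
Proof.
move=> ndF mF mf f0 FC.
have mf' i : measurable_fun (F i) f by exact: measurable_funTS.
have cv := @ge0_nondecreasing_set_cvg_integral _ _ _ F f mu ndF mF mf' (fun _ x _ => f0 x).
rewrite -(cvg_lim (@ereal_hausdorff R) cv); apply: lime_le; last exact: nearW.
by apply/cvg_ex; eexists; exact: cv.
Qed.

(** * Powers and integrable weights on the line *)

Section powR_integrals.
Context (R : realType).
Notation mu := (@lebesgue_measure R).

Lemma integral_powR_itv (q a b : R) : 0 < a -> a < b -> q + 1 != 0 ->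
  (\int[mu]_(x in `[a, b]) (x `^ q)%:E =
   ((b `^ (q + 1) - a `^ (q + 1)) / (q + 1))%:E)%E.
Proof.
move=> a0 ab q1.
pose F (x : R) := (q + 1)^-1 * x `^ (q + 1).
have dF (x : R) : 0 < x -> is_derive x 1 F (x `^ q).
  move=> x0; rewrite (_ : x `^ q = (q + 1)^-1 * ((q + 1) * x `^ (q + 1 - 1))); last first.
    by rewrite mulKf// addrK.
  have := is_deriveZ (q + 1)^-1 (is_derive1_powR (q + 1) x0); exact.
have cF (x : R) : 0 < x -> {for x, continuous F}.
  move=> x0; apply: differentiable_continuous; apply/derivable1_diffP.
  by have [] := dF x x0.
have cq (x : R) : 0 < x -> {for x, continuous (fun x : R => x `^ q)}.
  move=> x0; apply: differentiable_continuous; apply/derivable1_diffP.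
  by apply: derivable_powR; rewrite in_itv/= x0.
rewrite (@continuous_FTC2 _ _ F)//.
- by rewrite -EFinB /F -mulrBr mulrC.
- apply: continuous_in_subspaceT => x; rewrite inE/= in_itv/= => /andP[ax _].
  exact: cq (lt_le_trans a0 ax).
- split.
  + move=> x; rewrite in_itv/= => /andP[ax _].
    by have [] := dF x (lt_trans a0 ax).
  + exact/cvg_at_right_filter/cF.
  + exact/cvg_at_left_filter/cF/(lt_trans a0 ab).
- move=> x; rewrite in_itv/= => /andP[ax _]; rewrite derive1E.
  by have [_ ->] := dF x (lt_trans a0 ax).
Qed.

Lemma integral_powR_near0 (p : R) : p < 1 ->
  (\int[mu]_(x in `]0%R, 1%R]) (x `^ (- p))%:E < +oo)%E.
Proof.
(* Starting at 1/(k+2) rather than 1/(k+1) keeps the interval nondegenerate for [k = 0], as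
   [integral_powR_itv] demands. *)
move=> p1; pose F k : set R := `[k.+2%:R^-1, 1]%classic.
have k2 k : (0 : R) < k.+2%:R^-1 by rewrite invr_gt0.
have k21 k : (k.+2%:R^-1 : R) < 1 by rewrite invf_lt1// ltr1n.
have -> : `]0%R, 1%R]%classic = \bigcup_k F k.
  apply/seteqP; split=> [x /=|x [k _]]; rewrite /F /= !in_itv/= => /andP[x0 x1].
    exists (Num.truncn x^-1) => //=; rewrite in_itv/= x1 andbT.
    rewrite invf_ple ?posrE//; apply/ltW/(lt_trans (truncnS_gt _)).
    by rewrite ltr_nat.
  by rewrite (lt_le_trans (k2 k) x0) x1.
apply: (@le_lt_trans _ _ ((1 - p)^-1)%:E); last exact: ltry.
apply: ge0_integral_bigcup_le => //.
- move=> m n mn; apply/subsetPset => x; rewrite /F /= !in_itv/= => /andP[mx ->].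
  by rewrite andbT (le_trans _ mx)// lef_pV2 ?posrE// ler_nat.
- by move=> k; exact: measurable_itv.
- by apply/measurable_EFinP; exact: measurable_powR.
- by move=> x; rewrite lee_fin powR_ge0.
- move=> k; rewrite integral_powR_itv//; last by rewrite gt_eqF//; lra.
  rewrite lee_fin powR1 (_ : - p + 1 = 1 - p); last by lra.
  by rewrite ler_piMl ?invr_ge0 ?gerBl ?powR_ge0//; lra.
Qed.

Lemma integral_powR_infty (p : R) : 1 < p ->
  (\int[mu]_(x in `[1%R, +oo[) (x `^ (- p))%:E < +oo)%E.
Proof.
move=> p1; pose F k : set R := `[1, k.+2%:R]%classic.
have -> : `[1%R, +oo[%classic = \bigcup_k F k.
  apply/seteqP; split=> [x /=|x [k _]]; rewrite /F /= !in_itv/=; last by case/andP => ->.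
  rewrite andbT => x1; exists (Num.truncn x) => //=; rewrite in_itv/= x1/=.
  by apply/ltW/(lt_trans (truncnS_gt _)); rewrite ltr_nat.
apply: (@le_lt_trans _ _ ((p - 1)^-1)%:E); last exact: ltry.
apply: ge0_integral_bigcup_le => //.
- move=> m n mn; apply/subsetPset => x; rewrite /F /= !in_itv/= => /andP[-> mx].
  by rewrite /= (le_trans mx)// ler_nat.
- by move=> k; exact: measurable_itv.
- by apply/measurable_EFinP; exact: measurable_powR.
- by move=> x; rewrite lee_fin powR_ge0.
- move=> k; rewrite integral_powR_itv ?ltr1n//; last by rewrite lt_eqF//; lra.
  rewrite lee_fin powR1 (_ : - p + 1 = - (p - 1)); last by lra.
  rewrite invrN mulrN -mulNr opprB.
  by rewrite ler_piMl ?invr_ge0 ?gerBl ?powR_ge0//; lra.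
Qed.

(** An inequality suffices for all later uses; it lets both closed half-lines count the origin. *)
Lemma ge0_integral_even_le (F : R -> \bar R) :
  measurable_fun [set: measurableTypeR R] F -> (forall x, 0 <= F x)%E ->
  (\int[mu]_x F `|x|%R <= 2%:E * \int[mu]_(x in `[0%R, +oo[) F x)%E.
Proof.
move=> mF F0.
pose G := F \_ `[0%R, +oo[.
have G0 x : (0 <= G x)%E by exact: erestrict_ge0.
have mG : measurable_fun [set: measurableTypeR R] G.
  apply/(measurable_restrictT _ _).1 => //; exact: measurable_funTS.
have mGN : measurable_fun [set: measurableTypeR R] (fun x : R => G (- x)%R).
  by apply: measurableT_comp => //; exact: oppr_measurable.
have -> : (2%:E * \int[mu]_(x in `[0%R, +oo[) F x =
    \int[mu]_x (G x + G (- x)%R))%E.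
  rewrite ge0_integralD//.
  rewrite (ge0_integral_preserving (measure_preserving_opp R) mG G0).
  by rewrite [in RHS]/G -integral_mkcond mulr2n EFinD ge0_muleDl// mul1e.
apply: ge0_le_integral_nomeas => // x _.
rewrite /G /patch; have [x0|x0] := leP 0 x.
- by rewrite mem_set/= ?in_itv/= ?x0// ger0_norm// leeDl//; case: ifP.
- rewrite [X in (_ <= _ + X)%E]ifT; last by rewrite inE/= in_itv/= andbT oppr_ge0 ltW.
  by rewrite ltr0_norm// leeDr//; case: ifP.
Qed.

End powR_integrals.

Section one_dim_integrals.
Context (R : realType).
Notation mu := (@lebesgue_measure R).

Lemma integrable_scale (a : R) (f : R -> \bar R) : a != 0 ->
  mu.-integrable setT f -> mu.-integrable setT (fun x => f (a * x)).
Proof.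
move=> a0 /integrableP[mf foo]; apply/integrableP; split.
  pose th : measurableTypeR R -> measurableTypeR R := fun x => a * x.
  have mth : measurable_fun setT th by exact: mulrl_measurable.
  exact: (measurableT_comp mf mth).
rewrite (@ge0_integral_scale _ a (abse \o f))//=; last exact: measurableT_comp.
by rewrite lte_mul_pinfty// lee_fin invr_ge0.
Qed.

Lemma integral_scale (a : R) (f : R -> \bar R) : a != 0 ->
  mu.-integrable setT f ->
  (\int[mu]_x f (a * x)%R = `|a|^-1%:E * \int[mu]_x f x)%E.
Proof.
move=> a0 fi; have mf := measurable_int _ fi.
rewrite integralE [X in (_ = _ * X)%E]integralE muleBr//; last first.
  exact: integrable_add_def.
rewrite -(ge0_integral_scale a0 (measurable_funepos mf))//.
rewrite -(ge0_integral_scale a0 (measurable_funeneg mf)); last exact: funeneg_ge0.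
by congr (_ - _)%E; apply: eq_integral => x _; rewrite ?funeposE ?funenegE.
Qed.

Lemma ge0_integral_half_lty (F : R -> R) (C p q : R) : p < 1 -> 1 < q -> 0 <= C ->
  (forall x, 0 < x -> 0 <= F x) ->
  (forall x, 0 < x <= 1 -> F x <= C * x `^ (- p)) ->
  (forall x, 1 <= x -> F x <= C * x `^ (- q)) ->
  (\int[mu]_(x in `]0%R, +oo[) (F x)%:E < +oo)%E.
Proof.
move=> p1 q1 C0 F0 Fp Fq.
pose P (r : R) (x : R) := (x `^ (- r))%:E.
have mP r (D : set R) : measurable (D : set (measurableTypeR R)) ->
    measurable_fun [set: measurableTypeR R] (P r \_ D).
  move=> mD; apply/(measurable_restrictT _ _).1 => //.
  by apply: measurable_funTS; apply/measurable_EFinP; exact: measurable_powR.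
have P0 r (D : set R) x : (0 <= (P r \_ D) x)%E.
  by apply: erestrict_ge0 => ? _; rewrite lee_fin powR_ge0.
apply: (@le_lt_trans _ _ (C%:E * (\int[mu]_x ((P p \_ `]0%R, 1%R]) x + (P q \_ `[1%R, +oo[) x)))%E).
  rewrite -ge0_integralZl_EFin//; last 2 first.
  - by move=> x _; rewrite adde_ge0.
  - by apply: emeasurable_funD; exact: mP.
  rewrite [leLHS]integral_mkcond; apply: ge0_le_integral_nomeas => x _.
    by apply: erestrict_ge0 => y; rewrite /= in_itv/= andbT lee_fin => /F0.
  rewrite {1}/patch; case: ifPn => [|_]; last first.
    by rewrite mule_ge0// ?lee_fin// adde_ge0.
  rewrite inE/= in_itv/= andbT => x0; have [x1|x1] := leP x 1.
    rewrite (@le_trans _ _ (C%:E * (P p \_ `]0%R, 1%R]) x)%E)//.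
      by rewrite /patch ifT ?inE/= ?in_itv/= ?x0// -EFinM lee_fin Fp// x0.
    by rewrite lee_wpmul2l ?lee_fin// leeDl.
  rewrite (@le_trans _ _ (C%:E * (P q \_ `[1%R, +oo[) x)%E)//.
    by rewrite /patch ifT ?inE/= ?in_itv/= ?(ltW x1)// -EFinM lee_fin Fq// ltW.
  by rewrite lee_wpmul2l ?lee_fin// leeDr.
rewrite lte_mul_pinfty//= ge0_integralD//; [|exact: mP..].
by rewrite -!integral_mkcond lte_add_pinfty//; [exact: integral_powR_near0|
  exact: integral_powR_infty].
Qed.

Lemma ge0_integral_even_lty (F : R -> R) (C p q : R) : p < 1 -> 1 < q -> 0 <= C ->
  measurable_fun [set: measurableTypeR R] F -> (forall x, 0 <= F x) ->
  (forall x, 0 < x <= 1 -> F x <= C * x `^ (- p)) ->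
  (forall x, 1 <= x -> F x <= C * x `^ (- q)) ->
  (\int[mu]_x (F `|x|)%:E < +oo)%E.
Proof.
move=> p1 q1 C0 mF F0 Fp Fq.
have mF' : measurable_fun [set: measurableTypeR R] (EFin \o F) by apply/measurable_EFinP.
have := ge0_integral_even_le mF' (fun x => F0 x).
move=> /le_lt_trans; apply.
rewrite -integral_itv_obnd_cbnd; last exact: measurable_funTS.
rewrite lte_mul_pinfty//=; exact: (ge0_integral_half_lty p1 q1 C0).
Qed.

End one_dim_integrals.

Section one_dim_weights.
Context (R : realType).
Notation mu := (@lebesgue_measure R).

Lemma integral_powR_ball (p r : R) : p < 1 -> 0 < r ->
  (\int[mu]_x (if `|x| < r then `|x| `^ (- p) else 0)%:E < +oo)%E.
Proof.
move=> p1 r0.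
pose F (x : R) := if x < r then x `^ (- p) else 0.
have mF : measurable_fun [set: measurableTypeR R] F.
  by apply: measurable_fun_ifT;
    [exact: measurable_fun_ltr|exact: measurable_powR|].
(* The summand 1 serves the part below 1. For 1 <= x < r one has x^(-p) = x^(2-p) x^(-2) <= r^(2-p)
   x^(-2); the exponent 2 is just some number above 1. *)
apply: (@ge0_integral_even_lty _ F (1 + r `^ (2 - p)) p 2) => //.
- by rewrite ltr1n.
- by rewrite addr_ge0 ?powR_ge0.
- by move=> x; rewrite /F; case: ifP; rewrite ?powR_ge0.
- move=> x _; rewrite /F; case: ifP => _; last by rewrite mulr_ge0 ?addr_ge0 ?powR_ge0.
  by rewrite ler_peMl ?powR_ge0// lerDl powR_ge0.
- move=> x x1; rewrite /F; case: ifP => xr; last by rewrite mulr_ge0 ?addr_ge0 ?powR_ge0.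
  rewrite [in leLHS](_ : - p = (2 - p) + - 2); last lra.
  rewrite powRD; last by rewrite (gt_eqF (lt_le_trans _ x1))// implybT.
  rewrite ler_wpM2r ?powR_ge0//; apply: (@le_trans _ _ (r `^ (2 - p))).
    by rewrite ge0_ler_powR ?nnegrE ?(ltW r0) ?(ltW xr) ?(le_trans _ x1)//; lra.
  by rewrite lerDr.
Qed.

(* Dominates the truncated fractional kernel: [|t|^(-a)] near the origin,
   [|t|^(-1-a)] at infinity. *)
Definition kap (a t : R) : R := Num.min 1 `|t| * `|t| `^ (- (1 + a)).

Lemma kap_ge0 a t : 0 <= kap a t.
Proof. by rewrite mulr_ge0 ?powR_ge0// le_min ler01 normr_ge0. Qed.

Lemma measurable_kap a : measurable_fun [set: measurableTypeR R] (kap a).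
Proof.
apply: measurable_funM.
  by apply: measurable_minr; [exact: measurable_cst|exact: normr_measurable].
exact: (measurableT_comp (measurable_powR _) (@normr_measurable R setT)).
Qed.

Lemma integral_kap a : 0 < a < 1 -> (\int[mu]_t (kap a t)%:E < +oo)%E.
Proof.
move=> /andP[a0 a1].
rewrite (_ : kap a = (fun t => kap a `|t|)); last first.
  by apply/funext => t; rewrite /kap normr_id.
apply: (@ge0_integral_even_lty _ (kap a) 1 a (1 + a)) => //.
- lra.
- exact: measurable_kap.
- exact: kap_ge0.
- move=> x /andP[x0 x1]; rewrite /kap mul1r gtr0_norm//.
  rewrite (_ : Num.min 1 x = x); last exact/min_idPr.
  rewrite -{1}(powRr1 (ltW x0)) -powRD; last by rewrite (gt_eqF x0) implybT.
  by rewrite (_ : 1 + - (1 + a) = - a)//; lra.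
- move=> x x1; rewrite /kap mul1r ger0_norm ?(le_trans _ x1)//.
  by rewrite ler_piMl ?powR_ge0// ge_min lexx.
Qed.

(** The factor contributed by one coordinate when [integral_slice] integrates the coordinates out
    one at a time. *)
Lemma integral_bessel (q : R) : 1 < q ->
  (\int[mu]_t ((1 + t ^+ 2) `^ (- (q / 2)))%:E < +oo)%E.
Proof.
move=> q1.
under eq_integral => t _ do rewrite -real_normK ?num_real//.
apply: (@ge0_integral_even_lty _ (fun t => (1 + t ^+ 2) `^ (- (q / 2))) 1 0 q) => //.
- apply: (measurableT_comp (measurable_powR _)).
  by apply: measurable_funD; [exact: measurable_cst|exact: exprn_measurable].
- by move=> x; exact: powR_ge0.
- move=> x _; rewrite mul1r oppr0 powRr0 powRN invf_le1; last first.
    by rewrite powR_gt0// ltr_pwDl// sqr_ge0.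
  by rewrite -[leLHS](powRr0 (1 + x ^+ 2)) ler_powR//; [rewrite lerDl sqr_ge0|lra].
- move=> x x1; have x0 : 0 < x by exact: lt_le_trans x1.
  rewrite mul1r !powRN lef_pV2 ?posrE ?powR_gt0//; last by rewrite ltr_pwDl// sqr_ge0.
  have -> : x `^ q = (x ^+ 2) `^ (q / 2).
    by rewrite -powR_mulrn ?(ltW x0)// -powRrM mulrCA divff ?mulr1 ?pnatr_eq0.
  by rewrite ge0_ler_powR ?nnegrE ?sqr_ge0 ?addr_ge0 ?sqr_ge0 ?lerDr//; lra.
Qed.

End one_dim_weights.

Section Rintegral_Fubini.
Context d1 d2 (T1 : measurableType d1) (T2 : measurableType d2) (R : realType).
Variables (m1 : {sigma_finite_measure set T1 -> \bar R})
  (m2 : {sigma_finite_measure set T2 -> \bar R}).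
Variable f : T1 -> T2 -> R.
Hypothesis mf : measurable_fun setT (fun z : T1 * T2 => f z.1 z.2).
Hypothesis f1 : forall x, m2.-integrable setT (fun y => (f x y)%:E).
Hypothesis foo : (\int[m1]_x \int[m2]_y `|f x y|%:E < +oo)%E.

Let h (z : T1 * T2) := (f z.1 z.2)%:E.

Let hi : (m1 \x m2)%E.-integrable setT h.
Proof. by apply/integrable12ltyP => //; exact/measurable_EFinP. Qed.

Lemma integrable_Rintegral_section :
  m1.-integrable setT (fun x => (\int[m2]_y f x y)%:E).
Proof.
have := integrable_fubini_F hi; apply: eq_integrable => //= x _.
by rewrite /Rintegral fineK// integrable_fin_num//; exact: f1.
Qed.

Hypothesis f2 : forall y, m1.-integrable setT (fun x => (f x y)%:E).

(** Integrability of every section makes each inner [fine] faithful, so the real iterated integrals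
    agree with the extended ones, to which Fubini applies. *)
Lemma Rintegral_swap :
  \int[m1]_x \int[m2]_y f x y = \int[m2]_y \int[m1]_x f x y.
Proof.
rewrite /Rintegral; congr fine.
transitivity (\int[m1]_x \int[m2]_y h (x, y))%E.
  by apply: eq_integral => x _; rewrite fineK// integrable_fin_num//; exact: f1.
rewrite Fubini//; apply: eq_integral => y _.
by rewrite fineK// integrable_fin_num//; exact: f2.
Qed.

End Rintegral_Fubini.

Section rintegral_misc.
Context d (T : measurableType d) (R : realType) (mu : {measure set T -> \bar R}).

Lemma integrable_le (f g : T -> R) : measurable_fun setT f ->
  (forall x, `|f x| <= g x) -> (\int[mu]_x (g x)%:E < +oo)%E ->
  mu.-integrable setT (EFin \o f).
Proof.
move=> mf fg goo; apply/integrableP; split; first exact/measurable_EFinP.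
apply: le_lt_trans goo; apply: ge0_le_integral_nomeas => x _; first exact: abse_ge0.
by rewrite /= lee_fin.
Qed.

Lemma le_Rintegral_fine (f g : T -> R) : mu.-integrable setT (EFin \o f) ->
  (forall x, `|f x| <= g x) -> (\int[mu]_x (g x)%:E < +oo)%E ->
  `|\int[mu]_x f x| <= fine (\int[mu]_x (g x)%:E).
Proof.
move=> fi fg goo; apply: (le_trans (le_normr_Rintegral _ fi)) => //.
have le : (\int[mu]_x `|f x|%:E <= \int[mu]_x (g x)%:E)%E.
  by apply: ge0_le_integral_nomeas => x _; rewrite lee_fin.
have f0 : (0 <= \int[mu]_x `|f x|%:E)%E by apply: integral_ge0 => x _; rewrite lee_fin.
rewrite /Rintegral fine_le// ge0_fin_numE//; first exact: le_lt_trans le goo.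
exact: le_trans f0 le.
Qed.

Lemma ge0_integral_EFinZl (c : R) (g : T -> R) : 0 <= c ->
  measurable_fun setT g -> (forall x, 0 <= g x) ->
  (\int[mu]_x (c * g x)%:E = c%:E * \int[mu]_x (g x)%:E)%E.
Proof.
move=> c0 mg g0; under eq_integral do rewrite EFinM.
rewrite ge0_integralZl_EFin//; first by move=> x _; rewrite lee_fin.
exact/measurable_EFinP.
Qed.

Lemma ge0_integral_EFinZl_lty (c : R) (g : T -> R) : 0 <= c ->
  measurable_fun setT g -> (forall x, 0 <= g x) ->
  (\int[mu]_x (g x)%:E < +oo)%E -> (\int[mu]_x (c * g x)%:E < +oo)%E.
Proof. by move=> c0 mg g0 goo; rewrite ge0_integral_EFinZl// lte_mul_pinfty. Qed.

End rintegral_misc.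

(** * The kernel and the singular profile on the line *)

Section kernels1.
Context (R : realType) (a : R).
Hypothesis a01 : 0 < a < 1.
Notation mu := (@lebesgue_measure R).


(** The fractional kernel t |t|^(-2-a) of dimension one, written as a sign times a power. *)
Definition kfun (t : R) := Num.sg t * `|t| `^ (- (1 + a)).
Definition gfun (x : R) := if `|x| < 1 then Num.sg x * `|x| `^ (a - 1) else 0.

Lemma measurable_sgr : measurable_fun [set: measurableTypeR R] (@Num.sg R).
Proof.
apply: nondecreasing_measurable => // x y xy.
by case: (sgrP x) => [x0|x0|x0]; case: (sgrP y) => [y0|y0|y0]; lra.
Qed.

Lemma measurable_powR_norm (p : R) :
  measurable_fun [set: measurableTypeR R] (fun x : R => `|x| `^ p).
Proof. exact: (measurableT_comp (measurable_powR _) (@normr_measurable R setT)). Qed.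

Lemma measurable_norm_lt (r : R) :
  measurable_fun [set: measurableTypeR R] (fun x : R => `|x| < r).
Proof.
by apply: measurable_fun_ltr; [exact: normr_measurable|exact: measurable_cst].
Qed.

Lemma measurable_kfun : measurable_fun [set: measurableTypeR R] kfun.
Proof. by apply: measurable_funM; [exact: measurable_sgr|exact: measurable_powR_norm]. Qed.

Lemma measurable_gfun : measurable_fun [set: measurableTypeR R] gfun.
Proof.
apply: measurable_fun_ifT; [exact: measurable_norm_lt| |exact: measurable_cst].
by apply: measurable_funM; [exact: measurable_sgr|exact: measurable_powR_norm].
Qed.

Lemma norm_kfun t : `|kfun t| = `|t| `^ (- (1 + a)).
Proof.
have [a0 a1] := andP a01.
rewrite normrM (ger0_norm (powR_ge0 _ _)) normr_sg; case: eqVneq => [->|_]; last by rewrite mul1r.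
(* A nonzero power of 0 is 0, even for a negative exponent, so both sides vanish at the origin. *)
by rewrite mul0r normr0 powR0// oppr_eq0 gt_eqF//; lra.
Qed.

Lemma norm_gfun x : `|gfun x| = if `|x| < 1 then `|x| `^ (- (1 - a)) else 0.
Proof.
have [a0 a1] := andP a01.
rewrite /gfun opprB; case: ifPn => [_|]; last by rewrite normr0.
rewrite normrM (ger0_norm (powR_ge0 _ _)) normr_sg; case: eqVneq => [->|_]; last by rewrite mul1r.
by rewrite mul0r normr0 powR0// lt_eqF//; lra.
Qed.

Lemma integral_gfun : (\int[mu]_x `|gfun x|%:E < +oo)%E.
Proof.
have [a0 a1] := andP a01.
under eq_integral do rewrite norm_gfun.
by apply: integral_powR_ball => //; lra.
Qed.

Lemma norm_kfunM t (u M : R) : `|u| <= M * Num.min 1 `|t| -> `|kfun t * u| <= M * kap a t.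
Proof.
by move=> uM; rewrite normrM norm_kfun mulrC /kap mulrA ler_wpM2r ?powR_ge0.
Qed.

End kernels1.

(** * The one-dimensional Frullani estimate *)

Section frullani.
Context (R : realType) (a : R).
Hypothesis a01 : 0 < a < 1.
Notation mu := (@lebesgue_measure R).

Let w (y : R) := if `|y| < 1/2 then `|y| `^ (- (1/2)) else 0.
(** The radius 3 exceeds 1 + |z| as soon as ||z| - 1| < 1/2, the only case in which [K] is used. *)
Let K := fine (\int[mu]_s (if `|s|%R < 3 then `|s| `^ (- (1/2)) else 0)%:E).

(* Dominates [|z|^(-1-a)] times the integral of [1/|s|] over
   [||z| - 1| <= |s| < 1 + |z|]; the terms in [w] absorb the logarithmic
   singularities at [z = 1] and [z = -1]. *)
Definition frullani_bound (z : R) :=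
  8 * kap a z + 4 * K * (w (z - 1) + w (z + 1)).

Let K_lty : (\int[mu]_s (if `|s|%R < 3 then `|s| `^ (- (1/2)) else 0)%:E < +oo)%E.
Proof. by apply: integral_powR_ball; lra. Qed.

Let K_ge0 : 0 <= K.
Proof.
by rewrite fine_ge0// integral_ge0// => x _; rewrite lee_fin; case: ifP => // _; rewrite powR_ge0.
Qed.

Let w_ge0 y : 0 <= w y. Proof. by rewrite /w; case: ifP => // _; rewrite powR_ge0. Qed.

Let mw : measurable_fun [set: measurableTypeR R] w.
Proof.
apply: measurable_fun_ifT; [exact: measurable_norm_lt|exact: measurable_powR_norm|].
exact: measurable_cst.
Qed.

Lemma frullani_bound_ge0 z : 0 <= frullani_bound z.
Proof. by rewrite addr_ge0 ?mulr_ge0 ?addr_ge0 ?kap_ge0. Qed.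

Let mshift (c : R) : measurable_fun [set: measurableTypeR R] (fun z : R => w (z + c)).
Proof. by apply: (measurableT_comp mw); case: (measure_preserving_shift c). Qed.

Lemma measurable_frullani_bound : measurable_fun [set: measurableTypeR R] frullani_bound.
Proof.
apply: measurable_funD; apply: measurable_funM; [exact: measurable_cst|
  exact: measurable_kap|exact: measurable_cst|].
by apply: measurable_funD; exact: mshift.
Qed.

Lemma integral_frullani_bound : (\int[mu]_z (frullani_bound z)%:E < +oo)%E.
Proof.
have wi0 : mu.-integrable setT (EFin \o w).
  apply: (integrable_le (mu := mu) (g := w)) => //; first by move=> x; rewrite ger0_norm.
  by apply: integral_powR_ball; lra.
have wi c := integrable_preserving (measure_preserving_shift c) wi0.
have ki : mu.-integrable setT (EFin \o kap a).
  apply: (integrable_le (mu := mu) (g := kap a)); [exact: measurable_kap| |exact: integral_kap].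
  by move=> x; rewrite ger0_norm// kap_ge0.
apply: integrable_lty => //.
have := integrableD measurableT (integrableZl measurableT 8 ki)
  (integrableZl measurableT (4 * K) (integrableD measurableT (wi (- 1)) (wi 1))).
by apply: eq_integrable.
Qed.

Let D (z s : R) : R := if (`| `|z| - 1 | <= `|s|) && (`|s| < 1 + `|z|) then `|s| `^ (-1) else 0.

Let annulus (b c : R) : 0 <= b -> b <= c ->
  (\int[mu]_s (if ((b <= `|s|) && (`|s| < c))%R then 1 else 0)%:E <= (2 * (c - b))%:E)%E.
Proof.
move=> b0 bc; pose F (x : R) : \bar R := (if (b <= x) && (x < c) then 1 else 0)%:E.
have FE : F = EFin \o \1_(`[b, c[%classic : set R).
  apply/funext => x; rewrite /F /= indicE/=; congr EFin.
  rewrite (_ : (x \in _) = (b <= x) && (x < c)); first by case: ifP.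
  by apply/idP/idP; rewrite inE/= in_itv.
have mF : measurable_fun [set: measurableTypeR R] F.
  by rewrite FE; apply/measurable_EFinP; exact: measurable_indic.
apply: (le_trans (ge0_integral_even_le mF _)).
  by move=> x; rewrite lee_fin; case: ifP.
rewrite EFinM lee_wpmul2l// FE integral_indic//.
rewrite setIidl; last first.
  by move=> x /=; rewrite !in_itv/= andbT => /andP[bx _]; rewrite (le_trans b0).
rewrite [X in (X <= _)%E](@lebesgue_measure_itv R `[b, c[) /= lte_fin.
by case: ifP => // _; rewrite lee_fin subr_ge0.
Qed.

(** No logarithm is computed. With b = ||z| - 1|, if b >= 1/2 then 1/|s| <= 2 on an annulus of
    measure at most 4 min(1, |z|). If b < 1/2, then 1/|s| <= b^(-1/2) |s|^(-1/2) on the annulus; the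
    last factor is integrable in [s], and b^(-1/2) has an integrable singularity in [z]. Excluding 1
    and -1 makes [b] positive. *)
Let D_bound z : z != 1 -> z != -1 ->
  (\int[mu]_s (D z s)%:E < +oo)%E /\
  `|z| `^ (- (1 + a)) * fine (\int[mu]_s (D z s)%:E) <= frullani_bound z.
Proof.
have [a0 a1] := andP a01.
move=> z1 zN1; set b := `| `|z| - 1 |; set c := 1 + `|z|.
have z0 := normr_ge0 z.
have b0 : 0 < b.
  rewrite normr_gt0 subr_eq0; apply/eqP => zz.
  by move: zz z1 zN1; case: (ler0P z) => _ <-; rewrite ?opprK eqxx.
have cb : c - b = 2 * Num.min 1 `|z|.
  rewrite /c /b; have [zle|zgt] := leP 1 `|z|.
    by rewrite (@ger0_norm _ (`|z| - 1)) ?subr_ge0//; lra.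
  by rewrite (@ler0_norm _ (`|z| - 1)) ?subr_le0 ?(ltW zgt)//; lra.
have bc : b <= c by rewrite -subr_ge0 cb mulr_ge0// le_min ler01 z0.
have D0 s : (0 <= (D z s)%:E)%E by rewrite lee_fin /D; case: ifP => // _; rewrite powR_ge0.
suff [X DX Xle] : exists2 X, (\int[mu]_s (D z s)%:E <= X%:E)%E &
    `|z| `^ (- (1 + a)) * X <= frullani_bound z.
  split; first exact: le_lt_trans DX (ltry _).
  apply: le_trans Xle; rewrite ler_wpM2l ?powR_ge0//.
  rewrite -lee_fin fineK// ge0_fin_numE; last by apply: integral_ge0 => s _.
  exact: le_lt_trans DX (ltry _).
have [hb|hb] := leP (1/2) b.
- exists (2 * (2 * (c - b))).
    rewrite EFinM; apply: (le_trans _ (lee_wpmul2l _ (annulus (ltW b0) bc))) => //.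
    rewrite -ge0_integralZl_EFin//; last 2 first.
    + by move=> s _; rewrite lee_fin; case: ifP.
    + apply/measurable_EFinP; apply: measurable_fun_ifT; [|exact: measurable_cst..].
      apply: measurable_and; [|exact: measurable_norm_lt].
      by apply: measurable_fun_ler; [exact: measurable_cst|exact: normr_measurable].
    apply: ge0_le_integral_nomeas => s _ //.
    rewrite lee_fin /D -/b -/c; case: ifP => [/andP[bs sc]|_]; last by rewrite mulr0.
    have s0 : 0 < `|s| by apply: lt_le_trans bs.
    rewrite mulr1 powR_inv1// invf_ple ?posrE//; lra.
  (* The 8 of [frullani_bound]: a factor 2 bounds 1/|s|, another comes from the two components of
     the annulus, the third from [cb]. *)
  rewrite cb (_ : 2 * (2 * (2 * _)) = 8 * Num.min 1 `|z|); last lra.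
  rewrite mulrCA (mulrC (`|z| `^ _)) -/(kap a z) lerDl.
  by rewrite mulr_ge0 ?addr_ge0// mulr_ge0.
- exists (b `^ (- (1/2)) * K).
    rewrite EFinM /K fineK; last first.
      rewrite ge0_fin_numE// integral_ge0// => s _; rewrite lee_fin.
      by case: ifP => // _; rewrite powR_ge0.
    rewrite -ge0_integralZl_EFin//; last 3 first.
    + by move=> s _; rewrite lee_fin; case: ifP => // _; rewrite powR_ge0.
    + apply/measurable_EFinP; apply: measurable_fun_ifT; [exact: measurable_norm_lt|
        exact: measurable_powR_norm|exact: measurable_cst].
    + exact: powR_ge0.
    apply: ge0_le_integral_nomeas => s _ //.
    rewrite -EFinM lee_fin /D -/b -/c; case: ifPn => [/andP[bs sc]|_]; last first.
      by case: ifP => _; rewrite ?mulr0// mulr_ge0 ?powR_ge0.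
    have zle : `|z| < 3/2 by move: hb; rewrite /b ltr_norml => /andP[_]; lra.
    rewrite ifT; last by rewrite /c in sc; lra.
    have s0 : 0 < `|s| by apply: lt_le_trans bs.
    rewrite (_ : -1 = - (1/2) + - (1/2)); last lra.
    rewrite powRD; last by rewrite (gt_eqF s0) implybT.
    rewrite ler_wpM2r ?powR_ge0// !powRN lef_pV2 ?posrE ?powR_gt0//.
    by rewrite ge0_ler_powR ?nnegrE ?(ltW b0)//; lra.
  have zge : 1/2 <= `|z| by move: hb; rewrite /b ltr_norml => /andP[]; lra.
  (* Here |z| >= 1/2, so the power is at most 2^(1+a), and 1 + a < 2. This is the 4 of
     [frullani_bound]. *)
  have z4 : `|z| `^ (- (1 + a)) <= 4.
    rewrite powRN invf_ple ?posrE ?powR_gt0//; last lra.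
    apply: (@le_trans _ _ ((1/2) `^ (1 + a))); last first.
      by rewrite ge0_ler_powR ?nnegrE//; lra.
    apply: (@le_trans _ _ ((1/2) `^ 2%:R)); last by apply: ger_powR; lra.
    by rewrite powR_mulrn; lra.
  have bw : b `^ (- (1/2)) <= w (z - 1) + w (z + 1).
    have [zz|zz] := ler0P z.
      have E : b = `|z + 1| by rewrite /b (ler0_norm zz) -normrN opprB opprK addrC.
      by rewrite -[leLHS]add0r lerD// /w -E hb.
    have E : b = `|z - 1| by rewrite /b (gtr0_norm zz).
    by rewrite -[leLHS]addr0 lerD// /w -E hb.
  rewrite /frullani_bound -[leLHS]add0r lerD ?mulr_ge0 ?kap_ge0//.
  rewrite -mulrA; apply: ler_pM; rewrite ?powR_ge0 ?mulr_ge0 ?powR_ge0//.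
  by rewrite mulrC ler_wpM2l.
Qed.


(** The indicator of a ball: a power with exponent 0 is 1, also at the origin. This spelling makes
    it an instance of [integral_powR_ball]. *)
Let ball_ind (r x : R) : R := if `|x| < r then `|x| `^ (- 0) else 0.

Let ball_ind_lty r : 0 < r -> (\int[mu]_x (ball_ind r x)%:E < +oo)%E.
Proof. by move=> r0; apply: integral_powR_ball. Qed.

Let ball_ind_ge0 r x : 0 <= ball_ind r x.
Proof. by rewrite /ball_ind; case: ifP => // _; rewrite powR_ge0. Qed.

Let mball_ind r : measurable_fun [set: measurableTypeR R] (ball_ind r).
Proof.
apply: measurable_fun_ifT; [exact: measurable_norm_lt|exact: measurable_powR_norm|].
exact: measurable_cst.
Qed.

Let mD z : measurable_fun [set: measurableTypeR R] (D z).
Proof.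
apply: measurable_fun_ifT; [|exact: measurable_powR_norm|exact: measurable_cst].
apply: measurable_and; [|exact: measurable_norm_lt].
by apply: measurable_fun_ler; [exact: measurable_cst|exact: normr_measurable].
Qed.

Section lipschitz.
Variables (Psi : R -> R) (N L : R).
Hypothesis PsiN : forall x, `|Psi x| <= N.
Hypothesis PsiL : forall x y, `|Psi x - Psi y| <= L * `|x - y|.

Let N0 : 0 <= N. Proof. exact: le_trans (PsiN 0). Qed.

Let L0 : 0 <= L.
Proof. by have := PsiL 1 0; rewrite subr0 normr1 mulr1; exact: le_trans. Qed.

Lemma lipschitz_measurable : measurable_fun [set: measurableTypeR R] Psi.
Proof.
apply: continuous_measurable_fun => x; apply/cvgrPdist_le => /= e e0.
have L1 : 0 < L + 1 by rewrite ltr_pwDr.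
near=> y; apply: (le_trans (PsiL _ _)).
apply: (@le_trans _ _ ((L + 1) * `|x - y|)); first by rewrite ler_wpM2r// lerDl.
rewrite -ler_pdivlMl//; near: y.
have : nbhs x (ball x ((L + 1)^-1 * e)) by apply: nbhsx_ballx; rewrite mulr_gt0// invr_gt0.
by apply: filterS => y; rewrite /ball/= => /ltW.
Unshelve. all: by end_near. Qed.

(** Subtracting [Psi 0] makes Phi(s)/|s| bounded near 0, so the two halves of the Frullani
    difference can be integrated separately. The constant cancels in the difference. *)
Let Phi s := Psi s - Psi 0.

Let Phi_L s : `|Phi s| <= L * `|s|.
Proof. by have := PsiL s 0; rewrite subr0. Qed.

Let Phi_N s : `|Phi s| <= 2 * N.
Proof.
apply: (le_trans (ler_normB _ _)).
by rewrite mulrDl mul1r lerD.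
Qed.

Let mPhi : measurable_fun [set: measurableTypeR R] Phi.
Proof. by apply: measurable_funB; [exact: lipschitz_measurable|exact: measurable_cst]. Qed.

Let F (b s : R) : R := if `|s| < `|b| then `|s| `^ (-1) * Phi s else 0.

Let F_int b : b != 0 -> mu.-integrable setT (EFin \o F b).
Proof.
move=> b0; apply: (integrable_le (mu := mu) (g := fun s => L * ball_ind `|b| s)).
- apply: measurable_fun_ifT; [exact: measurable_norm_lt| |exact: measurable_cst].
  by apply: measurable_funM => //; exact: measurable_powR_norm.
- move=> s; rewrite /F /ball_ind; case: ifP => _; last by rewrite normr0 mulr0.
  rewrite oppr0 powRr0 mulr1 normrM ger0_norm ?powR_ge0//.
  rewrite powR_inv1//; have [->|s0] := eqVneq s 0; first by rewrite normr0 invr0 mul0r.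
  by rewrite ler_pdivrMl ?normr_gt0// mulrC.
- apply: (ge0_integral_EFinZl_lty (mu := mu) L0 (mball_ind _) (ball_ind_ge0 _)).
  by apply: ball_ind_lty; rewrite normr_gt0.
Qed.

Let E (b x : R) : R := if `|x| < 1 then `|x| `^ (-1) * Phi (x * b) else 0.

Let E_F b : b != 0 -> E b = fun x => `|b| * F b (b * x).
Proof.
move=> b0; apply/funext => x; rewrite /E /F normrM.
rewrite gtr_pMr ?normr_gt0//; case: ifP => _; last by rewrite mulr0.
by rewrite powRM// (powR_inv1 (normr_ge0 b)) -mulrA mulVKf ?normr_eq0// [b * x]mulrC.
Qed.

Let E_int b : b != 0 -> mu.-integrable setT (EFin \o E b).
Proof.
move=> b0; rewrite E_F//.
have := integrableZl measurableT `|b| (integrable_scale b0 (F_int b0)).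
by apply: eq_integrable.
Qed.

Let E_Rint b : b != 0 -> \int[mu]_x E b x = \int[mu]_s F b s.
Proof.
move=> b0; rewrite E_F// RintegralZl//; last exact: (integrable_scale b0 (F_int b0)).
rewrite /Rintegral (integral_scale (f := EFin \o F b))//; last exact: F_int.
rewrite fineM ?integrable_fin_num//; last exact: F_int.
by rewrite mulrA divff ?normr_eq0// mul1r.
Qed.

Let J (z x : R) : R :=
  if `|x| < 1 then `|x| `^ (-1) * (Psi (x * (1 + z)) - Psi (x * (1 - z))) else 0.

(** Scaling by 1 + z in one half and by 1 - z in the other turns both into integrals of the same
    function Phi(s)/|s|, since ds/|s| is scale invariant, over balls of radii |1 + z| and |1 - z|.
    They cancel on the smaller ball, and what is left lies in the annulus of [D]. The values 1 and
    -1 are excluded because a scaling factor would vanish. *)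
Lemma frullani_inner z : z != 1 -> z != -1 ->
  `|kfun a z * \int[mu]_x J z x| <= 2 * N * frullani_bound z.
Proof.
move=> z1 zN1; have [Doo Dle] := D_bound z1 zN1.
have p0 : 1 + z != 0 by rewrite addrC addr_eq0.
have m0 : 1 - z != 0 by rewrite subr_eq0 eq_sym.
have -> : \int[mu]_x J z x = \int[mu]_s (F (1 + z) s - F (1 - z) s).
  rewrite (RintegralB _ (F_int p0) (F_int m0))// -!E_Rint//.
  rewrite -(RintegralB _ (E_int p0) (E_int m0))//; congr fine.
  apply: eq_integral => x _; congr EFin; rewrite /J /E; case: ifP => _; last by rewrite subr0.
  by rewrite -mulrBr /Phi opprB addrA subrK.
have le : `|\int[mu]_s (F (1 + z) s - F (1 - z) s)| <= 2 * N * fine (\int[mu]_s (D z s)%:E).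
  have N20 : 0 <= 2 * N by rewrite mulr_ge0.
  have D0 s : 0 <= D z s by rewrite /D; case: ifP => // _; rewrite powR_ge0.
  have -> : 2 * N * fine (\int[mu]_s (D z s)%:E) = fine (\int[mu]_s (2 * N * D z s)%:E).
    rewrite (ge0_integral_EFinZl mu N20 (mD z) D0).
    by rewrite fineM// ge0_fin_numE// integral_ge0// => s _; rewrite lee_fin.
  apply: le_Rintegral_fine; last exact: (ge0_integral_EFinZl_lty (mu := mu) N20 (mD z) D0 Doo).
  - exact: (integrableB measurableT (F_int p0) (F_int m0)).
  - move=> s; rewrite /F.
    have Phile u v : u <= `|s| -> `|s| < v -> `| `|z| - 1 | <= u -> v <= 1 + `|z| ->
        `|s| `^ (-1) * `|Phi s| <= 2 * N * D z s.
      move=> us sv zu vz; rewrite /D ifT; last by rewrite (le_trans zu us) (lt_le_trans sv vz).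
      by rewrite mulrC ler_wpM2r ?powR_ge0.
    have zd (e : R) : `|e| = 1 -> `| `|z| - 1 | <= `|1 + e * z| /\ `|1 + e * z| <= 1 + `|z|.
      move=> e1; split.
        have := ler_dist_dist (- (e * z)) 1.
        rewrite normrN normrM e1 mul1r normr1 => /le_trans; apply.
        by rewrite -opprD normrN addrC.
      by rewrite (le_trans (ler_normD _ _))// normr1 normrM e1 mul1r.
    have [zp1 zp2] : `| `|z| - 1 | <= `|1 + z| /\ `|1 + z| <= 1 + `|z|.
      by have := zd 1 (normr1 _); rewrite mul1r.
    have [zm1 zm2] : `| `|z| - 1 | <= `|1 - z| /\ `|1 - z| <= 1 + `|z|.
      by have := zd (-1) (normrN1 _); rewrite mulN1r.
    have [sp|sp] := ltP `|s| `|1 + z|; have [sm|sm] := ltP `|s| `|1 - z|.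
    + by rewrite subrr normr0 mulr_ge0.
    + rewrite subr0 normrM (ger0_norm (powR_ge0 _ _)); exact: (Phile _ _ sm sp).
    + rewrite sub0r normrN normrM (ger0_norm (powR_ge0 _ _)); exact: (Phile _ _ sp sm).
    + by rewrite subrr normr0 mulr_ge0.
rewrite normrM norm_kfun//; apply: (le_trans (ler_wpM2l (powR_ge0 _ _) le)).
by rewrite mulrCA ler_wpM2l// mulr_ge0.
Qed.

End lipschitz.
End frullani.

(** * The fractional variation of the singular profile on the line *)

Section one_dim_variation.
Context (R : realType) (a : R).
Hypothesis a01 : 0 < a < 1.
Notation mu := (@lebesgue_measure R).
Variables (Psi : R -> R) (N L : R).
Hypothesis PsiN : forall x, `|Psi x| <= N.
Hypothesis PsiL : forall x y, `|Psi x - Psi y| <= L * `|x - y|.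

Let N0 : 0 <= N. Proof. exact: le_trans (PsiN 0). Qed.

Let L0 : 0 <= L.
Proof. by have := PsiL 1 0; rewrite subr0 normr1 mulr1; exact: le_trans. Qed.

Let mPsi := lipschitz_measurable PsiL.

Let H (x t : R) : R := kfun a t * (gfun a x * (Psi (x + t) - Psi (x - t))).
Let J (z x : R) : R :=
  if `|x| < 1 then `|x| `^ (-1) * (Psi (x * (1 + z)) - Psi (x * (1 - z))) else 0.
Let G (x z : R) : R := kfun a z * J z x.

(** As it contains [L], this constant serves only to justify Fubini; the conclusion involves [N]
    alone. *)
Let M : R := 2 * L + 2 * N.
Let M0 : 0 <= M. Proof. by rewrite addr_ge0// mulr_ge0. Qed.

Let diff_bound x t : `|Psi (x + t) - Psi (x - t)| <= M * Num.min 1 `|t|.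
Proof.
have [t1|t1] := leP 1 `|t|; rewrite /M.
  apply: (le_trans (ler_normB _ _)); rewrite mulr1.
  have := PsiN (x + t); have := PsiN (x - t); have := L0; lra.
apply: (le_trans (PsiL _ _)); rewrite (_ : x + t - (x - t) = 2 * t); last lra.
rewrite normrM ger0_norm// mulrA (mulrC L) ler_wpM2r// lerDl.
by rewrite mulr_ge0.
Qed.

Let H_bound x t : `|H x t| <= `|gfun a x| * M * kap a t.
Proof.
rewrite /H mulrCA normrM -mulrA ler_wpM2l//.
by apply: norm_kfunM => //; exact: diff_bound.
Qed.

Let RR : measurableType _ := (measurableTypeR R * measurableTypeR R)%type.

Let mcomp1 (f : R -> R) : measurable_fun [set: measurableTypeR R] f ->
  measurable_fun [set: RR] (fun z : RR => f z.1).
Proof. by move=> mf; apply: (measurableT_comp mf); exact: measurable_fst. Qed.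

Let mcomp2 (f : R -> R) : measurable_fun [set: measurableTypeR R] f ->
  measurable_fun [set: RR] (fun z : RR => f z.2).
Proof. by move=> mf; apply: (measurableT_comp mf); exact: measurable_snd. Qed.

Let mfst : measurable_fun [set: RR] (fun z : RR => z.1 : R).
Proof. exact: (mcomp1 (f := fun x => x) (@measurable_id _ (measurableTypeR R) setT)). Qed.

Let msnd : measurable_fun [set: RR] (fun z : RR => z.2 : R).
Proof. exact: (mcomp2 (f := fun x => x) (@measurable_id _ (measurableTypeR R) setT)). Qed.

Let mPsi2 (f : RR -> R) : measurable_fun [set: RR] f ->
  measurable_fun [set: RR] (fun z : RR => Psi (f z)).
Proof. by move=> mf; exact: (measurableT_comp mPsi mf). Qed.

Let mH : measurable_fun [set: RR] (fun z : RR => H z.1 z.2).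
Proof.
apply: measurable_funM; first exact: (mcomp2 (measurable_kfun a)).
apply: measurable_funM; first exact: (mcomp1 (measurable_gfun a)).
apply: measurable_funB; apply: mPsi2.
  by apply: measurable_funD; [exact: mfst|exact: msnd].
by apply: measurable_funB; [exact: mfst|exact: msnd].
Qed.

Let mJ : measurable_fun [set: RR] (fun z : RR => J z.2 z.1).
Proof.
apply: measurable_fun_ifT; last exact: measurable_cst.
  apply: measurable_fun_ltr; last exact: measurable_cst.
  exact: (mcomp1 (@normr_measurable R setT)).
apply: measurable_funM; first exact: (mcomp1 (measurable_powR_norm (-1))).
have m1 : measurable_fun [set: RR] (fun=> 1 : R) by exact: measurable_cst.
apply: measurable_funB; apply: mPsi2; apply: measurable_funM; try exact: mfst.
  by apply: measurable_funD; [exact: m1|exact: msnd].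
by apply: measurable_funB; [exact: m1|exact: msnd].
Qed.

Let mG : measurable_fun [set: RR] (fun z : RR => G z.1 z.2).
Proof. by apply: measurable_funM => //; exact: (mcomp2 (measurable_kfun a)). Qed.

Let msec1 (f : R -> R -> R) x : measurable_fun [set: RR] (fun z : RR => f z.1 z.2) ->
  measurable_fun [set: measurableTypeR R] (f x).
Proof.
move=> mf; apply: (measurableT_comp mf (g := fun y => (x, y))).
exact: measurable_pair1.
Qed.

Let msec2 (f : R -> R -> R) y : measurable_fun [set: RR] (fun z : RR => f z.1 z.2) ->
  measurable_fun [set: measurableTypeR R] (f ^~ y).
Proof.
move=> mf; apply: (measurableT_comp mf (g := fun x => (x, y))).
exact: measurable_pair2.
Qed.

Let Kap := (\int[mu]_t (kap a t)%:E)%E.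

Let kap_scale_lty (c : R) : 0 <= c -> (\int[mu]_t (c * kap a t)%:E = c%:E * Kap)%E.
Proof.
by move=> c0; rewrite (ge0_integral_EFinZl mu c0 (measurable_kap a) (kap_ge0 a)).
Qed.

Let Kap0 : (0 <= Kap)%E. Proof. by apply: integral_ge0 => t _; rewrite lee_fin kap_ge0. Qed.
Let Kapoo : (Kap < +oo)%E. Proof. exact: integral_kap. Qed.

Let H_int1 x : mu.-integrable setT (EFin \o H x).
Proof.
apply: (integrable_le (mu := mu) _ (H_bound x)); first exact: (msec1 x mH).
by rewrite kap_scale_lty ?mulr_ge0// lte_mul_pinfty ?lee_fin ?mulr_ge0.
Qed.

Let gfun_int : mu.-integrable setT (EFin \o gfun a).
Proof.
apply: (integrable_le (mu := mu) (g := fun x => `|gfun a x|)) => //; first exact: measurable_gfun.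
exact: integral_gfun.
Qed.

Let normg : (\int[mu]_x (`|gfun a x|)%:E < +oo)%E. Proof. exact: integral_gfun. Qed.

Let H_int2 t : mu.-integrable setT (fun x => (H x t)%:E).
Proof.
apply: (integrable_le (mu := mu) (f := H^~ t) (g := fun x => (M * kap a t) * `|gfun a x|)).
- exact: (msec2 t mH).
- by move=> x; rewrite mulrC mulrA; exact: H_bound.
- apply: (ge0_integral_EFinZl_lty (mu := mu)) => //; first by rewrite mulr_ge0// kap_ge0.
  by apply: (measurableT_comp (@normr_measurable R setT)); exact: measurable_gfun.
Qed.

Let H_abs : (\int[mu]_x \int[mu]_t `|H x t|%:E < +oo)%E.
Proof.
have KE : Kap = (fine Kap)%:E by rewrite fineK// ge0_fin_numE.
apply: (@le_lt_trans _ _ (\int[mu]_x ((M * fine Kap) * `|gfun a x|)%:E)%E).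
  apply: ge0_le_integral_nomeas => x _; first by apply: integral_ge0.
  rewrite [M * _ * _]mulrC mulrA EFinM -KE -kap_scale_lty ?mulr_ge0//.
  by apply: ge0_le_integral_nomeas => t _; rewrite ?lee_fin ?H_bound.
apply: (ge0_integral_EFinZl_lty (mu := mu)) => //.
  by rewrite mulr_ge0// fine_ge0.
by apply: (measurableT_comp (@normr_measurable R setT)); exact: measurable_gfun.
Qed.

(* The substitution [t = x z] turns [H] into a Frullani integrand in [x]. *)
Let H_G x z : x != 0 -> `|x| * H x (x * z) = G x z.
Proof.
move=> x0; rewrite /H /G /J /gfun; case: ifP => [x1|_]; last by rewrite !(mul0r, mulr0).
have xp : 0 < `|x| by rewrite normr_gt0.
rewrite /kfun sgrM normrM powRM// [x * (1 + z)]mulrDr [x * (1 - z)]mulrBr mulr1.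
have E : `|x| * `|x| `^ (- (1 + a)) * `|x| `^ (a - 1) = `|x| `^ (-1).
  rewrite -{1}(powRr1 (ltW xp)) -!powRD ?(gt_eqF xp) ?implybT//.
  by congr powR; lra.
have S : Num.sg x * Num.sg x = 1 by rewrite -expr2 sqr_sg x0.
rewrite -E; set P := Psi _ - Psi _.
transitivity (Num.sg x * Num.sg x * (Num.sg z * `|z| `^ (- (1 + a)) *
   (`|x| * `|x| `^ (- (1 + a)) * `|x| `^ (a - 1) * P))); last by rewrite S mul1r.
set A := `|x| `^ _; set B := `|z| `^ _; set C := `|x| `^ _; lra.
Qed.

Let H_G_int x : \int[mu]_t H x t = \int[mu]_z G x z.
Proof.
have [->|x0] := eqVneq x 0.
  rewrite /Rintegral; congr fine; apply: eq_integral => t _; congr EFin.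
  by rewrite /H /G /J /gfun sgr0 !mul0r !subrr !(mulr0, if_same, mul0r).
transitivity (\int[mu]_z (`|x| * H x (x * z))); last first.
  by rewrite /Rintegral; congr fine; apply: eq_integral => z _; rewrite H_G.
rewrite RintegralZl//; last exact: (integrable_scale x0 (H_int1 x)).
rewrite /Rintegral (integral_scale (f := EFin \o H x))//.
rewrite fineM ?integrable_fin_num//.
by rewrite mulrA divff ?normr_eq0// mul1r.
Qed.

Let G_int1 x : mu.-integrable setT (EFin \o G x).
Proof.
have [->|x0] := eqVneq x 0.
  have := @integrable0 _ _ _ mu setT; apply: eq_integrable => // z _ /=.
  by rewrite /G /J !mul0r subrr !(mulr0, if_same, mul0r).
have := integrableZl measurableT `|x| (integrable_scale x0 (H_int1 x)).
by apply: eq_integrable => // z _ /=; rewrite -EFinM H_G.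
Qed.

Let G_abs_int x : (\int[mu]_z `|G x z|%:E = \int[mu]_t `|H x t|%:E)%E.
Proof.
have [->|x0] := eqVneq x 0.
  apply: eq_integral => t _.
  by rewrite /H /G /J /gfun sgr0 !mul0r !subrr !(mulr0, if_same, mul0r).
under eq_integral do rewrite -H_G// normrM normr_id EFinM.
have mabs : measurable_fun [set: measurableTypeR R] (fun t => `|H x t|%:E).
  by apply/measurable_EFinP; apply: (measurableT_comp (@normr_measurable R setT)); exact: (msec1 x mH).
rewrite ge0_integralZl_EFin//; last first.
  have := measurable_int _ (integrable_scale x0 (integrable_norm (H_int1 x))); exact.
rewrite (ge0_integral_scale x0 mabs)//.
by rewrite muleA -EFinM divff ?normr_eq0// mul1e.
Qed.

(** At fixed [z], the factor 1/|x| is compensated by the Lipschitz bound 2 L |x z| on the increment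
    of [Psi]. *)
Let G_int2 z : mu.-integrable setT (fun x => (G x z)%:E).
Proof.
apply: (integrable_le (mu := mu) (f := G^~ z)
  (g := fun x => (`|kfun a z| * (L * 2 * `|z|)) * (if `|x| < 1 then `|x| `^ (- 0) else 0))).
- exact: (msec2 z mG).
- move=> x; rewrite /G normrM -mulrA ler_wpM2l// /J; case: ifP => _; last by rewrite normr0 mulr0.
  rewrite oppr0 powRr0 mulr1 normrM (ger0_norm (powR_ge0 _ _)) powR_inv1//.
  have [->|x0] := eqVneq x 0; first by rewrite normr0 invr0 mul0r !mulr_ge0.
  rewrite ler_pdivrMl ?normr_gt0//; apply: (le_trans (PsiL _ _)).
  rewrite (_ : _ - _ = 2 * (x * z)); last lra.
  by rewrite !normrM ger0_norm//; lra.
- apply: (ge0_integral_EFinZl_lty (mu := mu)).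
  + by rewrite !mulr_ge0.
  + apply: measurable_fun_ifT; [exact: measurable_norm_lt|
      exact: measurable_powR_norm|exact: measurable_cst].
  + by move=> x; case: ifP => // _; rewrite powR_ge0.
  + exact: integral_powR_ball.
Qed.

Let kJ z : \int[mu]_x G x z = kfun a z * \int[mu]_x J z x.
Proof.
have [k0|k0] := eqVneq (kfun a z) 0.
  by rewrite /G k0 mul0r /Rintegral; under eq_integral do rewrite mul0r; rewrite integral0.
rewrite /G RintegralZl//.
have := integrableZl measurableT (kfun a z)^-1 (G_int2 z).
by apply: eq_integrable => // x _ /=; rewrite -EFinM mulKf.
Qed.

(** Fubini is used twice. The first exchange puts the integral in [t] inside, where [t = x z] can be
    substituted at fixed [x]; the second puts the integral in [x] inside, where [frullani_inner]
    bounds it at fixed [z]. *)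
Lemma one_dim_variation :
  `|\int[mu]_t \int[mu]_x H x t| <= 2 * N * fine (\int[mu]_z (frullani_bound a z)%:E).
Proof.
rewrite -(Rintegral_swap (m1 := mu) (m2 := mu) mH H_int1 H_abs H_int2).
have -> : \int[mu]_x \int[mu]_t H x t = \int[mu]_x \int[mu]_z G x z.
  by apply: eq_Rintegral => x _; exact: H_G_int.
have Gabs : (\int[mu]_x \int[mu]_z `|G x z|%:E < +oo)%E.
  by under eq_integral do rewrite G_abs_int.
rewrite (Rintegral_swap (m1 := mu) (m2 := mu) mG G_int1 Gabs G_int2).
have mG' : measurable_fun [set: RR] (fun z : RR => G z.2 z.1).
  apply: (measurableT_comp mG (g := fun z : RR => (z.2, z.1))).
  exact: measurable_swap.
have Iint : mu.-integrable setT (fun z => (\int[mu]_x G x z)%:E).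
  apply: (integrable_Rintegral_section (m1 := mu) (m2 := mu) (f := fun z x => G x z) mG' G_int2).
  rewrite -(fubini_tonelli (fun z : RR => `|G z.1 z.2|%:E)); [exact: Gabs| |].
    by apply/measurable_EFinP; exact: (measurableT_comp (@normr_measurable R setT) mG).
  by move=> z; rewrite lee_fin.
(* The two values of [z] at which a scaling degenerates form a null set, and are removed before the
   pointwise bound is used. *)
pose N1 : set (measurableTypeR R) := [set 1] `|` [set -1].
have mN1 : measurable N1 by apply: measurableU; exact: measurable_set1.
have N10 : mu N1 = 0%E.
  rewrite measureU0; [exact: (lebesgue_measure_set1 1)|exact: measurable_set1..|].
  exact: (lebesgue_measure_set1 (-1)).
have mTN : measurable (setT `\` N1) by exact: measurableD.
have IintN := integrableS measurableT mTN (@subsetT _ _) Iint.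
rewrite /Rintegral (negligible_integral mN1 measurableT Iint N10).
apply: (le_trans (le_normr_Rintegral mTN IintN)).
have B0 z : 0 <= 2 * N * frullani_bound a z by rewrite !mulr_ge0// frullani_bound_ge0.
have Boo : (\int[mu]_z (2 * N * frullani_bound a z)%:E < +oo)%E.
  apply: (ge0_integral_EFinZl_lty (mu := mu)); [by rewrite mulr_ge0|
    exact: measurable_frullani_bound|exact: frullani_bound_ge0|
    exact: integral_frullani_bound].
have BE : 2 * N * fine (\int[mu]_z (frullani_bound a z)%:E) =
    fine (\int[mu]_z (2 * N * frullani_bound a z)%:E).
  rewrite (ge0_integral_EFinZl mu _ (measurable_frullani_bound a) (frullani_bound_ge0 a)) ?mulr_ge0//.
  rewrite fineM// ge0_fin_numE ?integral_frullani_bound//.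
  by apply: integral_ge0 => z _; rewrite lee_fin frullani_bound_ge0.
have le : (\int[mu]_(z in setT `\` N1) `|\int[mu]_x G x z|%:E <=
    \int[mu]_z (2 * N * frullani_bound a z)%:E)%E.
  rewrite integral_mkcond; apply: ge0_le_integral_nomeas => z _.
    by apply: erestrict_ge0 => ? _; rewrite lee_fin.
  rewrite /patch; case: ifPn => [|_]; last by rewrite lee_fin.
  rewrite inE => -[_ Nz]; rewrite lee_fin kJ.
  by apply: (frullani_inner a01 PsiN PsiL); apply/eqP => zE; apply: Nz; rewrite /N1 zE; [left|right].
rewrite BE /Rintegral fine_le//.
- rewrite ge0_fin_numE; first exact: le_lt_trans le Boo.
  by apply: integral_ge0 => z _; rewrite lee_fin.
- by rewrite ge0_fin_numE// integral_ge0// => z _; rewrite lee_fin.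
Qed.

End one_dim_variation.

(** * Integration over row vectors *)

Section lebesgue_rV_theory.
Context (R : realType).
Notation mu1 := (@lebesgue_measure R).
Notation mu n := (lebesgue_rV R n).
Notation R1 := (measurableTypeR R).

Lemma consrV0 n t (h : 'rV[R]_n) : consrV (t, h) ord0 ord0 = t.
Proof. by rewrite mxE unlift_none. Qed.

Lemma consrVS n t (h : 'rV[R]_n) j : consrV (t, h) ord0 (lift ord0 j) = h ord0 j.
Proof. by rewrite mxE liftK. Qed.

Lemma unconsrVK n : cancel (@unconsrV R n) (@consrV R n).
Proof.
move=> x; apply/rowP => i; case: (unliftP ord0 i) => [j ->|->].
  by rewrite consrVS mxE.
by rewrite consrV0.
Qed.

Lemma measurable_consrV1 n (t : R1) : measurable_fun setT (fun h : 'rV[R]_n => consrV (t, h)).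
Proof. by apply: (measurableT_comp (@measurable_consrV R n)); exact: measurable_pair1. Qed.

Lemma ge0_integral_consrV n (F : 'rV[R]_n.+1 -> \bar R) :
  measurable_fun setT F -> (forall x, (0 <= F x)%E) ->
  (\int[mu n.+1]_x F x = \int[mu1]_t \int[mu n]_h F (consrV (t, h)))%E.
Proof.
move=> mF F0.
rewrite [LHS](_ : _ = \int[pushforward (mu1 \x mu n)%E (@consrV R n)]_x F x)%E//.
rewrite ge0_integral_pushforward//; last exact: measurable_consrV.
rewrite preimage_setT; apply: (fubini_tonelli1 (F \o @consrV R n)).
  exact: (measurableT_comp mF (@measurable_consrV R n)).
by move=> x; exact: F0.
Qed.

Lemma measurable_integral_consrV n (F : 'rV[R]_n.+1 -> \bar R) :
  measurable_fun setT F -> (forall x, (0 <= F x)%E) ->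
  measurable_fun [set: R1] (fun t => \int[mu n]_h F (consrV (t, h)))%E.
Proof.
move=> mF F0.
apply: (measurable_fun_fubini_tonelli_F (m2 := mu n) (fun z : R1 * 'rV[R]_n => F (consrV z))) => //.
exact: (measurableT_comp mF (@measurable_consrV R n)).
Qed.

Lemma integrable_consrV n (F : 'rV[R]_n.+1 -> \bar R) :
  (mu n.+1).-integrable setT F ->
  (mu1 \x mu n)%E.-integrable setT (F \o @consrV R n).
Proof.
move=> /integrableP[mF Foo]; apply/integrable12ltyP.
  exact: (measurableT_comp mF (@measurable_consrV R n)).
have mabs : measurable_fun setT (abse \o F) by exact: measurableT_comp.
by have := ge0_integral_consrV mabs (fun x => abse_ge0 (F x)) => /= <-.
Qed.

Lemma integral_consrV n (F : 'rV[R]_n.+1 -> \bar R) :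
  (mu n.+1).-integrable setT F ->
  (\int[mu n.+1]_x F x = \int[mu1]_t \int[mu n]_h F (consrV (t, h)))%E.
Proof.
move=> Fi; have Fi' := integrable_consrV Fi.
rewrite (integral12_prod_meas1 Fi').
rewrite [LHS](_ : _ = \int[pushforward (mu1 \x mu n)%E (@consrV R n)]_x F x)%E//.
rewrite integral_pushforward//; [exact: measurable_consrV|exact: measurable_int Fi].
Qed.

(** The sigma-algebra is generated by the coordinates, so openness has to be translated: an open set
    is the union of the cubes with rational centre and radius 1/(k+1) that it contains. *)
Lemma open_measurable_rV n (U : set 'rV[R]_n) : open U -> measurable U.
Proof.
move=> oU.
pose B (qk : 'rV[rat]_n * nat) : set 'rV[R]_n :=
  [set x | forall i, `|x ord0 i - ratr (qk.1 ord0 i)| < qk.2.+1%:R^-1].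
have mB qk : measurable (B qk).
  rewrite (_ : B qk = \bigcap_(i in [set: 'I_n])
      ((fun x : 'rV[R]_n => x ord0 i) @^-1` ball (ratr (qk.1 ord0 i) : R) qk.2.+1%:R^-1)); last first.
    apply/seteqP; split=> x /= Bx i; [move=> _|]; rewrite /B/= ?/ball/=.
      by rewrite distrC; exact: Bx.
    by rewrite distrC; exact: Bx.
  apply: fin_bigcap_measurable => // i _.
  rewrite -[X in measurable X]setTI; apply: measurable_coord_rV => //.
  exact: measurable_ball.
have -> : U = \bigcup_(qk in [set: 'rV[rat]_n * nat]) (if `[< B qk `<=` U >] then B qk else set0).
  apply/seteqP; split=> [x Ux|x [qk _]]; last first.
    by case: asboolP => // + ?; apply.
  have [e e0 xe] : exists2 e : R, 0 < e & ball x e `<=` U.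
    by have /nbhs_ballP[e /= e0 xe] : nbhs x U by [exact: open_nbhs_nbhs]; exists e.
  (* Two radii must add up to less than [e]: the given point and any other point of the cube are
     compared through the centre. *)
  pose k := Num.truncn (2 / e).
  have ke : (k.+1%:R^-1 : R) + k.+1%:R^-1 < e.
    have : 2 / e < k.+1%:R by exact: truncnS_gt.
    rewrite ltr_pdivrMr// => h; have E (y : R) : y + y = 2 * y by lra.
    rewrite E.
    by rewrite ltr_pdivrMr// mulrC.
  have k0 : (0 : R) < k.+1%:R^-1 by rewrite invr_gt0.
  have Q i : exists q : rat, `|x ord0 i - ratr q| < k.+1%:R^-1.
    move: (k.+1%:R^-1 : R) k0 => d d0.
    have lt : x ord0 i - d < x ord0 i + d by lra.
    have [q] := @rat_in_itvoo R _ _ lt.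
    by rewrite in_itv/= => /andP[q1 q2]; exists q; rewrite ltr_norml; lra.
  pose q : 'rV[rat]_n := \row_i projT1 (cid (Q i)).
  have Bx : B (q, k) x by move=> i; rewrite /= mxE; case: cid.
  exists (q, k) => //; rewrite asboolT// => y By; apply: xe.
  split => // i j; rewrite (ord1 i) /ball/=.
  apply: le_lt_trans ke; rewrite (_ : _ - _ = (x ord0 j - ratr (q ord0 j)) - (y ord0 j - ratr (q ord0 j))); last lra.
  by rewrite (le_trans (ler_normB _ _))// lerD// ltW.
apply: countable_bigcupT_measurable => // qk; case: ifP => _ //.
Qed.

Lemma continuous_measurable_rV n (f : 'rV[R]_n -> R) :
  continuous f -> measurable_fun setT f.
Proof.
move=> /continuousP cf; apply: (measurability _ (RGenOpens.measurableE R)).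
move=> _ [_ [a [b ->] <-]]; rewrite setTI; apply: open_measurable_rV.
exact/cf/interval_open.
Qed.

Definition cmap n (th : 'I_n -> R -> R) (x : 'rV[R]_n) : 'rV[R]_n := \row_i th i (x ord0 i).

(** Induction on the dimension, slicing the indicator of the set along the first coordinate. One
    proof covers the translations and the coordinate reflections. *)
Lemma measure_preserving_cmap n (th : 'I_n -> R -> R) :
  (forall i, measure_preserving mu1 (th i : R1 -> R1)) ->
  measure_preserving (mu n) (cmap th).
Proof.
move=> mpth.
have mc k (ph : 'I_k -> R -> R) : (forall i, measure_preserving mu1 (ph i : R1 -> R1)) ->
    measurable_fun setT (cmap ph).
  move=> mp; apply: measurable_fun_rVP => i; rewrite /cmap.
  rewrite (_ : (fun t => _) = (ph i : R1 -> R1) \o (fun x : 'rV[R]_k => x ord0 i)); last first.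
    by apply/funext => x /=; rewrite mxE.
  by apply: measurableT_comp; [case: (mp i)|exact: measurable_coord_rV].
split; first exact: mc.
elim: n th mpth => [|n IH] th mpth A mA.
  by rewrite (_ : cmap th = id)//; apply/funext => x; apply/rowP => -[].
have mpl : measure_preserving (mu n) (cmap (th \o lift ord0)).
  by split; [apply: mc => i; exact: mpth|apply: IH => i; exact: mpth].
have indE (B : set 'rV[R]_n.+1) : measurable B ->
    (mu n.+1 B = \int[mu1]_t \int[mu n]_h (\1_B (consrV (t, h)))%:E)%E.
  move=> mB; rewrite -(ge0_integral_consrV (F := fun x => (\1_B x)%:E))//.
    by rewrite integral_indic// setIT.
  by apply/measurable_EFinP; exact: measurable_indic.
have mcA : measurable (cmap th @^-1` A).
  by rewrite -[X in measurable X]setTI; apply: mc => // i; exact: mpth.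
have mIA : measurable_fun setT (fun x : 'rV[R]_n.+1 => (\1_A x)%:E : \bar R).
  by apply/measurable_EFinP; exact: measurable_indic.
have IA0 (x : 'rV[R]_n.+1) : (0 <= (\1_A x)%:E :> \bar R)%E by rewrite lee_fin.
apply: (etrans (indE _ mcA)); apply: (etrans _ (esym (indE _ mA))).
rewrite -[RHS](ge0_integral_preserving (mpth ord0) (measurable_integral_consrV mIA IA0)); last first.
  by move=> t; apply: integral_ge0.
apply: eq_integral => t _.
rewrite -[RHS](ge0_integral_preserving (f := fun h => (\1_A (consrV (th ord0 t, h)))%:E) mpl)//; last first.
  exact: (measurableT_comp mIA (measurable_consrV1 _)).
apply: eq_integral => h _; congr EFin; rewrite !indicE; congr ((_ : bool)%:R).
suff E : cmap th (consrV (t, h)) = consrV (th ord0 t, cmap (th \o lift ord0) h).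
  by rewrite /preimage; apply/idP/idP; rewrite !inE/= E.
apply/rowP => i; rewrite mxE; case: (unliftP ord0 i) => [j ->|->].
  by rewrite !consrVS mxE.
by rewrite !consrV0.
Qed.

End lebesgue_rV_theory.

(** * The Euclidean norm, the fractional kernel and its slices *)

Section enorm_theory.
Context (R : realType).
Notation mu1 := (@lebesgue_measure R).
Notation mu n := (lebesgue_rV R n).
Notation R1 := (measurableTypeR R).

Lemma dotrV_ge0 n (x : 'rV[R]_n) : 0 <= dotrV x x.
Proof. by apply: sumr_ge0 => i _; rewrite -expr2 sqr_ge0. Qed.

Lemma enorm_ge0 n (x : 'rV[R]_n) : 0 <= enorm x.
Proof. exact: sqrtr_ge0. Qed.

Lemma enorm_powR n (x : 'rV[R]_n) p : enorm x `^ p = dotrV x x `^ (p / 2).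
Proof. by rewrite /enorm -powR12_sqrt ?dotrV_ge0// -powRrM mulrC. Qed.

Lemma coord_le_enorm n (x : 'rV[R]_n) i : `|x ord0 i| <= enorm x.
Proof.
rewrite -sqrtr_sqr ler_sqrt ?dotrV_ge0// /dotrV (bigD1 i)//= expr2 lerDl.
by apply: sumr_ge0 => j _; rewrite -expr2 sqr_ge0.
Qed.

Lemma enorm_gt0 n (x : 'rV[R]_n) i : x ord0 i != 0 -> 0 < enorm x.
Proof. by move=> xi; rewrite (lt_le_trans _ (coord_le_enorm x i))// normr_gt0. Qed.

Lemma enorm_le_sum n (x : 'rV[R]_n) : enorm x <= \sum_i `|x ord0 i|.
Proof.
have S0 : 0 <= \sum_i `|x ord0 i| by apply: sumr_ge0.
rewrite -(ger0_norm S0) -sqrtr_sqr ler_sqrt ?sqr_ge0//.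
rewrite expr2 mulr_suml; apply: ler_sum => i _.
rewrite -expr2 -real_normK ?num_real// expr2 ler_wpM2l// (bigD1 i)//= lerDl.
by apply: sumr_ge0.
Qed.

Lemma dotrV_consrV n t (h : 'rV[R]_n) :
  dotrV (consrV (t, h)) (consrV (t, h)) = t ^+ 2 + dotrV h h.
Proof.
rewrite /dotrV big_ord_recl consrV0 expr2; congr (_ + _).
by apply: eq_bigr => i _; rewrite consrVS.
Qed.

Lemma measurable_dotrV n : measurable_fun setT (fun x : 'rV[R]_n => dotrV x x).
Proof.
apply: measurable_sum => i; apply: measurable_funM; exact: measurable_coord_rV.
Qed.

Lemma measurable_enorm_powR n p : measurable_fun setT (fun x : 'rV[R]_n => enorm x `^ p).
Proof.
rewrite (_ : (fun _ => _) = (fun x : 'rV[R]_n => dotrV x x `^ (p / 2))); last first.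
  by apply/funext => x; rewrite enorm_powR.
exact: (measurableT_comp (measurable_powR _) (@measurable_dotrV n)).
Qed.

Lemma measurable_enorm n : measurable_fun setT (@enorm R n).
Proof.
have := @measurable_enorm_powR n 1.
by under eq_fun do rewrite powRr1 ?enorm_ge0//.
Qed.

(** Induction on [m]. Peeling off a coordinate [t] replaces [s] by s + t^2; after the induction
    hypothesis, rescaling [t] by the square root of [s] extracts the power of [s] and leaves
    [integral_bessel] with exponent p - m > 1. In dimension 0 the measure is a Dirac mass. *)
Lemma integral_slice (m : nat) (p : R) : m%:R < p ->
  exists2 C, 0 <= C & forall s, 0 < s ->
    (\int[mu m]_h ((s + dotrV h h) `^ (- (p / 2)))%:E = (C * s `^ ((m%:R - p) / 2))%:E)%E.
Proof.
elim: m => [|m IH] mp.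
  exists 1 => // s s0; rewrite /= integral_dirac//; last first.
    apply/measurable_EFinP; apply: (measurableT_comp (measurable_powR _)).
    by apply: measurable_funD; [exact: measurable_cst|exact: measurable_dotrV].
  rewrite diracE mem_set// mul1e mul1r /dotrV big_ord0 addr0.
  by rewrite sub0r mulNr.
have mp' : 1 < p - m%:R by rewrite ltrBrDr -natr1 in mp *; lra.
have [|C C0 HC] := IH; first by lra.
have Boo := integral_bessel mp'.
set B := (\int[_]_t _)%E in Boo.
have B0 : (0 <= B)%E by apply: integral_ge0 => t _; rewrite lee_fin powR_ge0.
have BE : B = (fine B)%:E by rewrite fineK// ge0_fin_numE.
exists (C * fine B); first by rewrite mulr_ge0// fine_ge0.
move=> s s0.
have mF : measurable_fun setT (fun h : 'rV[R]_m.+1 => ((s + dotrV h h) `^ (- (p / 2)))%:E).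
  apply/measurable_EFinP; apply: (measurableT_comp (measurable_powR _)).
  by apply: measurable_funD; [exact: measurable_cst|exact: measurable_dotrV].
rewrite ge0_integral_consrV//; last by move=> x; rewrite lee_fin powR_ge0.
have q0 : Num.sqrt s != 0 by rewrite gt_eqF// sqrtr_gt0.
pose q := (p - m%:R) / 2.
have mG : measurable_fun [set: R1] (fun t : R => (s + t ^+ 2) `^ (- q)).
  apply: (measurableT_comp (measurable_powR _)).
  by apply: measurable_funD; [exact: measurable_cst|exact: exprn_measurable].
transitivity (\int[mu1]_t (C * (s + t ^+ 2) `^ (- q))%:E)%E.
  apply: eq_integral => t _; under eq_integral do rewrite dotrV_consrV addrA.
  rewrite HC; last by rewrite ltr_pwDl// sqr_ge0.
  by rewrite /q -mulNr opprB.
rewrite (ge0_integral_EFinZl mu1 C0 mG); last by move=> t; rewrite powR_ge0.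
have -> : (\int[mu1]_t ((s + t ^+ 2) `^ (- q))%:E =
    `|Num.sqrt s|%:E * \int[mu1]_t ((s + (Num.sqrt s * t) ^+ 2) `^ (- q))%:E)%E.
  rewrite (ge0_integral_scale (f := fun t => ((s + t ^+ 2) `^ (- q))%:E) q0)//.
  - by rewrite muleA -EFinM divff ?normr_eq0// mul1e.
  - exact/measurable_EFinP.
  - by move=> t; rewrite lee_fin powR_ge0.
have mH : measurable_fun [set: R1] (fun t : R => (1 + t ^+ 2) `^ (- q)).
  apply: (measurableT_comp (measurable_powR _)).
  by apply: measurable_funD; [exact: measurable_cst|exact: exprn_measurable].
transitivity (C%:E * (`|Num.sqrt s|%:E * \int[mu1]_t (s `^ (- q) * (1 + t ^+ 2) `^ (- q))%:E))%E.
  congr (_ * (_ * _))%E; apply: eq_integral => t _; congr EFin.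
  rewrite exprMn sqr_sqrtr ?ltW// -powRM ?addr_ge0 ?sqr_ge0 ?(ltW s0)//.
  by rewrite mulrDr mulr1.
rewrite (ge0_integral_EFinZl mu1 (powR_ge0 _ _) mH); last by move=> t; rewrite powR_ge0.
rewrite -/B BE -!EFinM; congr EFin.
rewrite ger0_norm ?sqrtr_ge0// -powR12_sqrt ?ltW//.
rewrite -mulrA; congr (C * _); rewrite mulrA mulrC -powRD ?(gt_eqF s0) ?implybT//.
by congr (_ * powR _ _); rewrite /q -natr1; lra.
Qed.

Definition kapn n (a : R) (x : 'rV[R]_n) : R :=
  Num.min 1 (enorm x) * enorm x `^ (- (n%:R + a)).

Lemma kapn_ge0 n a (x : 'rV[R]_n) : 0 <= kapn a x.
Proof. by rewrite mulr_ge0 ?powR_ge0// le_min ler01 enorm_ge0. Qed.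

Lemma measurable_kapn n a : measurable_fun setT (@kapn n a).
Proof.
apply: measurable_funM; last exact: measurable_enorm_powR.
by apply: measurable_minr; [exact: measurable_cst|exact: measurable_enorm].
Qed.

(** Slices replace polar coordinates. Where |t| >= 1, bounding the minimum by 1 gives a slice of
    order |t|^(-1-a); where |t| < 1, bounding it by the norm gives order |t|^(-a). Both are covered
    by [kap]. *)
Lemma integral_kapn m a : 0 < a < 1 -> (\int[mu m.+1]_x (kapn a x)%:E < +oo)%E.
Proof.
move=> a01; have [a0 a1] := andP a01.
have [|C1 C10 HC1] := @integral_slice m (m%:R + a); first by lra.
have [|C2 C20 HC2] := @integral_slice m (m%:R + 1 + a); first by lra.
have mK : measurable_fun setT (fun x : 'rV[R]_m.+1 => (kapn a x)%:E).
  by apply/measurable_EFinP; exact: measurable_kapn.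
have K0 (x : 'rV[R]_m.+1) : (0 <= (kapn a x)%:E)%E by rewrite lee_fin kapn_ge0.
rewrite (ge0_integral_consrV mK K0).
have mI := measurable_integral_consrV mK K0.
(* The slice through the origin is discarded, because [integral_slice] needs a positive [s], here
   t^2. *)
rewrite -(integral_setD1 (r := 0)); last 2 first.
- by apply: measurableD => //; exact: measurable_set1.
- exact: measurable_funTS.
apply: (@le_lt_trans _ _ (\int[mu1]_t ((C1 + C2) * kap a t)%:E)%E); last first.
  apply: (ge0_integral_EFinZl_lty (mu := mu1)); [by rewrite addr_ge0|
    exact: measurable_kap|exact: kap_ge0|exact: integral_kap].
rewrite integral_mkcond; apply: ge0_le_integral_nomeas => t _.
  by apply: erestrict_ge0 => ? _; apply: integral_ge0.
rewrite /patch; case: ifPn => [|_]; last first.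
  by rewrite lee_fin mulr_ge0 ?addr_ge0 ?kap_ge0.
rewrite inE => -[_ /eqP t0].
have tt : 0 < `|t| by rewrite normr_gt0.
have t20 : 0 < t ^+ 2 by rewrite -real_normK ?num_real// exprn_gt0.
have tE (r : R) : (t ^+ 2) `^ (r / 2) = `|t| `^ r.
  by rewrite -real_normK ?num_real// -powR_mulrn// -powRrM mulrCA divff ?mulr1.
have le1 (q C : R) : (forall x : 'rV[R]_m.+1, 0 < enorm x -> kapn a x <= enorm x `^ (- q)) ->
    (forall s, 0 < s -> (\int[mu m]_h ((s + dotrV h h) `^ (- (q / 2)))%:E =
      (C * s `^ ((m%:R - q) / 2))%:E)%E) ->
    (\int[mu m]_h (kapn a (consrV (t, h)))%:E <= (C * `|t| `^ (m%:R - q))%:E)%E.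
  move=> kq HC; rewrite -tE -HC//; apply: ge0_le_integral_nomeas => h _ //.
  rewrite lee_fin; apply: (le_trans (kq _ _)).
    by apply: (@enorm_gt0 _ _ ord0); rewrite consrV0.
  by rewrite enorm_powR dotrV_consrV mulNr.
rewrite /kap; have [t1|t1] := leP 1 `|t|.
- apply: (le_trans (le1 (m%:R + 1 + a) C2 _ HC2)).
    move=> x x0; rewrite /kapn -natr1 ler_piMl ?powR_ge0//.
    by rewrite ge_min lexx.
  rewrite lee_fin mul1r (_ : m%:R - _ = - (1 + a)); last lra.
  by rewrite ler_wpM2r ?powR_ge0// lerDr.
- apply: (le_trans (le1 (m%:R + a) C1 _ HC1)).
    move=> x x0; rewrite /kapn -natr1.
    apply: (@le_trans _ _ (enorm x * enorm x `^ (- (m%:R + 1 + a)))).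
      by rewrite ler_wpM2r ?powR_ge0// ge_min lexx orbT.
    rewrite -{1}(powRr1 (ltW x0)) -powRD ?(gt_eqF x0) ?implybT//.
    by rewrite (_ : 1 + _ = - (m%:R + a))//; lra.
  rewrite lee_fin -{2}(powRr1 (ltW tt)) -powRD ?(gt_eqF tt) ?implybT//.
  rewrite (_ : 1 + _ = - a); last lra.
  rewrite (_ : m%:R - _ = - a); last lra.
  by rewrite ler_wpM2r ?powR_ge0// lerDl.
Qed.

Definition ker n (a : R) (i : 'I_n) (x : 'rV[R]_n) : R :=
  x ord0 i * enorm x `^ (- (n%:R + a + 1)).

Lemma measurable_ker n a i : measurable_fun setT (@ker n a i).
Proof.
by apply: measurable_funM; [exact: measurable_coord_rV|exact: measurable_enorm_powR].
Qed.

Lemma norm_kerM n a i (x : 'rV[R]_n) (u M : R) :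
  `|u| <= M * Num.min 1 (enorm x) -> `|ker a i x * u| <= M * kapn a x.
Proof.
move=> uM; rewrite /ker /kapn mulrA.
have [->|xi] := eqVneq (x ord0 i) 0.
  by rewrite !mul0r normr0 mulr_ge0 ?powR_ge0// (le_trans _ uM).
have x0 := enorm_gt0 xi.
rewrite normrM mulrC ler_pM// normrM (ger0_norm (powR_ge0 _ _)).
apply: (@le_trans _ _ (enorm x * enorm x `^ (- (n%:R + a + 1)))).
  by rewrite ler_wpM2r ?powR_ge0// coord_le_enorm.
rewrite -{1}(powRr1 (ltW x0)) -powRD ?(gt_eqF x0) ?implybT//.
by rewrite (_ : 1 + _ = - (n%:R + a))//; lra.
Qed.

(** By homogeneity, integrating out the transverse variables leaves the one-dimensional kernel of
    the same order; this is what reduces the normal direction to the line. At [t = 0] both sides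
    vanish by the conventions for [Num.sg] and [ker]. *)
Lemma integral_ker_slice m a : 0 < a < 1 -> exists2 C, 0 <= C &
  forall t, (mu m).-integrable setT (fun h => (ker a ord0 (consrV (t, h)))%:E) /\
  \int[mu m]_h ker a ord0 (consrV (t, h)) = C * kfun a t.
Proof.
move=> /andP[a0 a1].
have [|C C0 HC] := @integral_slice m (m%:R + 1 + a + 1); first by lra.
exists C => // t.
have [->|t0] := eqVneq t 0.
  have E0 h : ker a ord0 (consrV (0, h)) = 0 :> R by rewrite /ker consrV0 mul0r.
  split.
    by have := @integrable0 _ _ _ (mu m) setT; apply: eq_integrable => // h _; rewrite E0.
  rewrite /kfun sgr0 mul0r mulr0 /Rintegral; under eq_integral do rewrite E0.
  by rewrite integral0.
have tt : 0 < `|t| by rewrite normr_gt0.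
have t20 : 0 < t ^+ 2 by rewrite -real_normK ?num_real// exprn_gt0.
pose Q (h : 'rV[R]_m) := (t ^+ 2 + dotrV h h) `^ (- ((m%:R + 1 + a + 1) / 2)).
have kerE h : ker a ord0 (consrV (t, h)) = t * Q h.
  by rewrite /ker consrV0 enorm_powR dotrV_consrV /Q mulNr -natr1.
have Qi : (mu m).-integrable setT (EFin \o Q).
  apply: (integrable_le (mu := mu m) (g := Q)).
  - apply: (measurableT_comp (measurable_powR _)).
    by apply: measurable_funD; [exact: measurable_cst|exact: measurable_dotrV].
  - by move=> h; rewrite ger0_norm ?powR_ge0.
  - by rewrite HC// ltry.
split.
  have := integrableZl measurableT t Qi; apply: eq_integrable => // h _.
  by rewrite kerE.
rewrite (_ : (fun h => _) = (fun h => t * Q h)); last by apply/funext => h.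
rewrite RintegralZl// /Rintegral HC//= mulrCA; congr (C * _).
rewrite -real_normK ?num_real// -powR_mulrn// -powRrM.
rewrite (_ : 2%:R * ((m%:R - (m%:R + 1 + a + 1)) / 2) = -1 + - (1 + a)); last lra.
rewrite powRD ?(gt_eqF tt) ?implybT// mulrA /kfun; congr (_ * _).
by rewrite powR_inv1// [X in X / _]numEsg mulfK ?gt_eqF.
Qed.

End enorm_theory.

(** * Pointwise and Lipschitz bounds for test fields *)

Section test_fields.
Context (R : realType).
Notation mu1 := (@lebesgue_measure R).
Notation mu n := (lebesgue_rV R n).

Lemma coord_le_norm n (x : 'rV[R]_n) i : `|x ord0 i| <= `|x|.
Proof.
by rewrite [leRHS]/Num.norm /= mx_normrE; apply/bigmax_geP; right => /=; exists (ord0, i).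
Qed.

Lemma lebesgue_rV_ball_gt0 n (x : 'rV[R]_n) (e : R) : 0 < e -> (0 < mu n (ball x e))%E.
Proof.
move=> e0; have -> : ball x e = [set y | forall i, ball (x ord0 i) e (y ord0 i)].
  apply/seteqP; split=> y /= => [[_ xy] i|xy]; first exact: xy.
  by split=> // i j; rewrite (ord1 i); exact: xy.
rewrite (@lebesgue_rV_box R n (fun i => ball (x ord0 i) e)); last by move=> i; exact: measurable_ball.
elim/big_ind: _ => // [u v u0 v0|i _]; first exact: mule_gt0.
by rewrite lebesgue_measure_ball ?ltW// lte_fin mulrn_wgt0.
Qed.

(** The constraint on test fields is an essential bound. If a component exceeded 1 at a point, by
    continuity it would do so on a ball, and balls have positive measure. *)
Lemma unit_test_field_le1 n (phi : 'rV[R]_n -> 'rV[R]_n) x i :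
  unit_test_field phi -> `|phi x ord0 i| <= 1.
Proof.
move=> [sphi _ phi1]; rewrite leNgt; apply/negP => x1.
have cphi : continuous (fun y => phi y ord0 i).
  move=> y; apply: (@continuous_comp _ _ _ phi (fun z : 'rV[R]_n => z ord0 i)).
    exact: (sphi 0%N).
  exact: coord_continuous.
have [e /= e0 xe] : nbhs_ball x [set y | 1 < `|phi y ord0 i|].
  apply/nbhs_ballP; apply: open_nbhs_nbhs; split => //.
  apply: (@open_comp _ _ (fun y => `|phi y ord0 i|) [set z | 1 < z]); last exact: open_gt.
  by move=> y _; apply: continuous_comp; [exact: cphi|exact: norm_continuous].
(* The norm is an essential supremum only when the whole space has positive measure. *)
have muT : (0 < mu n setT)%E.
  by apply: (lt_le_trans (lebesgue_rV_ball_gt0 x e0)); apply: le_measure; rewrite ?inE//;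
    apply: open_measurable_rV; exact: ball_open.
move: phi1; rewrite unlock muT => /ess_supP[A [mA A0 hA]].
have : (0 < mu n A)%E.
  apply: (lt_le_trans (lebesgue_rV_ball_gt0 x e0)); apply: le_measure; rewrite ?inE//.
    by apply: open_measurable_rV; exact: ball_open.
  move=> y xy; apply: hA => /=; rewrite lee_fin ger0_norm ?enorm_ge0//.
  by apply/negP; rewrite -ltNge (lt_le_trans (xe _ xy))// coord_le_enorm.
by rewrite A0 ltxx.
Qed.

Lemma smooth_measurable n (phi : 'rV[R]_n -> 'rV[R]_n) i :
  continuous phi -> measurable_fun setT (fun x => phi x ord0 i).
Proof.
move=> cphi; apply: continuous_measurable_rV => y.
apply: (@continuous_comp _ _ _ phi (fun z : 'rV[R]_n => z ord0 i)); first exact: cphi.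
exact: coord_continuous.
Qed.

Lemma derive_bounded n (phi : 'rV[R]_n -> 'rV[R]_n) v :
  smooth phi -> compactly_supported phi -> exists M, forall x, `|'D_v phi x| <= M.
Proof.
move=> sphi cphi; have [_ /(_ v) cD] := sphi 1%N.
have [M [_ HM]] := compact_bounded (continuous_compact (continuous_subspaceT cD) cphi).
exists (Num.max 0 (M + 1)) => x.
have [xK|xK] := pselect (closure [set y | phi y != 0] x).
  by rewrite le_max (HM (M + 1)) ?orbT ?ltrDl//; exists x.
rewrite (_ : 'D_v phi x = 0) ?normr0 ?le_max ?lexx//.
rewrite (@near_eq_derive _ _ _ phi (cst 0)) ?derive_cst//.
have : nbhs x (~` closure [set y | phi y != 0]).
  apply: open_nbhs_nbhs; split => //; apply: closed_openC; exact: closed_closure.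
apply: filterS => y yK; apply: contrapT => /eqP y0; apply: yK; exact: subset_closure.
Qed.

(** The mean value theorem along a segment, with [L] the sum of the bounds on the partial
    derivatives. *)
Lemma smooth_lipschitz n (phi : 'rV[R]_n -> 'rV[R]_n) :
  smooth phi -> compactly_supported phi ->
  exists2 L, 0 <= L & forall x h i, `|phi (x + h) ord0 i - phi x ord0 i| <= L * enorm h.
Proof.
move=> sphi cphi.
have [B HB] : exists B : 'I_n -> R, forall j x, `|'D_(delta_mx ord0 j) phi x| <= B j.
  have H j : exists M, forall x, `|'D_(delta_mx ord0 j) phi x| <= M by exact: derive_bounded.
  by exists (fun j => projT1 (cid (H j))) => j x; case: cid => /=.
have B0 j : 0 <= B j by apply: le_trans (HB j 0).
exists (\sum_j B j); first by apply: sumr_ge0.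
have [dphi _] := sphi 1%N.
move=> x h i.
pose aff (t : R) : 'rV[R]_n := x + t *: h.
pose u (t : R) : R := phi (aff t) ord0 i.
have du (t : R) : is_derive t (1 : R) u ('D_h phi (aff t) ord0 i).
  have dph : derivable phi (aff t) h by exact: diff_derivable.
  have cu : (s^-1 *: (u (s *: (1 : R) + t) - u t)) @[s --> (0 : R)^'] -->
      ('D_h phi (aff t) ord0 i : R).
    rewrite (_ : (fun s => _) = (fun z : 'rV[R]_n => z ord0 i) \o
        (fun s => s^-1 *: (phi (s *: h + aff t) - phi (aff t)))); last first.
      apply/funext => s /=; rewrite !mxE /u; congr (_ * (phi _ _ _ - _)).
      by rewrite /aff [s%:A]mulr1 scalerDl addrCA.
    have cvd : (fun s : R => s^-1 *: (phi (s *: h + aff t) - phi (aff t))) @ (0 : R)^' -->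
      'D_h phi (aff t) by exact: dph.
    apply: (@continuous_cvg _ _ _ _ _ _ (fun z : 'rV[R]_n => z ord0 i) _ _ cvd).
    exact: coord_continuous.
  apply: DeriveDef; first by apply/cvg_ex; eexists; exact: cu.
  exact/cvg_lim/cu.
have cu : {within `[0, 1], continuous u}.
  apply: continuous_subspaceT => t; apply: differentiable_continuous.
  by apply/derivable1_diffP; case: (du t).
have [c _] := MVT_segment ler01 (fun t _ => du t) cu.
rewrite /u /aff scale1r scale0r addr0 subr0 mulr1 => ->.
rewrite deriveE// [X in 'd _ _ X]row_sum_delta linear_sum/= summxE.
apply: (le_trans (ler_norm_sum _ _ _)); rewrite mulr_suml.
apply: ler_sum => j _; rewrite linearZ/= mxE normrM mulrC ler_pM ?coord_le_enorm//.
by rewrite -deriveE// (le_trans (coord_le_norm _ _)).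
Qed.

End test_fields.

Section rV_shift_flip.
Context (R : realType).
Notation mu1 := (@lebesgue_measure R).
Notation mu n := (lebesgue_rV R n).

Lemma measure_preserving_shift_rV n (h : 'rV[R]_n) :
  measure_preserving (mu n) (fun x => x + h).
Proof.
rewrite (_ : (fun x => x + h) = cmap (fun i t => t + h ord0 i)).
  by apply: measure_preserving_cmap => i; exact: measure_preserving_shift.
by apply/funext => x; apply/rowP => i; rewrite !mxE.
Qed.

Definition flip n (i : 'I_n) : 'rV[R]_n -> 'rV[R]_n :=
  cmap (fun j t => if j == i then - t else t).

Lemma measure_preserving_flip n (i : 'I_n) : measure_preserving (mu n) (flip i).
Proof.
apply: measure_preserving_cmap => j; case: eqP => _; first exact: measure_preserving_opp.
by split=> //; exact: measurable_id.
Qed.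

Lemma flipE n (i j : 'I_n) x : flip i x ord0 j = if j == i then - x ord0 j else x ord0 j.
Proof. by rewrite mxE. Qed.

Lemma enorm_flip n (i : 'I_n) (x : 'rV[R]_n) : enorm (flip i x) = enorm x.
Proof.
rewrite /enorm; congr Num.sqrt; apply: eq_bigr => j _; rewrite flipE.
by case: eqP => _ //; rewrite mulrNN.
Qed.

Lemma ker_flip n a (i : 'I_n) (x : 'rV[R]_n) : ker a i (flip i x) = - ker a i x.
Proof. by rewrite /ker flipE eqxx enorm_flip mulNr. Qed.

Lemma measurable_addrV n :
  measurable_fun setT (fun z : 'rV[R]_n * 'rV[R]_n => z.1 + z.2).
Proof.
apply: measurable_fun_rVP => i.
rewrite (_ : (fun t => _) = (fun z : 'rV[R]_n * 'rV[R]_n => z.1 ord0 i + z.2 ord0 i)); last first.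
  by apply/funext => z; rewrite mxE.
by apply: measurable_funD;
  [exact: (measurableT_comp (@measurable_coord_rV R n i) measurable_fst)
  |exact: (measurableT_comp (@measurable_coord_rV R n i) measurable_snd)].
Qed.

End rV_shift_flip.

(** * The competitor and its fractional variation *)

Section cutoff.
Context (R : realType) (m : nat).
Notation mu n := (lebesgue_rV R n).
Implicit Types h k u v : 'rV[R]_m.

(** It is 1 on the unit ball of the sup norm and 0 outside the ball of radius 2. For [m = 0] it is
    constantly 1, so dimension one needs no separate treatment. *)
Definition eta h : R := Num.max 0 (Num.min 1 (2 - `|h|)).

Lemma eta_ge0 h : 0 <= eta h. Proof. by rewrite le_max lexx. Qed.

Lemma eta_le1 h : eta h <= 1. Proof. by rewrite ge_max ler01 ge_min lexx. Qed.

Lemma eta_eq1 h : `|h| <= 1 -> eta h = 1.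
Proof.
move=> h1; rewrite /eta (_ : Num.min 1 _ = 1); first by apply/max_idPr.
by apply/min_idPl; lra.
Qed.

Lemma eta_eq0 h : 2 <= `|h| -> eta h = 0.
Proof.
move=> h2; apply/max_idPl; rewrite ge_min; apply/orP; right; lra.
Qed.

Lemma eta_lip h k : `|eta h - eta k| <= `|h - k|.
Proof.
have d := ler_dist_dist h k.
rewrite ler_norml; move: d; rewrite ler_norml => /andP[d1 d2].
rewrite /eta; case: (leP 1 (2 - `|h|)); case: (leP 1 (2 - `|k|)) => H1 H2.
- by have := normr_ge0 (h - k); case: (leP 0 (1:R)) => _; lra.
- by have := normr_ge0 (h - k); case: (leP 0 (1:R)); case: (leP 0 (2 - `|k|)); lra.
- by have := normr_ge0 (h - k); case: (leP 0 (1:R)); case: (leP 0 (2 - `|h|)); lra.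
- by have := normr_ge0 (h - k); case: (leP 0 (2 - `|h|)); case: (leP 0 (2 - `|k|)); lra.
Qed.

Lemma measurable_eta : measurable_fun setT eta.
Proof.
apply: continuous_measurable_rV => h.
apply: (@cvgrPdist_le _ _ _ (nbhs h) _ eta (eta h)).2 => e e0.
near=> k; apply: (le_trans (eta_lip _ _)).
near: k; apply/nbhs_ballP; exists e => //= k.
by rewrite -ball_normE/= => /ltW.
Unshelve. all: by end_near. Qed.

Let box : set 'rV[R]_m := ball 0 2.
Let mbox : measurable box. Proof. by apply: open_measurable_rV; exact: ball_open. Qed.

Definition eta_vol : R := fine (mu m box).

Let box_lty : (mu m box < +oo)%E.
Proof.
have -> : box = [set y | forall i, ball (0 : R) 2 (y ord0 i)].
  apply/seteqP; split=> y /= => [[_ xy] i|xy]; first by have := xy ord0 i; rewrite mxE.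
  by split=> // i j; rewrite (ord1 i) mxE; exact: xy.
rewrite (@lebesgue_rV_box R m (fun i => ball (0:R) 2)); last by move=> i; exact: measurable_ball.
rewrite -ge0_fin_numE; last by apply: prode_ge0.
elim/big_ind: _ => // [u v|i _]; first exact: fin_numM.
by rewrite lebesgue_measure_ball.
Qed.

Let volE : mu m box = eta_vol%:E.
Proof. by rewrite fineK// ge0_fin_numE. Qed.

Lemma eta_vol_ge0 : 0 <= eta_vol. Proof. by rewrite fine_ge0. Qed.

Let indic_box h : (\1_box h : R) = if `|h| < 2 then 1 else 0.
Proof.
rewrite indicE; have [h2|h2] := ltP `|h| 2.
  by rewrite mem_set// /box -ball_normE/= sub0r normrN.
by rewrite memNset// /box -ball_normE/= sub0r normrN; apply/negP; rewrite -leNgt.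
Qed.

Let mind : measurable_fun setT (\1_box : 'rV[R]_m -> R). Proof. exact: measurable_indic. Qed.

Let integral_box h : (\int[mu m]_x (\1_box (x + h))%:E = eta_vol%:E)%E.
Proof.
rewrite (ge0_integral_preserving (f := fun x => (\1_box x)%:E) (measure_preserving_shift_rV h)).
- by rewrite integral_indic// setIT; exact: volE.
- exact/measurable_EFinP.
- by move=> x; rewrite lee_fin.
Qed.

Let eta_le_box h : eta h <= \1_box h.
Proof.
rewrite indic_box; case: ltP => [_|h2]; first exact: eta_le1.
by rewrite eta_eq0.
Qed.

Lemma integral_eta : (\int[mu m]_x (eta x)%:E <= eta_vol%:E)%E.
Proof.
rewrite -(integral_box 0); apply: ge0_le_integral_nomeas => x _; rewrite lee_fin ?eta_ge0//.
by rewrite addr0 eta_le_box.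
Qed.

(** The difference is at most min(1, |u - v|) everywhere and vanishes off the two translated
    supports, whose volumes account for the factor 2. *)
Lemma integral_eta_shift u v :
  (\int[mu m]_x `|eta (x - u) - eta (x - v)|%:E <= (2 * eta_vol * Num.min 1 `|u - v|)%:E)%E.
Proof.
pose F (x : 'rV[R]_m) : R := \1_box (x + (- u)) + \1_box (x + (- v)).
have F0 x : 0 <= F x by rewrite addr_ge0.
have mF : measurable_fun setT F.
  by apply: measurable_funD; apply: (measurableT_comp mind);
    [case: (measure_preserving_shift_rV (- u))|case: (measure_preserving_shift_rV (- v))].
have min0 : 0 <= Num.min 1 `|u - v| by rewrite le_min ler01 normr_ge0.
apply: (@le_trans _ _ (\int[mu m]_x (Num.min 1 `|u - v| * F x)%:E)%E).
  apply: ge0_le_integral_nomeas => x _; rewrite lee_fin//.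
  have le1 : `|eta (x - u) - eta (x - v)| <= 1.
    have := eta_ge0 (x - u); have := eta_le1 (x - u).
    have := eta_ge0 (x - v); have := eta_le1 (x - v); rewrite ler_norml; lra.
  have le2 : `|eta (x - u) - eta (x - v)| <= `|u - v|.
    by apply: (le_trans (eta_lip _ _)); rewrite opprB addrC subrKA distrC.
  have [xu|xu] := ltP `|x - u| 2.
    apply: (@le_trans _ _ (Num.min 1 `|u - v|)); first by rewrite le_min le1.
    by rewrite ler_peMr// /F indic_box xu lerDl.
  have [xv|xv] := ltP `|x - v| 2.
    apply: (@le_trans _ _ (Num.min 1 `|u - v|)); first by rewrite le_min le1.
    by rewrite ler_peMr// /F (indic_box (x + - v)) xv lerDr.
  by rewrite !eta_eq0// subrr normr0 mulr_ge0.
rewrite (ge0_integral_EFinZl (mu m) min0 mF F0).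
under eq_integral do rewrite EFinD.
rewrite ge0_integralD//; last 2 first.
- apply/measurable_EFinP; apply: (measurableT_comp mind).
  by case: (measure_preserving_shift_rV (- u)).
- apply/measurable_EFinP; apply: (measurableT_comp mind).
  by case: (measure_preserving_shift_rV (- v)).
by rewrite !integral_box -EFinD -EFinM lee_fin; lra.
Qed.

End cutoff.

Section competitor.
Context (R : realType) (m : nat) (a : R).
Hypothesis a01 : 0 < a < 1.
Notation mu1 := (@lebesgue_measure R).
Notation mu n := (lebesgue_rV R n).
Notation n := m.+1.
Notation R1 := (measurableTypeR R).

Definition tailV (x : 'rV[R]_n) : 'rV[R]_m := (unconsrV x).2.

Lemma tailV_consrV t (y : 'rV[R]_m) : tailV (consrV (t, y)) = y.
Proof. by rewrite /tailV consrVK. Qed.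

Lemma tailVB (x h : 'rV[R]_n) : tailV (x - h) = tailV x - tailV h.
Proof. by apply/rowP => j; rewrite !mxE. Qed.

Lemma tailVD (x h : 'rV[R]_n) : tailV (x + h) = tailV x + tailV h.
Proof. by apply/rowP => j; rewrite !mxE. Qed.

Lemma consrV_eta (x : 'rV[R]_n) : consrV (x ord0 ord0, tailV x) = x.
Proof. exact: unconsrVK. Qed.

Lemma norm_le_enorm p (x : 'rV[R]_p) : `|x| <= enorm x.
Proof.
rewrite [leLHS]/Num.norm /= mx_normrE; apply/bigmax_leP; split=> [|[i j] _] /=.
  exact: enorm_ge0.
by rewrite (ord1 i); exact: coord_le_enorm.
Qed.

Lemma norm_tailV (x : 'rV[R]_n) : `|tailV x| <= enorm x.
Proof.
apply: (le_trans (norm_le_enorm _)); rewrite -[in leRHS](consrV_eta x) /enorm dotrV_consrV.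
by rewrite ler_sqrt ?addr_ge0 ?sqr_ge0 ?dotrV_ge0// lerDr sqr_ge0.
Qed.

Lemma measurable_tailV : measurable_fun setT tailV.
Proof. exact: (measurableT_comp measurable_snd (@measurable_unconsrV R m)). Qed.

Definition competitor (x : 'rV[R]_n) : R := gfun a (x ord0 ord0) * eta (tailV x).

Lemma competitor_consrV t y : competitor (consrV (t, y)) = gfun a t * eta y.
Proof. by rewrite /competitor consrV0 tailV_consrV. Qed.

Lemma measurable_competitor : measurable_fun setT competitor.
Proof.
apply: measurable_funM.
  exact: (measurableT_comp (measurable_gfun a) (@measurable_coord_rV R n ord0)).
exact: (measurableT_comp (@measurable_eta R m) measurable_tailV).
Qed.

Let mnorm d (T : measurableType d) (f : T -> R) : measurable_fun setT f ->
  measurable_fun setT (fun x => `|f x|).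
Proof. by move=> mf; exact: (measurableT_comp (@normr_measurable R setT) mf). Qed.

Let G1 := fine (\int[mu1]_x `|gfun a x|%:E).

Let G1E : (\int[mu1]_x `|gfun a x|%:E = G1%:E)%E.
Proof.
rewrite fineK// ge0_fin_numE; first exact: integral_gfun.
by apply: integral_ge0 => x _; rewrite lee_fin.
Qed.


Let vol := eta_vol R m.
Let vol0 : 0 <= vol := eta_vol_ge0 R m.

Let integral_gfunZ (c : R) : 0 <= c -> (\int[mu1]_t (c * `|gfun a t|)%:E = (c * G1)%:E)%E.
Proof.
move=> c0; rewrite (ge0_integral_EFinZl mu1 c0 (mnorm (measurable_gfun a)))//.
by rewrite G1E EFinM.
Qed.

Lemma integral_norm_competitor : (\int[mu n]_x `|competitor x|%:E <= (vol * G1)%:E)%E.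
Proof.
have mc : measurable_fun setT (fun x => `|competitor x|%:E).
  by apply/measurable_EFinP; apply: mnorm; exact: measurable_competitor.
rewrite (ge0_integral_consrV mc)//.
rewrite -integral_gfunZ//; apply: ge0_le_integral_nomeas => t _; first exact: integral_ge0.
under eq_integral do rewrite competitor_consrV normrM (ger0_norm (eta_ge0 _)).
rewrite (ge0_integral_EFinZl (mu m) (normr_ge0 _) (@measurable_eta R m) (@eta_ge0 R m)).
by rewrite mulrC EFinM lee_wpmul2l ?lee_fin//; exact: integral_eta.
Qed.

Lemma integrable_competitor : (mu n).-integrable setT (EFin \o competitor).
Proof.
apply: (integrable_le (mu := mu n) (g := fun x => `|competitor x|)) => //.
  exact: measurable_competitor.
exact: le_lt_trans integral_norm_competitor (ltry _).
Qed.

(** Equal first coordinates let the singular factor [gfun] come out of the difference, so that only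
    [eta] is differenced. *)
Lemma integral_competitor_shift (h k : 'rV[R]_n) : h ord0 ord0 = k ord0 ord0 ->
  (\int[mu n]_x `|competitor (x - h) - competitor (x - k)|%:E <=
   (2 * vol * G1 * Num.min 1 (enorm (h - k)))%:E)%E.
Proof.
move=> hk.
have mcs u : measurable_fun setT (fun x : 'rV[R]_n => competitor (x - u)).
  by apply: (measurableT_comp measurable_competitor); case: (measure_preserving_shift_rV (- u)).
have mc : measurable_fun setT (fun x : 'rV[R]_n => `|competitor (x - h) - competitor (x - k)|%:E).
  by apply/measurable_EFinP; apply: mnorm; exact: measurable_funB.
rewrite (ge0_integral_consrV mc)//.
set c := Num.min 1 _.
have c0 : 0 <= c by rewrite le_min ler01 enorm_ge0.
have mge : measurable_fun [set: R1] (fun t : R1 => `|gfun a t|%:E).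
  by apply/measurable_EFinP; apply: mnorm; exact: measurable_gfun.
apply: (@le_trans _ _ (\int[mu1]_t ((2 * vol * c) * `|gfun a (t - h ord0 ord0)|)%:E)%E).
  apply: ge0_le_integral_nomeas => t _; first exact: integral_ge0.
  have E y : competitor (consrV (t, y) - h) - competitor (consrV (t, y) - k) =
      gfun a (t - h ord0 ord0) * (eta (y - tailV h) - eta (y - tailV k)).
    rewrite /competitor !tailVB tailV_consrV mulrBr; congr (_ * _ - _ * _).
      by rewrite !mxE unlift_none.
    by rewrite !mxE unlift_none/= hk.
  under eq_integral do rewrite E normrM.
  have meta u : measurable_fun setT (fun y : 'rV[R]_m => eta (y - u)).
    by apply: (measurableT_comp (@measurable_eta R m)); case: (measure_preserving_shift_rV (- u)).
  rewrite (ge0_integral_EFinZl (mu m) (normr_ge0 _) (mnorm (measurable_funB (meta _) (meta _))))//.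
  rewrite [in leRHS]mulrC EFinM lee_wpmul2l ?lee_fin//.
  apply: (le_trans (integral_eta_shift _ _)); rewrite lee_fin.
  rewrite ler_wpM2l ?mulr_ge0// /c -tailVB.
  by rewrite le_min ge_min lexx/= ge_min norm_tailV orbT.
have mgs : measurable_fun [set: R1] (fun t : R1 => `|gfun a (t - h ord0 ord0)|).
  apply: mnorm; apply: (measurableT_comp (measurable_gfun a)).
  by case: (measure_preserving_shift (- h ord0 ord0)).
rewrite (ge0_integral_EFinZl mu1 _ mgs)//; last by rewrite !mulr_ge0.
rewrite (ge0_integral_preserving (measure_preserving_shift (- h ord0 ord0)) mge)//.
by rewrite G1E -EFinM lee_fin mulrAC.
Qed.

Section correlation.
Variables (phi : 'rV[R]_n -> R) (L : R).
Hypothesis mphi : measurable_fun setT phi.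
Hypothesis phi1 : forall x, `|phi x| <= 1.
Hypothesis phiL : forall x h, `|phi (x + h) - phi x| <= L * enorm h.

Definition corr h : R := \int[mu n]_x (competitor x * phi (x + h)).

Lemma L_ge0 : 0 <= L.
Proof.
have := phiL 0 (delta_mx ord0 ord0).
have e1 : 0 < enorm (delta_mx ord0 ord0 : 'rV[R]_n).
  by apply: (@enorm_gt0 _ _ _ ord0); rewrite mxE !eqxx oner_eq0.
by move/(le_trans (normr_ge0 _)); rewrite pmulr_lge0.
Qed.

Let mshift h : measurable_fun setT (fun x : 'rV[R]_n => phi (x + h)).
Proof. by apply: (measurableT_comp mphi); case: (measure_preserving_shift_rV h). Qed.

Let norm_comp_lty : (\int[mu n]_x `|competitor x|%:E < +oo)%E.
Proof. exact: le_lt_trans integral_norm_competitor (ltry _). Qed.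

Lemma integrable_corr h : (mu n).-integrable setT (EFin \o (fun x => competitor x * phi (x + h))).
Proof.
apply: (integrable_le (mu := mu n) (g := fun x => `|competitor x|)) => //.
  by apply: measurable_funM => //; exact: measurable_competitor.
by move=> x; rewrite normrM ler_piMr.
Qed.

Lemma phi_diff_bound x h : `|phi (x + h) - phi x| <= (L + 2) * Num.min 1 (enorm h).
Proof.
have L0 := L_ge0.
have [h1|h1] := leP 1 (enorm h).
  rewrite mulr1; apply: (le_trans (ler_normB _ _)).
  by have := phi1 (x + h); have := phi1 x; lra.
by apply: (le_trans (phiL _ _)); rewrite ler_wpM2r ?enorm_ge0// lerDl.
Qed.

(** A change of variables moves the translation from [phi] onto the competitor. Then [phi] enters
    through its bound 1 only, and the estimate is free of [L]. *)
Lemma corr_modulus (h k : 'rV[R]_n) : h ord0 ord0 = k ord0 ord0 ->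
  `|corr h - corr k| <= 2 * vol * G1 * Num.min 1 (enorm (h - k)).
Proof.
move=> hk.
have corrE (u : 'rV[R]_n) : corr u = \int[mu n]_x (competitor (x - u) * phi x) /\
    (mu n).-integrable setT (EFin \o (fun x => competitor (x - u) * phi x)).
  have I : (mu n).-integrable setT (EFin \o (fun x => competitor (x - u) * phi x)).
    have := integrable_preserving (measure_preserving_shift_rV (- u)) (integrable_corr u).
    by apply: eq_integrable => // x _ /=; rewrite subrK.
  split => //.
  rewrite -(Rintegral_preserving (measure_preserving_shift_rV u) I).
  by rewrite /corr; apply: eq_Rintegral => x _; rewrite addrK.
have [-> Ih] := corrE h; have [-> Ik] := corrE k.
rewrite -RintegralB//.
have le := integral_competitor_shift hk.
have lty := le_lt_trans le (ltry _).
apply: (@le_trans _ _ (fine (\int[mu n]_x `|competitor (x - h) - competitor (x - k)|%:E))).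
  apply: le_Rintegral_fine; [exact: (integrableB measurableT Ih Ik)| |exact: lty].
  by move=> x; rewrite -mulrBl normrM ler_piMr.
rewrite -lee_fin fineK// ge0_fin_numE//.
by apply: integral_ge0 => x _; rewrite lee_fin.
Qed.

(** The function to which the estimate on the line is applied as [Psi]. Its sup bound depends on the
    volume of the cutoff alone, its Lipschitz constant on [L]. *)
Definition slice_mean (t : R) : R := \int[mu m]_y (eta y * phi (consrV (t, y))).

Let integrable_slice t : (mu m).-integrable setT (EFin \o (fun y => eta y * phi (consrV (t, y)))).
Proof.
apply: (integrable_le (mu := mu m) (g := @eta R m)).
- apply: measurable_funM; first exact: measurable_eta.
  exact: (measurableT_comp mphi (measurable_consrV1 _)).
- by move=> y; rewrite normrM (ger0_norm (eta_ge0 _)) ler_piMr ?eta_ge0.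
- exact: le_lt_trans (integral_eta R m) (ltry _).
Qed.

Let fine_eta : fine (\int[mu m]_y (eta y)%:E) <= vol.
Proof.
rewrite -lee_fin fineK; first exact: integral_eta.
rewrite ge0_fin_numE; first exact: le_lt_trans (integral_eta R m) (ltry _).
by apply: integral_ge0 => y _; rewrite lee_fin eta_ge0.
Qed.

Lemma slice_mean_bound t : `|slice_mean t| <= vol.
Proof.
apply: le_trans fine_eta; apply: le_Rintegral_fine; first exact: integrable_slice.
- by move=> y; rewrite normrM (ger0_norm (eta_ge0 _)) ler_piMr ?eta_ge0.
- exact: le_lt_trans (integral_eta R m) (ltry _).
Qed.

Lemma slice_mean_lip s t : `|slice_mean s - slice_mean t| <= vol * L * `|s - t|.
Proof.
rewrite /slice_mean -RintegralB//.
have lty := le_lt_trans (integral_eta R m) (ltry _).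
have c0 : 0 <= L * `|s - t| by rewrite mulr_ge0// L_ge0.
apply: (@le_trans _ _ (fine (\int[mu m]_y (L * `|s - t| * eta y)%:E))).
  apply: le_Rintegral_fine; first exact: (integrableB measurableT (integrable_slice s) (integrable_slice t)).
    move=> y; rewrite -mulrBr normrM (ger0_norm (eta_ge0 _)) mulrC ler_wpM2r ?eta_ge0//.
    have := phiL (consrV (t, y)) (consrV (s - t, 0)).
    have -> : consrV (t, y) + consrV (s - t, 0) = consrV (s, y).
      rewrite -[RHS]consrV_eta -[LHS]consrV_eta tailVD !tailV_consrV addr0.
      by rewrite [in LHS]mxE !consrV0 addrC subrK.
    rewrite /enorm dotrV_consrV [dotrV 0 0](_ : _ = 0) ?addr0 ?sqrtr_sqr//.
    by rewrite /dotrV big1// => i _; rewrite mxE mul0r.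
  exact: (ge0_integral_EFinZl_lty c0 (@measurable_eta R m) (@eta_ge0 R m)).
rewrite (ge0_integral_EFinZl (mu m) c0 (@measurable_eta R m) (@eta_ge0 R m)).
have fin : (\int[mu m]_y (eta y)%:E)%E \is a fin_num.
  by rewrite ge0_fin_numE//; apply: integral_ge0 => y _; rewrite lee_fin eta_ge0.
by rewrite fineM//= -mulrA [leRHS]mulrC ler_wpM2l.
Qed.

Lemma corr_consrV0 t : corr (consrV (t, 0)) = \int[mu1]_x (gfun a x * slice_mean (x + t)).
Proof.
have Fi := integrable_corr (consrV (t, 0)).
rewrite /corr /Rintegral (integral_consrV Fi); congr fine.
apply: eq_integral => s _.
have E y : competitor (consrV (s, y)) * phi (consrV (s, y) + consrV (t, 0)) =
    gfun a s * (eta y * phi (consrV (s + t, y))).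
  rewrite competitor_consrV -mulrA; congr (_ * (_ * phi _)).
  rewrite -[RHS]consrV_eta -[LHS]consrV_eta tailVD !tailV_consrV addr0.
  by rewrite [in LHS]mxE !consrV0.
under eq_integral do rewrite /= E EFinM.
rewrite integralZl//; last exact: integrable_slice.
by rewrite /slice_mean /Rintegral EFinM fineK// integrable_fin_num//; exact: integrable_slice.
Qed.

End correlation.
End competitor.

(** * A bound on the pairing that is uniform over test fields *)

Section upper_bound.
Context (R : realType) (m : nat) (a : R).
Hypothesis a01 : 0 < a < 1.
Notation mu1 := (@lebesgue_measure R).
Notation mu n := (lebesgue_rV R n).
Notation n := m.+1.
Notation R1 := (measurableTypeR R).
Notation V := 'rV[R]_n.

Let Kapn := fine (\int[mu n]_x (kapn a x)%:E).
Let KapnE : (\int[mu n]_x (kapn a x)%:E = Kapn%:E)%E.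
Proof.
rewrite fineK// ge0_fin_numE; first exact: integral_kapn.
by apply: integral_ge0 => x _; rewrite lee_fin kapn_ge0.
Qed.

Let Kapn0 : 0 <= Kapn.
Proof. by rewrite -lee_fin -KapnE; apply: integral_ge0 => x _; rewrite lee_fin kapn_ge0. Qed.

Let integral_kapnZ c : 0 <= c -> (\int[mu n]_x (c * kapn a x)%:E = (c * Kapn)%:E)%E.
Proof.
move=> c0; rewrite (ge0_integral_EFinZl (mu n) c0 (@measurable_kapn R n a) (@kapn_ge0 R n a)).
by rewrite KapnE EFinM.
Qed.

Let mnorm d (T : measurableType d) (f : T -> R) : measurable_fun setT f ->
  measurable_fun setT (fun x => `|f x|).
Proof. by move=> mf; exact: (measurableT_comp (@normr_measurable R setT) mf). Qed.

Lemma Rintegral_kapn_le (f : V -> R) c : 0 <= c -> measurable_fun setT f ->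
  (forall x, `|f x| <= c * kapn a x) ->
  (mu n).-integrable setT (EFin \o f) /\ `|\int[mu n]_x f x| <= c * Kapn.
Proof.
move=> c0 mf fc.
have lty : (\int[mu n]_x (c * kapn a x)%:E < +oo)%E by rewrite integral_kapnZ// ltry.
have fi : (mu n).-integrable setT (EFin \o f) by exact: (integrable_le mf fc lty).
split; first exact: fi.
by have := le_Rintegral_fine fi fc lty; rewrite integral_kapnZ.
Qed.

Let Ncomp := fine (\int[mu n]_x `|competitor a x : R|%:E).
Let NcompE : (\int[mu n]_x `|competitor a x : R|%:E = Ncomp%:E)%E.
Proof.
rewrite fineK// ge0_fin_numE; last by apply: integral_ge0 => x _; rewrite lee_fin.
exact: le_lt_trans (integral_norm_competitor m a01) (ltry _).
Qed.
Let Ncomp0 : 0 <= Ncomp.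
Proof. by rewrite -lee_fin -NcompE; apply: integral_ge0 => x _; rewrite lee_fin. Qed.

Let Mod := 2 * eta_vol R m * fine (\int[mu1]_x `|gfun a x|%:E).
Let Mod0 : 0 <= Mod.
Proof.
by rewrite !mulr_ge0 ?eta_vol_ge0// fine_ge0// integral_ge0.
Qed.

Let lip_measurable (f : V -> R) c : 0 <= c ->
  (forall h k, `|f h - f k| <= c * enorm (h - k)) -> measurable_fun setT f.
Proof.
move=> c0 fc; apply: continuous_measurable_rV => h.
apply: (@cvgrPdist_le _ _ _ (nbhs h) _ f (f h)).2 => e e0.
pose d := e / (c * n%:R + 1).
have D0 : 0 < c * n%:R + 1 by rewrite ltr_pwDr// mulr_ge0.
have d0 : 0 < d by rewrite divr_gt0.
near=> k; apply: (le_trans (fc _ _)).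
have kd : `|h - k| <= d.
  near: k; apply/nbhs_ballP; exists d => //= k.
  by rewrite -ball_normE/= => /ltW.
apply: (@le_trans _ _ (c * (n%:R * d))).
  rewrite ler_wpM2l// (le_trans (enorm_le_sum _))//.
  apply: (@le_trans _ _ (\sum_(i < n) d)).
    by apply: ler_sum => i _; rewrite (le_trans (coord_le_norm _ _)).
  by rewrite sumr_const card_ord mulr_natl.
rewrite mulrA /d mulrA ler_pdivrMr// mulrC ler_wpM2l ?(ltW e0)//.
by rewrite lerDl.
Unshelve. all: by end_near. Qed.

Section scalar.
Variables (phi : V -> R) (L : R).
Hypothesis mphi : measurable_fun setT phi.
Hypothesis phi1 : forall x, `|phi x| <= 1.
Hypothesis phiL : forall x h, `|phi (x + h) - phi x| <= L * enorm h.

Let L0 : 0 <= L := L_ge0 phiL.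
Let ML : R := L + 2.
Let ML0 : 0 <= ML. Proof. by rewrite addr_ge0. Qed.

Let C := corr a phi.

Let mphiD : measurable_fun setT (fun z : V * V => phi (z.1 + z.2)).
Proof. exact: (measurableT_comp mphi (@measurable_addrV R n)). Qed.

Let mshift h : measurable_fun setT (fun x : V => phi (x + h)).
Proof. by apply: (measurableT_comp mphi); case: (measure_preserving_shift_rV h). Qed.

Let mshiftl x : measurable_fun setT (fun h : V => phi (x + h)).
Proof. by under eq_fun do rewrite addrC; exact: mshift. Qed.

Lemma integrable_frac_integrand i x :
  (mu n).-integrable setT (EFin \o (fun h => ker a i h * (phi (x + h) - phi x))).
Proof.
apply: (Rintegral_kapn_le ML0 _ _).1.
  apply: measurable_funM; first exact: measurable_ker.
  by apply: measurable_funB; [exact: mshiftl|exact: measurable_cst].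
by move=> h; apply: norm_kerM; exact: (phi_diff_bound phi1 phiL).
Qed.

Let F i (x h : V) : R := competitor a x * (ker a i h * (phi (x + h) - phi x)).

Let F_bound i x h : `|F i x h| <= `|competitor a x| * (ML * kapn a h).
Proof.
by rewrite normrM ler_wpM2l//; apply: norm_kerM; exact: (phi_diff_bound phi1 phiL).
Qed.

Let mF i : measurable_fun setT (fun z : V * V => F i z.1 z.2).
Proof.
apply: measurable_funM.
  exact: (measurableT_comp (@measurable_competitor R m a) measurable_fst).
apply: measurable_funM; first exact: (measurableT_comp (@measurable_ker R n a i) measurable_snd).
by apply: measurable_funB => //; exact: (measurableT_comp mphi measurable_fst).
Qed.

Let F1 i x : (mu n).-integrable setT (EFin \o F i x).
Proof.
have := integrableZl measurableT (competitor a x) (integrable_frac_integrand i x).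
by apply: eq_integrable.
Qed.

Let Fdiff h : (mu n).-integrable setT (EFin \o (fun x => competitor a x * (phi (x + h) - phi x))).
Proof.
have := integrableB measurableT (integrable_corr a01 mphi phi1 h) (integrable_corr a01 mphi phi1 0).
by apply: eq_integrable => // x _ /=; rewrite addr0 -EFinB -mulrBr.
Qed.

Let CE h k : C h - C k = \int[mu n]_x (competitor a x * (phi (x + h) - phi (x + k))).
Proof.
rewrite /C /corr -RintegralB//; [|exact: integrable_corr..].
by apply: eq_Rintegral => x _; rewrite mulrBr.
Qed.

Let F2 i h : (mu n).-integrable setT (fun x => (F i x h)%:E).
Proof.
have := integrableZl measurableT (ker a i h) (Fdiff h).
by apply: eq_integrable => // x _ /=; rewrite /F -EFinM mulrCA.
Qed.

Let F_abs i : (\int[mu n]_x \int[mu n]_h `|F i x h|%:E < +oo)%E.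
Proof.
have mc : measurable_fun setT (fun x : V => `|competitor a x|).
  by apply: mnorm; exact: measurable_competitor.
apply: (@le_lt_trans _ _ (\int[mu n]_x ((ML * Kapn) * `|competitor a x|)%:E)%E).
  apply: ge0_le_integral_nomeas => x _; first exact: integral_ge0.
  rewrite mulrC mulrA -integral_kapnZ ?mulr_ge0//.
  by apply: ge0_le_integral_nomeas => h _; rewrite lee_fin// -mulrA.
apply: (ge0_integral_EFinZl_lty (mu := mu n) _ mc) => //; first by rewrite mulr_ge0.
by rewrite NcompE ltry.
Qed.

Let W i h := ker a i h * (C h - C 0).

Let W_F i h : \int[mu n]_x F i x h = W i h.
Proof.
rewrite /W CE -RintegralZl//; last first.
  by have := Fdiff h; apply: eq_integrable => // x _ /=; rewrite addr0.
by apply: eq_Rintegral => x _; rewrite addr0 /F mulrCA.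
Qed.

Lemma frac_pairing_corr i :
  \int[mu n]_x (competitor a x * \int[mu n]_h (ker a i h * (phi (x + h) - phi x))) =
  \int[mu n]_h W i h.
Proof.
transitivity (\int[mu n]_x \int[mu n]_h F i x h).
  apply: eq_Rintegral => x _; rewrite -RintegralZl//.
  exact: integrable_frac_integrand.
rewrite (Rintegral_swap (m1 := mu n) (m2 := mu n) (mF i) (F1 i) (F_abs i) (F2 i)).
by apply: eq_Rintegral => h _; rewrite W_F.
Qed.

Lemma integrable_pairing i : (mu n).-integrable setT
  (fun x => (competitor a x * \int[mu n]_h (ker a i h * (phi (x + h) - phi x)))%:E).
Proof.
have := integrable_Rintegral_section (m1 := mu n) (m2 := mu n) (mF i) (F1 i) (F_abs i).
apply: eq_integrable => // x _; congr EFin; rewrite -RintegralZl//.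
exact: integrable_frac_integrand.
Qed.

(** Valid for every pair of shifts but, through [ML], dependent on the Lipschitz constant of [phi]:
    fit for measurability and integrability only. The final constant relies on [C_mod]. *)
Let C_bound h k : `|C h - C k| <= Ncomp * ML * Num.min 1 (enorm (h - k)).
Proof.
rewrite CE.
set c := ML * Num.min 1 (enorm (h - k)).
have c0 : 0 <= c by rewrite mulr_ge0// le_min ler01 enorm_ge0.
have mc : measurable_fun setT (fun x : V => `|competitor a x|).
  by apply: mnorm; exact: measurable_competitor.
have E : (\int[mu n]_x (c * `|competitor a x|)%:E = (c * Ncomp)%:E)%E.
  by rewrite (ge0_integral_EFinZl (mu n) c0 mc)// NcompE EFinM.
rewrite -mulrA -/c mulrC (_ : c * Ncomp = fine (\int[mu n]_x (c * `|competitor a x|)%:E)); last by rewrite E.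
apply: le_Rintegral_fine; last by rewrite E ltry.
- have := integrableB measurableT (integrable_corr a01 mphi phi1 h) (integrable_corr a01 mphi phi1 k).
  by apply: eq_integrable => // x _ /=; rewrite -EFinB -mulrBr.
- move=> x; rewrite normrM mulrC ler_wpM2r//.
  have := phi_diff_bound phi1 phiL (x + k) (h - k).
  by rewrite addrACA subrr addr0.
Qed.


Let mC : measurable_fun setT C.
Proof.
apply: (lip_measurable (c := Ncomp * ML)); first by rewrite mulr_ge0.
move=> h k; apply: (le_trans (C_bound h k)).
by rewrite ler_wpM2l ?mulr_ge0// ge_min lexx orbT.
Qed.

Let C_mod (h k : V) : h ord0 ord0 = k ord0 ord0 ->
  `|C h - C k| <= Mod * Num.min 1 (enorm (h - k)).
Proof. by move=> hk; apply: (corr_modulus a01 mphi phi1). Qed.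

Let VV i h := ker a i h * (C h - C (flip i h)).

Let mflip (i : 'I_n) : measurable_fun setT (@flip R n i).
Proof. by case: (measure_preserving_flip R i). Qed.

Let mVV i : measurable_fun setT (VV i).
Proof.
apply: measurable_funM; first exact: measurable_ker.
by apply: measurable_funB; [exact: mC|exact: (measurableT_comp mC (mflip i))].
Qed.

Let W_int i : (mu n).-integrable setT (EFin \o W i).
Proof.
apply: (Rintegral_kapn_le (c := Ncomp * ML) _ _ _).1; first by rewrite mulr_ge0.
  apply: measurable_funM; first exact: measurable_ker.
  by apply: measurable_funB; [exact: mC|exact: measurable_cst].
by move=> h; apply: norm_kerM; have := C_bound h 0; rewrite subr0.
Qed.

Let W_VV i : 2 * \int[mu n]_h W i h = \int[mu n]_h VV i h.
Proof.
have mp := measure_preserving_flip R i.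
have Wf : (mu n).-integrable setT (EFin \o (fun h => W i (flip i h))).
  exact: (integrable_preserving mp (W_int i)).
rewrite mulrDl mul1r -{2}(Rintegral_preserving mp (W_int i)) -RintegralD//.
apply: eq_Rintegral => h _; rewrite /W /VV ker_flip mulNr -mulrBr.
by rewrite opprB addrA subrK.
Qed.

Let enorm_flipB (i : 'I_n) (h : V) : enorm (h - flip i h) <= 2 * enorm h.
Proof.
apply: (le_trans (enorm_le_sum _)); rewrite (bigD1 i)//= big1 ?addr0.
  have -> : (h - flip i h) ord0 i = 2 * h ord0 i by rewrite !mxE eqxx opprK; lra.
  rewrite normrM ger0_norm//.
  by rewrite ler_wpM2l// coord_le_enorm.
by move=> j ji; rewrite !mxE (negbTE ji) subrr normr0.
Qed.

Let min_double (e : R) : 0 <= e -> Num.min 1 (2 * e) <= 2 * Num.min 1 e.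
Proof. by move=> e0; case: (leP 1 e) => h; rewrite ge_min; apply/orP; [left|right]; lra. Qed.

Let min_flip (i : 'I_n) (h : V) :
  Num.min 1 (enorm (h - flip i h)) <= 2 * Num.min 1 (enorm h).
Proof.
apply: le_trans (min_double (enorm_ge0 _)).
by rewrite le_min !ge_min lexx/= enorm_flipB orbT.
Qed.

(** Reversing a transverse coordinate keeps the first one, so [C_mod] applies directly to the
    symmetrised integrand. *)
Lemma pairing_transverse_le i : i != ord0 -> `|\int[mu n]_h W i h| <= Mod * Kapn.
Proof.
move=> i0.
suff : `|2 * \int[mu n]_h W i h| <= 2 * (Mod * Kapn).
  by rewrite normrM ger0_norm// ler_pM2l.
rewrite W_VV [leRHS]mulrA; apply: (Rintegral_kapn_le _ (mVV i) _).2; first by rewrite mulr_ge0.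
move=> h; apply: norm_kerM; apply: (le_trans (C_mod _)).
  by rewrite flipE eq_sym (negbTE i0).
by rewrite [2 * Mod]mulrC -[leRHS]mulrA ler_wpM2l// min_flip.
Qed.

Let c (t : R) : R := C (consrV (t, 0)).

Let mc : measurable_fun [set: R1] c.
Proof.
apply: (measurableT_comp mC); apply: (measurableT_comp (@measurable_consrV R m)).
exact: measurable_pair2.
Qed.

Let D (t : R) := c t - c (- t).

Let mD : measurable_fun [set: R1] D.
Proof.
by apply: measurable_funB; [exact: mc|apply: (measurableT_comp mc); exact: oppr_measurable].
Qed.

Let D_bound t : `|D t| <= 2 * (Ncomp * ML) * Num.min 1 `|t|.
Proof.
have enc s : enorm (consrV (s, 0) - 0 : V) = `|s|.
  rewrite subr0 /enorm dotrV_consrV [dotrV 0 0](_ : _ = 0) ?addr0 ?sqrtr_sqr//.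
  by rewrite /dotrV big1// => i _; rewrite mxE mul0r.
have := C_bound (consrV (t, 0)) 0; have := C_bound (consrV (- t, 0)) 0.
rewrite !enc normrN => b1 b2.
rewrite (_ : D t = (c t - C 0) - (c (- t) - C 0)); last by rewrite /D opprB addrA subrK.
by apply: (le_trans (ler_normB _ _)); rewrite /c; lra.
Qed.

Let kD_int : mu1.-integrable setT (EFin \o (fun t => kfun a t * D t)).
Proof.
apply: (integrable_le (mu := mu1) (g := fun t => 2 * (Ncomp * ML) * kap a t)).
- by apply: measurable_funM => //; exact: measurable_kfun.
- by move=> t; apply: norm_kfunM.
- apply: (ge0_integral_EFinZl_lty (mu := mu1)); [by rewrite !mulr_ge0|
    exact: measurable_kap|exact: kap_ge0|exact: integral_kap].
Qed.

Let Psi := slice_mean phi.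
Let vol := eta_vol R m.

Let gP_int t : mu1.-integrable setT (EFin \o (fun x => gfun a x * Psi (x + t))).
Proof.
have mP : measurable_fun [set: R1] Psi := lipschitz_measurable (slice_mean_lip mphi phi1 phiL).
apply: (integrable_le (mu := mu1) (g := fun x => vol * `|gfun a x|)).
- apply: measurable_funM; first exact: measurable_gfun.
  by apply: (measurableT_comp mP); case: (measure_preserving_shift t).
- by move=> x; rewrite normrM mulrC ler_wpM2r//; exact: (slice_mean_bound mphi phi1).
- apply: (ge0_integral_EFinZl_lty (mu := mu1)) => //; [exact: eta_vol_ge0| |exact: integral_gfun].
  by apply: mnorm; exact: measurable_gfun.
Qed.

Let D_slice t : D t = \int[mu1]_x (gfun a x * (Psi (x + t) - Psi (x - t))).
Proof.
rewrite /D /c /C !(corr_consrV0 a01 mphi phi1) -RintegralB//.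
by apply: eq_Rintegral => x _; rewrite mulrBr.
Qed.

Let kD_bound : `|\int[mu1]_t (kfun a t * D t)| <=
  2 * vol * fine (\int[mu1]_z (frullani_bound a z)%:E).
Proof.
have := one_dim_variation a01 (slice_mean_bound mphi phi1) (slice_mean_lip mphi phi1 phiL).
congr (`|_| <= _); apply: eq_Rintegral => t _.
rewrite RintegralZl ?D_slice//.
have := integrableB measurableT (gP_int t) (gP_int (- t)).
by apply: eq_integrable => // x _ /=; rewrite -EFinB mulrBr.
Qed.

(** Replacing [h] and its reflection by their projections to the first axis changes transverse
    coordinates only, so [C_mod] bounds the error without [L]. The remaining term [V0] sees the
    transverse variables through the kernel alone; integrating them out leaves [Cs] times the
    integral bounded by [one_dim_variation]. *)
Lemma pairing_normal_le Cs :  0 <= Cs ->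
  (forall t, (mu m).-integrable setT (fun h => (ker a ord0 (consrV (t, h)))%:E) /\
     \int[mu m]_h ker a ord0 (consrV (t, h)) = Cs * kfun a t) ->
  `|\int[mu n]_h W ord0 h| <=
    Mod * Kapn + Cs * vol * fine (\int[mu1]_z (frullani_bound a z)%:E).
Proof.
move=> Cs0 HCs.
pose V0 (h : V) := ker a ord0 h * D (h ord0 ord0).
have mV0 : measurable_fun setT V0.
  apply: measurable_funM; first exact: measurable_ker.
  exact: (measurableT_comp mD (@measurable_coord_rV R n ord0)).
have [Ei Ele] : (mu n).-integrable setT (EFin \o (fun h => VV ord0 h - V0 h)) /\
    `|\int[mu n]_h (VV ord0 h - V0 h)| <= 2 * Mod * Kapn.
  apply: Rintegral_kapn_le; [by rewrite mulr_ge0|exact: measurable_funB|].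
  move=> h; rewrite /VV /V0 -mulrBr; apply: norm_kerM.
  set p := consrV (h ord0 ord0, 0) : V; set q := consrV (- h ord0 ord0, 0) : V.
  have -> : C h - C (flip ord0 h) - D (h ord0 ord0) =
      (C h - C p) - (C (flip ord0 h) - C q) by rewrite /D /c -/p -/q; lra.
  apply: (le_trans (ler_normB _ _)); rewrite -mulrA mulrDl mul1r.
  have enp (x : V) s : x ord0 ord0 = s -> enorm (x - consrV (s, 0)) <= enorm x.
    move=> xs; rewrite -[in leRHS](consrV_eta x) -[in leLHS](consrV_eta (x - _)).
    rewrite tailVB tailV_consrV subr0 /enorm !dotrV_consrV.
    rewrite ler_sqrt ?addr_ge0 ?sqr_ge0 ?dotrV_ge0// lerD2r.
    by rewrite mxE [X in _ + X]mxE consrV0 xs subrr expr0n sqr_ge0.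
  have mono (x : V) s : x ord0 ord0 = s ->
      Num.min 1 (enorm (x - consrV (s, 0))) <= Num.min 1 (enorm x).
    by move=> xs; rewrite le_min !ge_min lexx/= enp ?orbT.
  apply: lerD.
    apply: (le_trans (C_mod _)); first by rewrite consrV0.
    by rewrite ler_wpM2l// mono.
  apply: (le_trans (C_mod _)); first by rewrite consrV0 flipE eqxx.
  by rewrite ler_wpM2l// -(enorm_flip ord0 h) mono// flipE eqxx.
have Vi : (mu n).-integrable setT (EFin \o VV ord0).
  apply: (Rintegral_kapn_le (c := 2 * (Ncomp * ML)) _ (mVV _) _).1; first by rewrite !mulr_ge0.
  move=> h; apply: norm_kerM; apply: (le_trans (C_bound _ _)).
  by rewrite [2 * _]mulrC -[leRHS]mulrA ler_wpM2l ?mulr_ge0// min_flip.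
have V0i : (mu n).-integrable setT (EFin \o V0).
  have := integrableB measurableT Vi Ei.
  by apply: eq_integrable => // x _ /=; rewrite -EFinB opprB addrC subrK.
have V0E : \int[mu n]_h V0 h = Cs * \int[mu1]_t (kfun a t * D t).
  rewrite -RintegralZl// /Rintegral (integral_consrV V0i); congr fine.
  apply: eq_integral => t _; have [ki kE] := HCs t.
  under eq_integral do rewrite /= /V0 consrV0 mulrC EFinM.
  rewrite integralZl// -[(\int[mu m]_y _)%E]fineK ?integrable_fin_num//.
  by rewrite -EFinM; congr EFin; rewrite (kE : fine _ = _) mulrC -mulrA.
suff : `|2 * \int[mu n]_h W ord0 h| <=
    2 * (Mod * Kapn + Cs * vol * fine (\int[mu1]_z (frullani_bound a z)%:E)).
  by rewrite normrM ger0_norm// ler_pM2l.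
rewrite W_VV.
have -> : \int[mu n]_h VV ord0 h = \int[mu n]_h (VV ord0 h - V0 h) + \int[mu n]_h V0 h.
  by rewrite -RintegralD//; apply: eq_Rintegral => h _; rewrite subrK.
apply: (le_trans (ler_normD _ _)); rewrite mulrDr mulrA lerD//.
rewrite V0E normrM ger0_norm// (_ : 2 * _ = Cs * (2 * vol * fine (\int[mu1]_z (frullani_bound a z)%:E))).
  by rewrite ler_wpM2l.
by set X := fine _; lra.
Qed.

End scalar.

(** That [B] is fixed before [phi] and [L] is what makes the supremum defining the variation
    finite. *)
Lemma pairing_bounded : exists2 B, 0 <= B & forall (phi : V -> R) L,
  measurable_fun setT phi -> (forall x, `|phi x| <= 1) ->
  (forall x h, `|phi (x + h) - phi x| <= L * enorm h) ->
  forall i, `|\int[mu n]_x (competitor a x * \int[mu n]_h (ker a i h * (phi (x + h) - phi x)))| <= B.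
Proof.
have [Cs Cs0 HCs] := integral_ker_slice m a01.
set X := Cs * eta_vol R m * fine (\int[mu1]_z (frullani_bound a z)%:E).
have X0 : 0 <= X.
  rewrite !mulr_ge0 ?eta_vol_ge0// fine_ge0// integral_ge0// => z _.
  by rewrite lee_fin frullani_bound_ge0.
exists (Mod * Kapn + X); first by rewrite addr_ge0// mulr_ge0.
move=> phi L mphi phi1 phiL i; rewrite (frac_pairing_corr mphi phi1 phiL).
have [->|i0] := eqVneq i ord0; first exact: (pairing_normal_le mphi phi1 phiL Cs0 HCs).
by apply: (le_trans (pairing_transverse_le mphi phi1 phiL i0)); rewrite lerDl.
Qed.

End upper_bound.

Section competitor_BV.
Context (R : realType) (m : nat) (a : R).
Hypothesis a01 : 0 < a < 1.
Notation mu n := (lebesgue_rV R n).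
Notation n := m.+1.
Notation V := 'rV[R]_n.

Lemma test_field_regular (phi : V -> V) : unit_test_field phi ->
  [/\ forall i, measurable_fun setT (fun x => phi x ord0 i),
      forall i x, `|phi x ord0 i| <= 1 &
      exists L, forall i x h, `|phi (x + h) ord0 i - phi x ord0 i| <= L * enorm h].
Proof.
move=> tphi; have [sphi cphi _] := tphi; split.
- by move=> i; apply: smooth_measurable; exact: (sphi 0%N).
- by move=> i x; exact: unit_test_field_le1.
- by have [L _ HL] := smooth_lipschitz sphi cphi; exists L.
Qed.

Definition frac_integrand (phi : V -> V) (x h : V) : R :=
  \sum_i ker a i h * (phi (x + h) ord0 i - phi x ord0 i).

Lemma frac_integrandE (phi : V -> V) (x y : V) :
  dotrV (y - x) (phi y - phi x) / enorm (y - x) `^ (n%:R + a + 1) =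
  frac_integrand phi x (y - x).
Proof.
rewrite /dotrV mulr_suml; apply: eq_bigr => i _.
by rewrite /ker [x + _]addrC subrK !mxE mulrAC powRN.
Qed.

Lemma integrable_frac_integrand_sum (phi : V -> V) x : unit_test_field phi ->
  (mu n).-integrable setT (EFin \o frac_integrand phi x).
Proof.
move=> /test_field_regular[mphi phi1 [L phiL]].
have := integrable_sum measurableT (index_enum 'I_n) (P := xpredT)
  (fun i _ => integrable_frac_integrand a01 (mphi i) (phi1 i) (phiL i) i x).
by apply: eq_integrable => // h _ /=; rewrite sumEFin.
Qed.

Lemma frac_div_shift (phi : V -> V) x : unit_test_field phi ->
  frac_div a phi x = frac_const n a * \int[mu n]_h frac_integrand phi x h.
Proof.
move=> tphi; rewrite /frac_div; congr (_ * _).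
rewrite -(Rintegral_preserving (measure_preserving_shift_rV (- x)) (integrable_frac_integrand_sum x tphi)).
by apply: eq_Rintegral => y _; exact: frac_integrandE.
Qed.

Lemma frac_divE (phi : V -> V) x : unit_test_field phi ->
  frac_div a phi x = frac_const n a *
    \sum_i \int[mu n]_h (ker a i h * (phi (x + h) ord0 i - phi x ord0 i)).
Proof.
move=> tphi; rewrite frac_div_shift//; congr (_ * _).
have [mphi phi1 [L phiL]] := test_field_regular tphi.
have fi i := integrable_frac_integrand a01 (mphi i) (phi1 i) (phiL i) i x.
rewrite /Rintegral; under eq_integral do rewrite /frac_integrand -sumEFin.
rewrite integral_sum//.
rewrite (_ : (\sum_(k <- _ | _) _)%E = (\sum_i (\int[mu n]_h (ker a i h * (phi (x + h) ord0 i - phi x ord0 i)))%:E)%E).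
  by rewrite sumEFin.
by apply: eq_bigr => i _; rewrite /Rintegral fineK// integrable_fin_num//; exact: fi.
Qed.

Lemma competitor_BV : frac_BV a (competitor a : V -> R).
Proof.
split; first exact: integrable_competitor.
have [B B0 HB] := pairing_bounded m a01.
apply: (@le_lt_trans _ _ (\sum_(i < n) (`|frac_const n a| * B)%:E)%E); last first.
  by rewrite sumEFin ltry.
apply: ge_ereal_sup => _ [phi tphi <-].
have [mphi phi1 [L phiL]] := test_field_regular tphi.
pose p i x := competitor a x * \int[mu n]_h (ker a i h * (phi (x + h) ord0 i - phi x ord0 i)).
have pint i : (mu n).-integrable setT (EFin \o p i).
  exact: (integrable_pairing a01 (mphi i) (phi1 i) (phiL i) i).
under eq_integral => x _.
  rewrite frac_divE// mulrCA mulr_sumr mulr_sumr -sumEFin.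
  over.
rewrite /= integral_sum//; last first.
  by move=> i; have := integrableZl measurableT (frac_const n a) (pint i); apply: eq_integrable.
apply: lee_sum => i _; under eq_integral do rewrite EFinM.
rewrite integralZl//; last exact: pint.
rewrite -[(\int[mu n]_x _)%E]fineK ?integrable_fin_num//; last exact: pint.
rewrite -EFinM lee_fin (le_trans (ler_norm _))// normrM ler_wpM2l//.
exact: (HB _ L (mphi i) (phi1 i) (phiL i) i).
Qed.

End competitor_BV.

(** * Positivity of the normalising constant *)

Section Gamma_positive.
Context (R : realType).
Notation mu := (@lebesgue_measure R).

(** [Gamma] is the [fine] of an extended integral, and [fine] sends infinity to 0; positivity
    therefore needs convergence of the integral as well as a lower bound. *)
Lemma Gamma_gt0 (s : R) : 0 < s -> 0 < Gamma s.
Proof.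
move=> s0; pose F (t : R) := t `^ (s - 1) * expR (- t).
have F0 t : 0 <= F t by rewrite mulr_ge0 ?powR_ge0 ?expR_ge0.
have Foo : (\int[mu]_(t in `]0%R, +oo[) (F t)%:E < +oo)%E.
  (* For x >= 1, x^(s+1) <= x^(k+1) <= (k+1)! exp x, which leaves (k+1)! x^(-2) as majorant of the
     integrand. *)
  set k := Num.truncn (s + 1).
  have sk : s + 1 < k.+1%:R by exact: truncnS_gt.
  apply: (@ge0_integral_half_lty _ F k.+1`!%:R (1 - s) 2) => //; first lra.
  - by rewrite ltr1n.
  - move=> x /andP[x0 x1]; rewrite /F opprB.
    apply: (@le_trans _ _ (x `^ (s - 1) * 1)).
      by rewrite ler_wpM2l ?powR_ge0// -expR0 ler_expR; lra.
    by rewrite mulrC ler_wpM2r ?powR_ge0// ler1n fact_gt0.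
  - move=> x x1; have x0 : 0 < x by exact: lt_le_trans x1.
    rewrite /F expRN ler_pdivrMr ?expR_gt0//.
    have E : x ^+ k.+1 <= k.+1`!%:R * expR x.
      have := expR_ge1Dxn k (ltW x0); rewrite -ler_pdivrMl ?ltr0n ?fact_gt0//.
      by move=> /(le_trans _); apply; rewrite mulrC lerDr.
    have P : x `^ (s + 1) <= x ^+ k.+1.
      by rewrite -powR_mulrn ?(ltW x0)// ler_powR// ltW.
    rewrite mulrAC; apply: (@le_trans _ _ (x ^+ k.+1 * x `^ (- 2))); last first.
      by rewrite ler_wpM2r ?powR_ge0.
    apply: (@le_trans _ _ (x `^ (s + 1) * x `^ (- 2))); last by rewrite ler_wpM2r ?powR_ge0.
    rewrite -powRD ?(gt_eqF x0) ?implybT//.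
    by rewrite (_ : s + 1 + - 2 = s - 1)//; lra.
rewrite /Gamma /Rintegral fine_gt0// Foo andbT.
(* A lower bound for the integrand on [1, 2]: there t^(s-1) >= 1/t >= 1/2 and exp(-t) >= exp(-2). *)
pose c : R := 2^-1 * expR (- 2).
have c0 : 0 < c by rewrite mulr_gt0 ?invr_gt0 ?expR_gt0.
apply: (@lt_le_trans _ _ (\int[mu]_t (c * \1_(`[1, 2]%classic : set R) t)%:E)%E).
  rewrite (ge0_integral_EFinZl mu (ltW c0))//.
  rewrite integral_indic// setIT.
  rewrite [X in (_ < _ * X)%E](@lebesgue_measure_itv R `[1, 2]) /= lte_fin ltr1n -EFinD -EFinM lte_fin.
  by rewrite mulr_gt0//; lra.
rewrite [leRHS]integral_mkcond; apply: ge0_le_integral_nomeas => t _.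
  by rewrite lee_fin mulr_ge0// ltW.
rewrite /patch indicE; case: (boolP (t \in `[1, 2]%classic)) => [|_]; last first.
  by rewrite mulr0; case: ifP => // _; rewrite lee_fin F0.
rewrite inE/= in_itv/= => /andP[t1 t2].
rewrite ifT; last by rewrite inE/= in_itv/= andbT (lt_le_trans _ t1).
have t0 : 0 < t by exact: lt_le_trans t1.
rewrite mulr1 lee_fin /c ler_pM ?expR_ge0 ?invr_ge0//.
  apply: (@le_trans _ _ (t `^ (- 1))); last by rewrite ler_powR//; lra.
  by rewrite powR_inv1 ?(ltW t0)// lef_pV2 ?posrE.
by rewrite ler_expR lerN2.
Qed.

Lemma frac_const_gt0 n (a : R) : 0 < a < 1 -> 0 < frac_const n a.
Proof.
move=> /andP[a0 a1]; rewrite /frac_const divr_gt0 ?mulr_gt0 ?powR_gt0 ?pi_gt0//.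
- by apply: Gamma_gt0; rewrite divr_gt0// ltr_pwDr// addr_ge0// ltW.
- by apply: Gamma_gt0; rewrite divr_gt0// subr_gt0.
Qed.

End Gamma_positive.

(** * Smooth test fields *)

Section flat_functions.
Context (R : realType).

(* The class of functions [P(1/u) exp(-1/u)], extended by [0] to [u <= 0], is
   stable under differentiation, so all its members are smooth. *)
Definition flat (P : {poly R}) (u : R) : R :=
  if 0 < u then P.[u^-1] * expR (- u^-1) else 0.

(** The exponential beats every power: with y = 1/u >= 1 and N the size of [P], |P(y)| is at most a
    multiple of y^N, and y^(N+2) <= (N+2)! exp y. The two spare powers of [y] give the square, which
    forces the derivative at 0 to vanish. *)
Lemma flat_le_sqr P : exists2 C, 0 <= C & forall u, u <= 1 -> `|flat P u| <= C * u ^+ 2.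
Proof.
pose A := \sum_(i < size P) `|P`_i|.
have A0 : 0 <= A by apply: sumr_ge0.
set N := size P.
exists (A * (N.+2)`!%:R); first by rewrite mulr_ge0.
move=> u u1; rewrite /flat; case: ifPn => [u0|_]; last first.
  by rewrite normr0 mulr_ge0 ?sqr_ge0// mulr_ge0.
set y := u^-1.
have y0 : 0 < y by rewrite invr_gt0.
have y1 : 1 <= y by rewrite -invr1 lef_pV2 ?posrE.
have PA : `|P.[y]| <= A * y ^+ N.
  rewrite horner_coef mulr_suml (le_trans (ler_norm_sum _ _ _))//.
  apply: ler_sum => i _; rewrite normrM ler_wpM2l// normrX ger0_norm ?(ltW y0)//.
  by rewrite ler_weXn2l// ltnW.
have E : y ^+ N.+2 <= N.+2`!%:R * expR y.
  have := expR_ge1Dxn N.+1 (ltW y0); rewrite -ler_pdivrMl ?ltr0n ?fact_gt0//.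
  by move=> /(le_trans _); apply; rewrite mulrC lerDr.
rewrite normrM (ger0_norm (expR_ge0 _)) expRN ler_pdivrMr ?expR_gt0//.
apply: (le_trans PA); rewrite -(mulrA A) -(mulrA A) ler_wpM2l//.
have -> : y ^+ N = u ^+ 2 * y ^+ N.+2.
  have -> : y ^+ N.+2 = y ^+ N * y ^+ 2 by rewrite -exprD addn2.
  by rewrite mulrCA -exprMn divff ?gt_eqF// expr1n mulr1.
by rewrite [_%:R * _]mulrC -(mulrA (u ^+ 2)) ler_wpM2l// sqr_ge0.
Qed.

(** Differentiating P(1/u) exp(-1/u) gives u^(-2) (P - P')(1/u) exp(-1/u), again in the class. At
    the junction [u = 0] the quadratic bound takes over. *)
Lemma is_derive_flat P (u : R) :
  is_derive u (1 : R) (flat P) (flat ('X^2 * (P - P^`())) u).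
Proof.
have [u0|u0|u0] := ltgtP u 0.
- rewrite {2}/flat ltNge (ltW u0)/=.
  apply: (@near_eq_is_derive R R R (cst 0)).
  near=> v; rewrite /flat ltNge ltW//=; near: v; exact: lt_nbhsl.
- rewrite {2}/flat u0.
  apply: (@near_eq_is_derive R R R (fun v : R => P.[v^-1] * expR (- v^-1))).
    by near=> v; rewrite /flat ifT//; near: v; exact: lt_nbhsr.
  have dV : is_derive u (1 : R) (@GRing.inv R) (- (u ^- 2)).
    apply: DeriveDef; first exact/diff_derivable/differentiable_Rinv/lt0r_neq0.
    rewrite deriveE ?diff_Rinv ?lt0r_neq0//; last exact/differentiable_Rinv/lt0r_neq0.
    by rewrite /= [LHS]mulr1.
  have dP := is_derive1_comp (is_derive_poly P u^-1) dV.
  have dE := @is_derive1_comp _ expR (- (@GRing.inv R)) u _ _ (is_derive_expR _) (is_deriveN dV).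
  rewrite (_ : (fun v : R => _) = (horner P \o @GRing.inv R) * (expR \o - (@GRing.inv R)))//.
  apply: (is_derive_eq (is_deriveM dP dE)).
  rewrite /= !hornerE exprVn /GRing.scale/= opprK -[(- GRing.inv) u]/(- u^-1).
  set A := P.[_]; set B := _.[u^-1]; set e := expR _; set w := (u ^+ 2)^-1.
  lra.
- rewrite {2}/flat u0 ltxx.
  have [C C0 HC] := flat_le_sqr P.
  have f0 : flat P 0 = 0 by rewrite /flat ltxx.
  have cv : (h^-1 *: (flat P (h *: (1 : R) + 0) - flat P 0)) @[h --> (0 : R)^'] --> (0 : R).
    apply: (@cvgrPdist_le _ _ _ (0^') _ _ _).2 => e e0.
    have eC0 : 0 < e / (C + 1) by rewrite divr_gt0// ltr_wpDl.
    near=> h.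
    rewrite f0 addr0 subr0 sub0r normrN normrZ [h%:A]mulr1.
    have h1 : `|h| <= 1.
      by near: h; apply: dnbhs0_le.
    have he : `|h| <= e / (C + 1).
      by near: h; apply: dnbhs0_le; exact: eC0.
    have hn : h != 0 by near: h; exact: nbhs_dnbhs_neq.
    have hp : 0 < `|h| by rewrite normr_gt0.
    rewrite normfV ler_pdivrMl//.
    have := HC h; rewrite (le_trans (ler_norm _) h1) => /(_ isT) /le_trans; apply.
    rewrite -real_normK ?num_real// expr2 mulrA mulrC ler_wpM2l//.
    apply: (@le_trans _ _ (C * (e / (C + 1)))); first by rewrite ler_wpM2l.
    rewrite mulrA ler_pdivrMr ?ltr_pwDr// mulrC ler_wpM2l ?(ltW e0)// lerDl//.
  apply: DeriveDef; first by apply/cvg_ex; eexists; exact: cv.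
  exact/cvg_lim/cv.
Unshelve. all: by end_near. Qed.

End flat_functions.

(** * Closure properties of the classes [Ck] *)

Section Ck_closure.
Context (R : realType) (V : normedModType R).

Lemma Ck_pred (W : normedModType R) k (f : V -> W) : Ck k.+1 f -> Ck k f.
Proof.
elim: k f => [|k IHk] f [df Df]; first by move=> x; exact: differentiable_continuous.
by split=> // v; exact/IHk/Df.
Qed.

Lemma Ck_cst (W : normedModType R) k (c : W) : Ck k (cst c : V -> W).
Proof.
elim: k c => [|k IHk] c; first by move=> x; exact: cvg_cst.
split=> [x|v]; first exact: differentiable_cst.
by rewrite (_ : (fun x => _) = cst 0)//; apply/funext => x; rewrite derive_cst.
Qed.

Lemma CkD (W : normedModType R) k (f g : V -> W) :
  Ck k f -> Ck k g -> Ck k (fun x => f x + g x).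
Proof.
elim: k f g => [|k IHk] f g; first by move=> cf cg x; apply: cvgD; [exact: cf|exact: cg].
move=> [df Df] [dg Dg]; split=> [x|v]; first exact: differentiableD.
rewrite (_ : (fun x => _) = (fun x => 'D_v f x + 'D_v g x)); first by apply: IHk; [exact: Df|exact: Dg].
by apply/funext => x; rewrite deriveD//; exact: diff_derivable.
Qed.

Lemma CkM k (f g : V -> R) : Ck k f -> Ck k g -> Ck k (fun x => f x * g x).
Proof.
elim: k f g => [|k IHk] f g; first by move=> cf cg x; apply: cvgM; [exact: cf|exact: cg].
move=> cf cg; have [df Df] := cf; have [dg Dg] := cg; split=> [x|v]; first exact: differentiableM.
rewrite (_ : (fun x => _) = (fun x => f x * 'D_v g x + g x * 'D_v f x)).
  by apply: CkD; apply: IHk; [exact: Ck_pred|exact: Dg|exact: Ck_pred|exact: Df].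
by apply/funext => x; rewrite (deriveM (diff_derivable _) (diff_derivable _)).
Qed.

Lemma Ck_prod (I : Type) (s : seq I) k (f : I -> V -> R) :
  (forall i, Ck k (f i)) -> Ck k (fun x => \prod_(i <- s) f i x).
Proof.
move=> cf; elim: s => [|i s IHs].
  by rewrite (_ : (fun x => _) = cst 1); [exact: Ck_cst|apply/funext => x; rewrite big_nil].
rewrite (_ : (fun x => _) = (fun x => f i x * \prod_(j <- s) f j x)); first exact: CkM.
by apply/funext => x; rewrite big_cons.
Qed.

Lemma Ck_scalel (W : normedModType R) k (f : V -> R) (w : W) :
  Ck k f -> Ck k (fun x => f x *: w).
Proof.
elim: k f => [|k IHk] f; first by move=> cf x; apply: cvgZr_tmp; exact: (cf x).
move=> [df Df]; split=> [x|v]; first exact: differentiableZl.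
rewrite (_ : (fun x => _) = (fun x => 'D_v f x *: w)); first by apply: IHk; exact: Df.
apply/funext => x.
by rewrite deriveE ?diffZl ?deriveE//; exact: differentiableZl.
Qed.

End Ck_closure.

Section smooth_cutoff.
Context (R : realType) (n : nat).

(** The induction on [k] is over all polynomials at once, since a derivative changes [P]. *)
Lemma Ck_flat k P (c d : R) i : Ck k (fun x : 'rV[R]_n => flat P (c * x ord0 i + d)).
Proof.
have dP (Q : {poly R}) u : differentiable (flat Q) u.
  by apply/derivable1_diffP; case: (is_derive_flat Q u).
pose l (x : 'rV[R]_n) : R := c * x ord0 i + d.
have dl x : differentiable l x.
  apply: differentiableD => //; apply: differentiableM => //; exact: differentiable_coord.
have dPl (Q : {poly R}) x : differentiable (flat Q \o l) x by exact: differentiable_comp.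
elim: k P => [|k IHk] P; first by move=> x; apply: differentiable_continuous; exact: dPl.
split=> [x|v]; first exact: dPl.
rewrite (_ : (fun x => 'D_v _ x) = (fun x => (c * v ord0 i) * flat ('X^2 * (P - P^`())) (l x))).
  by apply: CkM; [exact: (@Ck_cst _ _ _ k (c * v ord0 i))|exact: IHk].
apply/funext => x; transitivity ('D_(c * v ord0 i) (flat P) (l x)).
  apply: (congr1 (fun F : R -> R => lim (F @ (0 : R)^'))); apply/funext => h /=.
  by rewrite /l !mxE mulrDr mulrCA addrA.
rewrite deriveE// -[X in 'd _ _ X]mulr1 linearZ/= -deriveE//.
by have [_ ->] := is_derive_flat P (l x).
Qed.

End smooth_cutoff.

Section box_bump.
Context (R : realType).
Notation mu n := (lebesgue_rV R n).
Notation q := (@flat R 1).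

Lemma flat1_ge0 u : 0 <= q u.
Proof. by rewrite /flat; case: ifP => // _; rewrite hornerC mul1r expR_ge0. Qed.

Lemma flat1_le1 u : q u <= 1.
Proof.
rewrite /flat; case: ifP => // u0; rewrite hornerC mul1r -expR0 ler_expR oppr_le0.
by rewrite invr_ge0 ltW.
Qed.

Lemma flat1_eq0 u : u <= 0 -> q u = 0.
Proof. by rewrite /flat ltNge => ->. Qed.

Lemma flat1_ge u : 1 <= u -> expR (- 1) <= q u.
Proof.
move=> u1; have u0 : 0 < u by exact: lt_le_trans u1.
by rewrite /flat u0 hornerC mul1r ler_expR lerN2 -invr1 lef_pV2 ?posrE.
Qed.

Section bump.
Context (n : nat) (l u w : 'I_n -> R).
Hypothesis w0 : forall i, 0 < w i.

Definition bump (x : 'rV[R]_n) : R :=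
  \prod_i (q ((x ord0 i - l i) / w i) * q ((u i - x ord0 i) / w i)).

Lemma bump_ge0 x : 0 <= bump x.
Proof. by apply: prodr_ge0 => i _; rewrite mulr_ge0// flat1_ge0. Qed.

Lemma bump_le1 x : bump x <= 1.
Proof.
by apply: prodr_ile1 => i _; rewrite mulr_ge0 ?flat1_ge0// mulr_ile1 ?flat1_ge0 ?flat1_le1.
Qed.

Lemma bump_eq0 (x : 'rV[R]_n) i : x ord0 i <= l i \/ u i <= x ord0 i -> bump x = 0.
Proof.
move=> xi; rewrite /bump (bigD1 i)//=; case: xi => xi.
  by rewrite flat1_eq0 ?mul0r// pmulr_lle0 ?invr_gt0// subr_le0.
by rewrite [X in _ * X * _]flat1_eq0 ?mulr0 ?mul0r// pmulr_lle0 ?invr_gt0// subr_le0.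
Qed.

(** Each coordinate contributes two factors, both at least exp(-1) once their arguments reach 1;
    hence the exponent. *)
Lemma bump_ge (x : 'rV[R]_n) : (forall i, l i + w i <= x ord0 i <= u i - w i) ->
  expR (- 1) ^+ (n * 2) <= bump x.
Proof.
move=> xi; rewrite mulnC exprM -[n in leLHS]card_ord -prodr_const; apply: ler_prod => i _.
rewrite sqr_ge0/= expr2; have /andP[li ui] := xi i.
by rewrite ler_pM ?expR_ge0// flat1_ge// ler_pdivlMr// mul1r; lra.
Qed.

Lemma smooth_bump k : Ck k bump.
Proof.
apply: Ck_prod => i; apply: CkM.
  rewrite (_ : (fun x => _) = (fun x : 'rV[R]_n => q ((w i)^-1 * x ord0 i + - (l i / w i)))).
    exact: Ck_flat.
  by apply/funext => x; rewrite mulrBl [_^-1 * _]mulrC.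
rewrite (_ : (fun x => _ : R) = (fun x : 'rV[R]_n => q (- (w i)^-1 * x ord0 i + u i / w i))).
  exact: Ck_flat.
by apply/funext => x; rewrite mulrBl mulNr [_^-1 * _]mulrC addrC.
Qed.

Lemma unit_test_field_bump (e : 'rV[R]_n) : enorm e = 1 ->
  unit_test_field (fun x => bump x *: e).
Proof.
move=> e1; split.
- by move=> k; exact/Ck_scalel/smooth_bump.
- pose M := \sum_i (`|l i| + `|u i|).
  apply: bounded_closed_compact; last exact: closed_closure.
  have cM : closed [set x : 'rV[R]_n | `|x| <= M].
    apply: (@closed_comp _ _ (fun x : 'rV[R]_n => `|x|) [set z | z <= M]).
      by move=> x _; exact: norm_continuous.
    exact: closed_le.
  have sub : closure [set x | bump x *: e != 0] `<=` [set x : 'rV[R]_n | `|x| <= M].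
    rewrite [X in _ `<=` X]((closure_id _).1 cM); apply: closure_subset => x /= x0.
    have M0 : 0 <= M by apply: sumr_ge0 => i _; rewrite addr_ge0.
    rewrite /Num.norm /= mx_normrE; apply/bigmax_leP; split=> [//|[k i] _] /=.
    rewrite (ord1 k); apply: (@le_trans _ _ (`|l i| + `|u i|)); last first.
      by rewrite /M (bigD1 i)//= lerDl sumr_ge0// => j _; rewrite addr_ge0.
    have /andP[li ui] : l i < x ord0 i < u i.
      rewrite !ltNge -negb_or; apply: contra x0 => /orP h.
      by rewrite (@bump_eq0 _ i) ?scale0r.
    have l1 := ler_norm (- l i); rewrite normrN in l1.
    have u1 := ler_norm (u i).
    have l0 := normr_ge0 (l i); have u0 := normr_ge0 (u i).
    rewrite ler_norml; apply/andP; split; lra.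
  exists M; split; first exact: num_real.
  by move=> N MN x /sub /le_trans; apply; exact: ltW.
- rewrite unlock; case: ifP => // _; apply/ess_supP; apply: nearW => x /=.
  rewrite lee_fin ger0_norm ?enorm_ge0//.
  rewrite /enorm (_ : Num.sqrt _ = bump x * Num.sqrt (dotrV e e)); first by rewrite -/(enorm e) e1 mulr1 bump_le1.
  have -> : dotrV (bump x *: e) (bump x *: e) = bump x ^+ 2 * dotrV e e.
    by rewrite /dotrV mulr_sumr; apply: eq_bigr => i _; rewrite !mxE expr2 mulrACA.
  by rewrite sqrtrM ?sqr_ge0// sqrtr_sqr ger0_norm// bump_ge0.
Qed.

End bump.
End box_bump.

(** * Perimeter of the superlevel sets *)

Section lower_bound.

Lemma lebesgue_measure_segment (R : realType) (u v : R) : u <= v ->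
  @lebesgue_measure R `[u, v]%classic = (v - u)%:E.
Proof.
move=> uv; rewrite [LHS](@lebesgue_measure_itv R `[u, v]) /= lte_fin.
by case: ltP => [_|vu]; [rewrite EFinB|rewrite (_ : v - u = 0)//; lra].
Qed.

Lemma measurable_rV_box (R : realType) n (A : 'I_n -> set (measurableTypeR R)) :
  (forall i, measurable (A i)) ->
  measurable [set x : 'rV[R]_n | forall i, A i (x ord0 i)].
Proof.
move=> mA; rewrite (_ : mkset _ = \bigcap_(i in [set: 'I_n])
    ((fun x : 'rV[R]_n => x ord0 i) @^-1` A i)); last first.
  by apply/seteqP; split=> x /= Ax i; [move=> _|]; exact: Ax.
apply: fin_bigcap_measurable => // i _; rewrite -[X in measurable X]setTI.
exact: measurable_coord_rV.
Qed.

Lemma ge_integral_subset d (T : measurableType d) (R : realType)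
    (mu : {measure set T -> \bar R}) (A D : set T) (c : R) (f : T -> R) :
  measurable A -> A `<=` D -> 0 <= c -> (forall x, D x -> 0 <= f x) ->
  (forall x, A x -> c <= f x) ->
  (c%:E * mu A <= \int[mu]_(x in D) (f x)%:E)%E.
Proof.
move=> mA AD c0 f0 cf; rewrite -integral_cst// integral_mkcond [leRHS]integral_mkcond.
apply: ge0_le_integral_nomeas => x _; rewrite /patch.
  by case: ifP => // _; rewrite lee_fin.
case: ifPn => [/[!inE] Ax|_]; first by rewrite ifT ?inE ?lee_fin; [exact: cf|exact: AD].
by case: ifPn => // /[!inE] Dx; rewrite lee_fin f0.
Qed.

(** A displacement of length at most [s] directed against the sign of [u] cannot leave [-1, 1]. This
    yields, for each transverse coordinate, a full interval of length [s] of admissible shifts. *)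
Lemma small_shift (R : realType) (s u v : R) : 0 < s -> s <= 1 -> `|u| <= 1 ->
  u <= 0 /\ 0 <= v <= s \/ 0 < u /\ - s <= v <= 0 -> `|v| <= s /\ `|u + v| <= 1.
Proof.
move=> s0 s1 u1 H; have {u1} [u1 u2] : - 1 <= u /\ u <= 1.
  by apply/andP; rewrite -ler_norml.
by case: H => -[u0 /andP[v1 v2]]; split; rewrite ler_norml; apply/andP; split; lra.
Qed.

Context (R : realType) (m : nat) (a : R).
Hypothesis a01 : 0 < a < 1.
Notation mu n := (lebesgue_rV R n).
Notation n := m.+1.
Notation V := 'rV[R]_n.

Section at_scale.
Variable s : R.
Hypotheses (s0 : 0 < s) (s1 : s <= 1).

(** With the ramps of width [wd], the plateau of the bump is the box where the first coordinate lies
    in [-2s, -s] and the others in [-1, 1]. *)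
Definition lo (i : 'I_n) : R := if i == ord0 then - 3 * s else - 2.
Definition hi (i : 'I_n) : R := if i == ord0 then 0 else 2.
Definition wd (i : 'I_n) : R := if i == ord0 then s else 1.

Let psi := @bump R n lo hi wd.
Let e0 : V := - delta_mx ord0 ord0.

Definition layer_field (x : V) : V := psi x *: e0.

Lemma wd_gt0 i : 0 < wd i. Proof. by rewrite /wd; case: ifP. Qed.

Lemma unit_test_field_layer : unit_test_field layer_field.
Proof.
apply: unit_test_field_bump => [i|]; first exact: wd_gt0.
rewrite /enorm /dotrV (bigD1 ord0)//= big1 ?addr0; last first.
  by move=> i i0; rewrite !mxE eqxx (negPf i0) oppr0 mul0r.
by rewrite !mxE !eqxx mulrNN mulr1 sqrtr1.
Qed.

Lemma frac_integrand_layer (x h : V) : 0 <= x ord0 ord0 ->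
  frac_integrand a layer_field x h = - ker a ord0 h * psi (x + h).
Proof.
move=> x0; rewrite /frac_integrand (bigD1 ord0)//= big1 ?addr0; last first.
  by move=> i i0; rewrite !mxE eqxx (negPf i0) oppr0 !mulr0 subrr mulr0.
have -> : layer_field x = 0.
  by rewrite /layer_field /psi (@bump_eq0 _ _ _ _ _ wd_gt0 x ord0) ?scale0r//; right.
by rewrite !mxE !eqxx subr0 mulrN1 mulrN mulNr.
Qed.

(** Where the bump is nonzero at [x + h], the first coordinate has become negative, so that of [h]
    is negative and minus the kernel is nonnegative. *)
Lemma frac_integrand_layer_ge0 (x h : V) : 0 <= x ord0 ord0 ->
  0 <= frac_integrand a layer_field x h.
Proof.
move=> x0; rewrite frac_integrand_layer//.
have [h0|h0] := leP 0 (x ord0 ord0 + h ord0 ord0).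
  by rewrite /psi (@bump_eq0 _ _ _ _ _ wd_gt0 _ ord0) ?mulr0//; right; rewrite mxE.
rewrite mulr_ge0 ?bump_ge0// /ker -mulNr mulr_ge0 ?powR_ge0//; lra.
Qed.

Lemma frac_div_layer_ge0 (x : V) : 0 <= x ord0 ord0 -> 0 <= frac_div a layer_field x.
Proof.
move=> x0; rewrite frac_div_shift//; last exact: unit_test_field_layer.
rewrite mulr_ge0 ?(ltW (frac_const_gt0 _ a01))//.
by apply: fine_ge0; apply: integral_ge0 => h _; rewrite lee_fin frac_integrand_layer_ge0.
Qed.

(** The exponential is the lower bound of the bump on its plateau. The number m + 3 bounds |h|/s: at
    most 3 from the first coordinate and 1 from each of the [m] others. *)
Definition layer_const : R :=
  frac_const n a * (expR (- 1) ^+ (n * 2) * (m.+3%:R) `^ (- (n%:R + a + 1))).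

Lemma layer_const_gt0 : 0 < layer_const.
Proof. by rewrite mulr_gt0 ?frac_const_gt0// mulr_gt0 ?powR_gt0// exprn_gt0// expR_gt0. Qed.

(** The integrand is bounded below on a box of shifts of volume s^n. There -h_0 >= s and the kernel
    denominator is of order s^(n+a+1), so the powers combine to s^(n+1-(n+a+1)) = s^(-a). *)
Lemma frac_div_layer_ge (x : V) : 0 < x ord0 ord0 < s ->
  (forall i, `|x ord0 i| <= 1) -> layer_const * s `^ (- a) <= frac_div a layer_field x.
Proof.
move=> /andP[x0 xs] x1; rewrite frac_div_shift//; last exact: unit_test_field_layer.
rewrite /layer_const -(mulrA (frac_const _ _)) ler_wpM2l// ?(ltW (frac_const_gt0 _ _))//.
(* Shifts that carry [x] into the plateau of the bump; the side chosen for a transverse shift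
   depends on the sign of that coordinate of [x]. *)
pose A (i : 'I_n) : set (measurableTypeR R) :=
  if i == ord0 then `[- 2 * s - x ord0 ord0, - s - x ord0 ord0]%classic
  else if x ord0 i <= 0 then `[0, s]%classic else `[- s, 0]%classic.
have mA i : measurable (A i).
  by rewrite /A; case: ifP => _; [|case: ifP => _]; exact: measurable_itv.
pose Y := [set h : V | forall i, A i (h ord0 i)].
have muY : mu n Y = (s ^+ n)%:E.
  rewrite /Y lebesgue_rV_box// (eq_bigr (fun=> s%:E)).
    by rewrite prodEFin prodr_const card_ord.
  by move=> i _; rewrite /A; case: ifP => _; [|case: ifP => _];
    (rewrite lebesgue_measure_segment; [congr EFin; lra|lra]).
have mY : measurable Y by exact: measurable_rV_box.
pose c : R := expR (- 1) ^+ (n * 2) * (s * (m.+3%:R * s) `^ (- (n%:R + a + 1))).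
have ms0 : 0 < m.+3%:R * s by rewrite mulr_gt0.
have c0 : 0 <= c by rewrite mulr_ge0 ?exprn_ge0 ?expR_ge0// mulr_ge0 ?powR_ge0// ltW.
have Fc h : Y h -> c <= frac_integrand a layer_field x h.
  move=> Yh; rewrite frac_integrand_layer ?(ltW x0)//.
  have h0 : - 2 * s - x ord0 ord0 <= h ord0 ord0 <= - s - x ord0 ord0.
    by have := Yh ord0; rewrite /A eqxx /= in_itv.
  have {h0} [h0 h0'] := andP h0.
  have hj i : i != ord0 -> `|h ord0 i| <= s /\ `|x ord0 i + h ord0 i| <= 1.
    move=> i0; apply: small_shift => //.
    have := Yh i; rewrite /A (negPf i0).
    by case: leP => xi; rewrite /= in_itv/=; [left|right].
  have hE : enorm h <= m.+3%:R * s.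
    apply: (le_trans (enorm_le_sum h)); rewrite big_ord_recl.
    apply: (@le_trans _ _ (3 * s + \sum_(i < m) s)).
      apply: lerD; first by rewrite ler_norml; apply/andP; split; lra.
      by apply: ler_sum => i _; have [] := hj (lift ord0 i) isT.
    by rewrite sumr_const card_ord -[s *+ m]mulr_natl -mulrDl -natrD.
  have hp : 0 < enorm h by apply: (enorm_gt0 (i := ord0)); apply/eqP; lra.
  rewrite mulrC; apply: ler_pM; rewrite ?exprn_ge0 ?expR_ge0//.
  - by rewrite mulr_ge0 ?powR_ge0// ltW.
  - apply: bump_ge => [|i]; first exact: wd_gt0.
    rewrite mxE /lo /hi /wd.
    case: ifPn => [/eqP ->|i0]; first by apply/andP; split; lra.
    by have [_] := hj i i0; rewrite ler_norml => /andP[? ?]; apply/andP; split; lra.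
  - rewrite /ker -mulNr ler_pM ?powR_ge0 ?(ltW s0)//; first lra.
    rewrite !powRN lef_pV2 ?posrE ?powR_gt0//.
    apply: ge0_ler_powR => //; rewrite ?nnegrE ?enorm_ge0 ?(ltW ms0)//.
    by rewrite !addr_ge0// ltW//; case/andP: a01.
have H : ((c * s ^+ n)%:E <= \int[mu n]_h (frac_integrand a layer_field x h)%:E)%E.
  rewrite EFinM -muY; apply: ge_integral_subset => // h _.
  exact: frac_integrand_layer_ge0 (ltW x0).
have fin : (\int[mu n]_h (frac_integrand a layer_field x h)%:E)%E \is a fin_num.
  by apply: integrable_fin_num => //; exact/integrable_frac_integrand_sum/unit_test_field_layer.
rewrite /Rintegral -lee_fin fineK//; apply: le_trans H; rewrite lee_fin /c.
rewrite -!(mulrA (expR (-1) ^+ _)) ler_wpM2l ?exprn_ge0 ?expR_ge0//.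
rewrite powRM ?ler0n ?(ltW s0)// mulrCA -!mulrA ler_wpM2l ?powR_ge0//.
rewrite mulrCA -exprS -powR_mulrn ?(ltW s0)// -powRD ?(gt_eqF s0) ?implybT//.
by rewrite (_ : _ + m.+2%:R = - a)// -[m.+2%:R]natr1; lra.
Qed.

(** The layer alone, of volume s 2^m, produces the bound. The rest of [E] contributes nonnegatively
    because it stays on the positive side, whatever its shape. *)
Lemma frac_perimeter_layer (E : set V) : E `<=` [set x | 0 < x ord0 ord0] ->
  [set x : V | 0 < x ord0 ord0 < s /\ `|tailV x| <= 1] `<=` E ->
  ((2 ^+ m * layer_const * s `^ (1 - a))%:E <= frac_perimeter a E)%E.
Proof.
move=> E0 sE; apply: (@le_trans _ _ (\int[mu n]_(x in E) (frac_div a layer_field x)%:E)%E); last first.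
  by apply: ereal_sup_ubound; exists layer_field => //; exact: unit_test_field_layer.
pose A (i : 'I_n) : set (measurableTypeR R) :=
  if i == ord0 then `]0, s[%classic else `[-1, 1]%classic.
have mA i : measurable (A i) by rewrite /A; case: ifP => _; exact: measurable_itv.
pose Y := [set h : V | forall i, A i (h ord0 i)].
have mY : measurable Y by exact: measurable_rV_box.
have muY : mu n Y = (s * 2 ^+ m)%:E.
  rewrite /Y lebesgue_rV_box// big_ord_recl (eq_bigr (fun=> 2%:E)).
    by rewrite prodEFin prodr_const card_ord /A eqxx [X in (X * _)%E](@lebesgue_measure_itv R `]0, s[) /= lte_fin s0 -EFinD subr0.
  by move=> i _; rewrite /A /= lebesgue_measure_segment; [congr EFin; lra|lra].
have YE (x : V) : Y x -> 0 < x ord0 ord0 < s /\ forall i, `|x ord0 i| <= 1.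
  move=> Yx; have x0 : 0 < x ord0 ord0 < s by have := Yx ord0; rewrite /A eqxx /= in_itv.
  split=> // i; have [->|i0] := eqVneq i ord0.
    by have /andP[x00 x0s] := x0; rewrite gtr0_norm// (le_trans (ltW x0s)).
  by have := Yx i; rewrite /A (negPf i0) /= in_itv/= ler_norml.
rewrite (_ : _ * _ = layer_const * s `^ (- a) * (s * 2 ^+ m)); last first.
  rewrite (_ : 1 - a = - a + 1); last lra.
  rewrite powRD ?(gt_eqF s0) ?implybT// powRr1 ?(ltW s0)//; lra.
rewrite EFinM -muY; apply: ge_integral_subset => //.
- move=> x /YE[x0 x1]; apply: sE; split=> //.
  rewrite [leLHS]/Num.norm /= mx_normrE; apply/bigmax_leP; split=> [//|[k i] _] /=.
  by rewrite !mxE.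
- by rewrite mulr_ge0 ?powR_ge0// ltW// layer_const_gt0.
- by move=> x /E0 x0; apply/frac_div_layer_ge0/ltW.
- by move=> x /YE[x0 x1]; exact: frac_div_layer_ge.
Qed.

End at_scale.
End lower_bound.

Section divergence.
Context (R : realType).
Notation mu1 := (@lebesgue_measure R).

Definition inv_tail (t : R) : R := \1_(`[1, +oo[%classic : set R) t * t `^ (- 1).

Lemma inv_tail_ge0 t : 0 <= inv_tail t.
Proof. by rewrite mulr_ge0 ?powR_ge0. Qed.

Lemma measurable_inv_tail : measurable_fun [set: measurableTypeR R] inv_tail.
Proof.
apply: measurable_funM; last exact: measurable_powR.
by apply: measurable_indic; exact: measurable_itv.
Qed.

(* With [I] the integral, the substitution [t -> 2t] gives [I >= I + 1/2]. *)
Lemma integral_inv_tail : (\int[mu1]_t (inv_tail t)%:E = +oo)%E.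
Proof.
pose B : set R := `[2^-1, 1[%classic.
have mB : measurable (B : set (measurableTypeR R)) by exact: measurable_itv.
have le t : inv_tail t + \1_B t <= 2 * inv_tail (2 * t).
  rewrite /inv_tail !indicE /B; have [t1|t1] := leP 1 t.
    have t0 : 0 < t by lra.
    rewrite mem_set/= ?in_itv/= ?andbT// memNset/= ?in_itv/=; last by apply/negP; rewrite negb_and -leNgt t1 orbT.
    rewrite mem_set/= ?in_itv/= ?andbT; last by lra.
    by rewrite !mul1r addr0 !powR_inv1 ?invfM; lra.
  rewrite memNset/= ?in_itv/= ?andbT; last by apply/negP; rewrite -ltNge.
  rewrite mul0r add0r; have [t2|t2] := leP 2^-1 t; last first.
    rewrite memNset/= ?in_itv/=; last by apply/negP; rewrite negb_and -ltNge t2.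
    by rewrite mulr_ge0// mulr_ge0// powR_ge0.
  rewrite mem_set/= ?in_itv/= ?t2//.
  rewrite mem_set/= ?in_itv/= ?andbT; last by lra.
  have t0 : 0 < t by lra.
  rewrite mul1r powR_inv1; last lra.
  by rewrite invfM mulrA divff// mul1r invr_ge1 ?ltW// unitfE gt_eqF.
have I0 : (0 <= \int[mu1]_t (inv_tail t)%:E)%E by apply: integral_ge0 => t _; rewrite lee_fin inv_tail_ge0.
have H : (\int[mu1]_t (inv_tail t)%:E + (2^-1)%:E <= \int[mu1]_t (inv_tail t)%:E)%E.
  have muB : (\int[mu1]_t (\1_B t)%:E = (2^-1)%:E)%E.
    rewrite integral_indic// setIT [LHS](@lebesgue_measure_itv R `[2^-1, 1[) /= lte_fin.
    by rewrite ifT; [rewrite -EFinB; congr EFin|]; lra.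
  have mg : measurable_fun [set: measurableTypeR R] (fun t => (inv_tail t)%:E).
    by apply/measurable_EFinP; exact: measurable_inv_tail.
  rewrite -muB -(@ge0_integralD _ _ R mu1)//; last 2 first.
  - by move=> t _; rewrite lee_fin inv_tail_ge0.
  - by apply/measurable_EFinP; exact: measurable_indic.
  apply: (@le_trans _ _ (\int[mu1]_t (2 * inv_tail (2 * t))%:E)%E).
    apply: ge0_le_integral_nomeas => t _; last by rewrite -EFinD lee_fin.
    by rewrite -EFinD lee_fin addr_ge0 ?inv_tail_ge0.
  rewrite (ge0_integral_EFinZl mu1)//; last 2 first.
  - apply: (measurableT_comp measurable_inv_tail); exact: mulrl_measurable.
  - by move=> t; exact: inv_tail_ge0.
  rewrite (@ge0_integral_scale R 2 (fun t => (inv_tail t)%:E))//; last first.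
    by move=> t; rewrite lee_fin inv_tail_ge0.
  by rewrite muleA -EFinM gtr0_norm// divff// mul1e.
move: I0 H; case: (\int[mu1]_t _)%E => [r| |]//= _.
by rewrite -EFinD lee_fin => H; exfalso; lra.
Qed.

End divergence.

Section superlevels.
Context (R : realType) (m : nat) (a : R).
Hypothesis a01 : 0 < a < 1.
Notation n := m.+1.
Notation V := 'rV[R]_n.

Lemma unit_test_field0 : unit_test_field (cst 0 : V -> V).
Proof.
split.
- by move=> k; exact: Ck_cst.
- rewrite /compactly_supported (_ : [set _ | _] = set0) ?closure0; first exact: compact0.
  by apply/seteqP; split=> // x /=; rewrite eqxx.
- rewrite unlock; case: ifP => // _; apply/ess_supP; apply: nearW => x /=.
  rewrite /enorm /dotrV big1 ?sqrtr0 ?normr0//.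
  by move=> i _; rewrite mxE mul0r.
Qed.

(** The zero field is admissible. For levels below 1 this is the only bound on the perimeter that
    the divergence argument uses. *)
Lemma frac_perimeter_ge0 (E : set V) : (0 <= frac_perimeter a E)%E.
Proof.
apply: ereal_sup_ubound; exists (cst 0); first exact: unit_test_field0.
apply: integral0_eq => x _; rewrite frac_div_shift//; last exact: unit_test_field0.
rewrite /Rintegral integral0_eq ?mulr0// => h _.
by rewrite /frac_integrand big1// => i _; rewrite subrr mulr0.
Qed.

Lemma frac_perimeter_superlevel (t : R) : 1 <= t ->
  ((2 ^+ m * layer_const m a * t^-1)%:E <=
   frac_perimeter a [set x : V | (t < competitor a x)%R])%E.
Proof.
move=> t1; have t0 : 0 < t by exact: lt_le_trans t1.
have [a0 a1] := andP a01.
(* This solves s^(a-1) = t, so the profile exceeds [t] for 0 < x_0 < s. The assumption 1 <= t gives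
   s <= 1, which keeps the layer inside the truncation of [gfun]. *)
pose s := t^-1 `^ (1 - a)^-1.
have ti0 : 0 < t^-1 by rewrite invr_gt0.
have s0 : 0 < s by rewrite powR_gt0.
have sE : s `^ (1 - a) = t^-1 by rewrite -powRrM mulVf ?powRr1 ?(ltW ti0)//; lra.
have s1 : s <= 1.
  have -> : 1 = 1 `^ (1 - a)^-1 :> R by rewrite powR1.
  apply: ge0_ler_powR; rewrite ?nnegrE ?(ltW ti0)//.
    by rewrite invr_ge0; lra.
  by rewrite invf_le1.
rewrite -sE; apply: frac_perimeter_layer => // x /=.
  rewrite /competitor /gfun => xt; rewrite ltNge; apply/negP => x0.
  move: xt; apply/negP; rewrite -leNgt (le_trans _ (ltW t0))// mulr_le0_ge0 ?eta_ge0//.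
  by case: ifP => // _; rewrite mulr_le0_ge0 ?powR_ge0// sgr_le0.
move=> [/andP[x0 xs] x1]; rewrite /competitor eta_eq1// mulr1 /gfun gtr0_norm// ifT; last first.
  exact: lt_le_trans s1.
rewrite gtr0_sg// mul1r -(opprB 1 a) powRN -[t]invrK -sE ltf_pV2 ?posrE ?powR_gt0//.
by apply: gt0_ltr_powR; rewrite ?nnegrE ?ltW//; lra.
Qed.

(** The comparison with c/t goes through [ge0_le_integral_nomeas], so measurability of the perimeter
    as a function of [t] does not have to be established. *)
Lemma integral_frac_perimeter_superlevel :
  (\int[@lebesgue_measure R]_t
     frac_perimeter a [set x : V | (t < competitor a x)%R] = +oo)%E.
Proof.
pose c := 2 ^+ m * layer_const m a.
have c0 : 0 < c by rewrite mulr_gt0 ?layer_const_gt0// exprn_gt0.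
apply/eqP; rewrite eq_le leey/=.
apply: (@le_trans _ _ (\int[@lebesgue_measure R]_t (c * inv_tail t)%:E)%E).
  rewrite (ge0_integral_EFinZl _ (ltW c0) (@measurable_inv_tail R) (@inv_tail_ge0 R)).
  by rewrite integral_inv_tail gt0_muley// lte_fin.
apply: ge0_le_integral_nomeas => t _.
  by rewrite lee_fin mulr_ge0 ?inv_tail_ge0// ltW.
have [t1|t1] := leP 1 t; last first.
  rewrite /inv_tail indicE memNset ?mul0r ?mulr0 ?frac_perimeter_ge0//=.
  by rewrite in_itv/= andbT; apply/negP; rewrite -ltNge.
rewrite /inv_tail indicE mem_set /= ?in_itv/= ?t1// mul1r powR_inv1; last lra.
exact: frac_perimeter_superlevel.
Qed.

End superlevels.

Theorem corollary5p6 (R : realType) (n : nat) (alpha : R)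
    (hn : (1 <= n)%N) (halpha : 0 < alpha < 1) :
  exists f : 'rV[R]_n -> R,
    frac_BV alpha f /\
    (\int[@lebesgue_measure R]_t
       frac_perimeter alpha [set x : 'rV[R]_n | (t < f x)%R]
     = +oo)%E.
Proof.
case: n hn => // m _; exists (competitor alpha); split.
  exact: competitor_BV.
exact: integral_frac_perimeter_superlevel.
Qed.
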